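(* Let $\alpha,\beta$ be real numbers with $0<\alpha<2$, $0<\beta<2$ and $\alpha\beta<2$. Let $\mu\in\mathbb{C}$ be arbitrary, let $\epsilon>0$, and let $\theta$ be a real number satisfying $$\frac{\pi\alpha\beta}{2}<\theta\le \min(\pi,\pi\alpha\beta).$$ Put $\epsilon_\alpha:=\epsilon^{1/\beta}$, $\epsilon_\beta:=\epsilon^{1/\alpha}$, $\theta_\alpha:=\theta/\beta$, $\theta_\beta:=\theta/\alpha$, and assume $\theta_\alpha<\pi$ and $\theta_\beta<\pi$ (so that the regions below are defined). If $x\in\Omega^{(-)}(\epsilon_\alpha;\theta_\alpha)$ and $y\in\Omega^{(+)}(\epsilon_\beta;\theta_\beta)$, then $$E_{\alpha,\beta}(x,y;\mu)=\frac{1}{\beta}\,\frac{e^{y^{1/\beta}}\,y^{\frac{1+\alpha-\mu}{\beta}}}{y^{\alpha/\beta}-x}+\frac{1}{2\pi i}\,\frac{1}{\alpha\beta}\int_{\gamma(\epsilon;\theta)}\frac{e^{\zeta^{1/(\alpha\beta)}}\,\zeta^{\frac{1+\alpha+\beta-\mu}{\alpha\beta}-1}}{(\zeta^{1/\alpha}-y)(\zeta^{1/\beta}-x)}\,d\zeta .$$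
   Context: For $\alpha,\beta,\mu\in\mathbb{C}$ with $\Re(\alpha),\Re(\beta)>0$ and $x,y\in\mathbb{C}$, the generalized Mittag-Leffler type function of two variables is the entire function $$E_{\alpha,\beta}(x,y;\mu):=\sum_{n,m\ge 0}\frac{x^n y^m}{\Gamma(n\alpha+m\beta+\mu)},$$ with the convention $1/\Gamma=0$ at the poles of $\Gamma$. For $\epsilon>0$ and $0<\theta\le\pi$, the Hankel contour $\gamma(\epsilon;\theta)$ consists of the ray $\{\arg\zeta=-\theta,\ |\zeta|\ge\epsilon\}$, the circular arc $\{|\zeta|=\epsilon,\ -\theta\le\arg\zeta\le\theta\}$ and the ray $\{\arg\zeta=\theta,\ |\zeta|\ge\epsilon\}$, oriented by non-decreasing $\arg\zeta$ (it comes in from infinity along the ray $\arg\zeta=-\theta$, traverses the arc counterclockwise, and goes out to infinity along the ray $\arg\zeta=\theta$). If $\theta=\pi$, the contour is the circle $|\zeta|=\epsilon$ together with the ray $-\infty<\zeta\le-\epsilon$ traversed twice (with $\arg\zeta=-\pi$ inward and $\arg\zeta=\pi$ outward). For $0<\theta<\pi$ the contour $\gamma(\epsilon;\theta)$ divides the complex plane into two unbounded regions: $\Omega^{(-)}(\epsilon;\theta)$, to the left of the contour by orientation, i.e. $\{|z|<\epsilon\}\cup\{z\neq0:\ \theta<|\arg z|\le\pi\}$; and $\Omega^{(+)}(\epsilon;\theta)$, to the right of it, i.e. $\{|z|>\epsilon,\ |\arg z|<\theta\}$. Powers $\zeta^{s}$ on the contour are $\exp(s(\ln|\zeta|+i\arg\zeta))$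 with the value of $\arg\zeta\in[-\theta,\theta]$ given by the parametrization of the contour; powers of $y$ are principal values. *)

(* Defs.v *)
From Stdlib Require Import Reals Factorial List ClassicalEpsilon.
From Coquelicot Require Import Coquelicot.
Open Scope R_scope.

Definition Cexp (z : C) : C :=
  (exp (Re z) * cos (Im z), exp (Re z) * sin (Im z)).

(* Values in (-PI, PI]; only meaningful for z <> 0. *)
Definition Arg (z : C) : R :=
  if Rle_dec 0 (Im z) then acos (Re z / Cmod z) else - acos (Re z / Cmod z).

(* The power zeta^s at the point of the Riemann surface of the logarithm with
   |zeta| = r and arg zeta = phi; phi is not reduced modulo 2 PI. *)
Definition polar_pow (r phi : R) (s : C) : C := Cexp (s * (ln r, phi)).

(* Principal value; only meaningful for z <> 0. *)
Definition Cppow (z s : C) : C := polar_pow (Cmod z) (Arg z) s.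

(* z (z + 1) ... (z + n), with n + 1 factors *)
Fixpoint Crising (z : C) (n : nat) : C :=
  match n with
  | O => z
  | S k => (Crising z k * (z + INR n))%C
  end.

Definition Climit_seq (u : nat -> C) : C :=
  iota (T := C_CompleteNormedModule)
    (fun l : C => filterlim u eventually (locally l)).

Definition CGamma_pole (z : C) : Prop := exists k : nat, z = (- INR k)%C.

(* Euler-Gauss limit
   Gamma(z) = lim_n n! n^z / (z (z + 1) ... (z + n)),
   which holds at every z that is not a pole. *)
Definition CGamma (z : C) : C :=
  Climit_seq (fun n =>
    (INR (fact n) * polar_pow (INR n) 0 z / Crising z n)%C).

(* 1 / Gamma, extended by 0 at the poles of Gamma *)
Definition rCGamma (z : C) : C :=
  if excluded_middle_informative (CGamma_pole z) then RtoC 0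
  else (/ CGamma z)%C.

Definition Csum_list (a : nat -> nat -> C) (l : list (nat * nat)) : C :=
  fold_right (fun p s => (a (fst p) (snd p) + s)%C) (RtoC 0) l.

(* Unordered summation over nat * nat: the limit of the sums over finite index
   sets (duplicate-free lists), directed by inclusion. For complex terms this
   is the same as absolute convergence. *)
Definition is_double_sum (a : nat -> nat -> C) (s : C) : Prop :=
  forall eps : R, 0 < eps ->
  exists l0 : list (nat * nat), forall l : list (nat * nat),
    NoDup l -> incl l0 l -> Cmod (Csum_list a l - s) < eps.

Definition ex_double_sum (a : nat -> nat -> C) : Prop :=
  exists s : C, is_double_sum a s.

Definition double_sum (a : nat -> nat -> C) : C :=
  iota (T := C_CompleteNormedModule) (is_double_sum a).

Definition ML2_term (alpha beta x y mu : C) (n m : nat) : C :=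
  (x ^ n * y ^ m * rCGamma (INR n * alpha + INR m * beta + mu))%C.

(* E_{alpha,beta}(x, y; mu) *)
Definition ML2 (alpha beta x y mu : C) : C :=
  double_sum (ML2_term alpha beta x y mu).

Definition Omega_minus (eps theta : R) (z : C) : Prop :=
  Cmod z < eps \/ (z <> RtoC 0 /\ theta < Rabs (Arg z) <= PI).

Definition Omega_plus (eps theta : R) (z : C) : Prop :=
  eps < Cmod z /\ Rabs (Arg z) < theta.

(* An integrand on gamma(eps; theta) is given as F r phi, where r = |zeta| and
   phi = arg zeta in [-theta, theta], so that the two rays carry different
   values of F even when theta = PI and they coincide as sets.
   On a ray d zeta = e^{i phi} dr, on the arc d zeta = i eps e^{i phi} d phi. *)
Definition hankel_ray (F : R -> R -> C) (phi r : R) : C :=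
  (F r phi * Cexp (Ci * phi))%C.

Definition hankel_arc (F : R -> R -> C) (eps phi : R) : C :=
  (F eps phi * (Ci * eps * Cexp (Ci * phi)))%C.

Definition ex_hankel_int (F : R -> R -> C) (eps theta : R) : Prop :=
  ex_RInt_gen (V := C_R_NormedModule) (hankel_ray F (- theta))
    (Rbar_locally p_infty) (at_point eps) /\
  ex_RInt (V := C_R_NormedModule) (hankel_arc F eps) (- theta) theta /\
  ex_RInt_gen (V := C_R_NormedModule) (hankel_ray F theta)
    (at_point eps) (Rbar_locally p_infty).

Definition hankel_int (F : R -> R -> C) (eps theta : R) : C :=
  (RInt_gen (V := C_R_CompleteNormedModule) (hankel_ray F (- theta))
     (Rbar_locally p_infty) (at_point eps) +
   RInt (V := C_R_CompleteNormedModule) (hankel_arc F eps) (- theta) theta +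
   RInt_gen (V := C_R_CompleteNormedModule) (hankel_ray F theta)
     (at_point eps) (Rbar_locally p_infty))%C.

Definition ML2_integrand (alpha beta : R) (x y mu : C) (r phi : R) : C :=
  (Cexp (polar_pow r phi (1 / (alpha * beta)))
     * polar_pow r phi ((1 + alpha + beta - mu) / (alpha * beta) - 1)
   / ((polar_pow r phi (1 / alpha) - y) * (polar_pow r phi (1 / beta) - x)))%C.

(* Main.v *)
(* Put zeta = u^(alpha beta), with u = e^w. The integral becomes the Hankel integral of
   e^u u^(alpha + beta - mu) / ((u^beta - y) (u^alpha - x)) du over an opening th with
   pi/2 < th <= pi, and on a contour of large radius both factors expand into geometric series,
   uniformly in u. Integrating term by term against Hankel's formula
   1/Gamma(z) = (2 pi i)^-1 int e^u u^-z du gives E. Shrinking the contour to the given radius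
   crosses the single pole u = y^(1/beta), whose residue is the explicit term; the other factor
   has no zero because x is on the left of the contour. In the coordinate w all contours are
   boundaries of rectangles.

   Hankel's formula is obtained from Gauss's limit: with e^u replaced by (1 - u/m)^-m, which
   decays in all directions, repeated integration by parts leaves one simple pole at u = m and
   evaluates the integral to the reciprocal of Gauss's quotient; then m -> oo. *)
Require Import Defs.
From Stdlib Require Import Reals Factorial Lra Lia Psatz Permutation List ClassicalEpsilon.
From Coquelicot Require Import Coquelicot.
Open Scope R_scope.

(** * Continuity and differentiability of complex functions *)

(** The logarithmic coordinate removes every branch cut: powers become entire exponentials, the two
    rays stay distinct lines even at opening $\pi$, and only rectangles occur, for which Cauchy's
    theorem follows by differentiating a parameter integral. For that reason a function is always
    accompanied by a continuous derivative.

    The obstacle is uniformity in $m$. Since $(1-u/m)^{-m}$ decays only like a power of $|u|$, no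
    exponential can majorise the whole family. On the rays both it and $e^u$ are bounded by
    $C_K|u|^{-K}$, with $K$ as large as required and $C_K$ independent of $m\ge K$; the error of the
    approximation is then $O(1/m)$ on the whole contour.

    [CGamma] is a limit of quotients whose existence has to be shown. The contour argument yields
    the limit of the reciprocals; inverting it requires that this limit is not zero away from the
    poles, which rests on a separate monotonicity argument. The convergence of the double series is
    likewise a conclusion: its sum is introduced as a contour integral, and the finite partial sums
    are shown to approach it. *)

Lemma continuous_C {U : UniformSpace} (f : U -> C) (x : U) :
  continuous (fun u => Re (f u)) x -> continuous (fun u => Im (f u)) x ->
  continuous f x.
Proof.
intros H1 H2 P [e He].
assert (B : forall a b : R, ball (Re (f x)) e a -> ball (Im (f x)) e b -> P (a, b)).
{ intros a b Ha Hb. apply He. split; assumption. }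
assert (L1 : locally x (fun u => ball (Re (f x)) e (Re (f u)))).
{ apply H1. exists e. intros y Hy; exact Hy. }
assert (L2 : locally x (fun u => ball (Im (f x)) e (Im (f u)))).
{ apply H2. exists e. intros y Hy; exact Hy. }
change (locally x (fun u => P (f u))).
generalize (filter_and _ _ L1 L2). apply filter_imp.
intros u [Ha Hb]. rewrite (surjective_pairing (f u)). now apply B.
Qed.

Lemma continuous_Re {U : UniformSpace} (f : U -> C) (x : U) :
  continuous f x -> continuous (fun u => Re (f u)) x.
Proof. intros H. apply (continuous_comp f (@fst R R)); [exact H | apply continuous_fst]. Qed.

Lemma continuous_Im {U : UniformSpace} (f : U -> C) (x : U) :
  continuous f x -> continuous (fun u => Im (f u)) x.
Proof. intros H. apply (continuous_comp f (@snd R R)); [exact H | apply continuous_snd]. Qed.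

Lemma continuous_Cplus {U : UniformSpace} (f g : U -> C) (x : U) :
  continuous f x -> continuous g x -> continuous (fun u => (f u + g u)%C) x.
Proof.
intros Hf Hg. apply continuous_C; cbn.
- apply (continuous_plus (V := R_NormedModule)); now apply continuous_Re.
- apply (continuous_plus (V := R_NormedModule)); now apply continuous_Im.
Qed.

Lemma continuous_Copp {U : UniformSpace} (f : U -> C) (x : U) :
  continuous f x -> continuous (fun u => (- f u)%C) x.
Proof.
intros Hf. apply continuous_C; cbn.
- apply (continuous_opp (V := R_NormedModule)); now apply continuous_Re.
- apply (continuous_opp (V := R_NormedModule)); now apply continuous_Im.
Qed.

Lemma continuous_Cminus {U : UniformSpace} (f g : U -> C) (x : U) :
  continuous f x -> continuous g x -> continuous (fun u => (f u - g u)%C) x.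
Proof. intros Hf Hg. apply continuous_Cplus; [|apply continuous_Copp]; assumption. Qed.

Lemma continuous_Cmult {U : UniformSpace} (f g : U -> C) (x : U) :
  continuous f x -> continuous g x -> continuous (fun u => (f u * g u)%C) x.
Proof.
intros Hf Hg.
pose proof (continuous_Re _ _ Hf). pose proof (continuous_Im _ _ Hf).
pose proof (continuous_Re _ _ Hg). pose proof (continuous_Im _ _ Hg).
apply continuous_C; cbn.
- apply (continuous_minus (V := R_NormedModule));
  apply (continuous_mult (K := R_AbsRing)); assumption.
- apply (continuous_plus (V := R_NormedModule));
  apply (continuous_mult (K := R_AbsRing)); assumption.
Qed.

Lemma Csqr_sum_neq_0 (z : C) : z <> RtoC 0 -> Re z ^ 2 + Im z ^ 2 <> 0.
Proof.
intros Hz H. apply Hz. destruct z as [a b]. cbn in H.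
assert (a = 0) by nra. assert (b = 0) by nra. subst. reflexivity.
Qed.

Lemma continuous_Rsqr_sum {U : UniformSpace} (f g : U -> R) (x : U) :
  continuous f x -> continuous g x -> continuous (fun u => f u ^ 2 + g u ^ 2) x.
Proof.
intros Hf Hg.
apply (continuous_ext (fun u => f u * f u + g u * g u)); [intros u; cbn; ring|].
apply (continuous_plus (V := R_NormedModule)).
- now apply (continuous_mult (K := R_AbsRing)).
- now apply (continuous_mult (K := R_AbsRing)).
Qed.

Lemma continuous_Cinv {U : UniformSpace} (f : U -> C) (x : U) :
  continuous f x -> f x <> RtoC 0 -> continuous (fun u => (/ f u)%C) x.
Proof.
intros Hf H0.
pose proof (continuous_Re _ _ Hf). pose proof (continuous_Im _ _ Hf).
assert (K : continuous (fun u => / (Re (f u) ^ 2 + Im (f u) ^ 2)) x).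
{ apply (continuous_comp (fun u => Re (f u) ^ 2 + Im (f u) ^ 2) Rinv).
  - now apply continuous_Rsqr_sum.
  - now apply continuous_Rinv, Csqr_sum_neq_0. }
apply continuous_C; cbn.
- apply (continuous_mult (K := R_AbsRing)); assumption.
- apply (continuous_mult (K := R_AbsRing)); [|assumption].
  now apply (continuous_opp (V := R_NormedModule)).
Qed.

Lemma continuous_Cdiv {U : UniformSpace} (f g : U -> C) (x : U) :
  continuous f x -> continuous g x -> g x <> RtoC 0 -> continuous (fun u => (f u / g u)%C) x.
Proof. intros Hf Hg H. apply continuous_Cmult; [|apply continuous_Cinv]; assumption. Qed.

Lemma continuous_Cpow {U : UniformSpace} (f : U -> C) (n : nat) (x : U) :
  continuous f x -> continuous (fun u => (f u ^ n)%C) x.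
Proof.
intros Hf. induction n as [|n IH]; cbn.
- apply continuous_const.
- now apply continuous_Cmult.
Qed.

Lemma continuous_Cexp {U : UniformSpace} (f : U -> C) (x : U) :
  continuous f x -> continuous (fun u => Cexp (f u)) x.
Proof.
intros Hf.
pose proof (continuous_Re _ _ Hf). pose proof (continuous_Im _ _ Hf).
apply continuous_C; cbn.
- apply (continuous_mult (K := R_AbsRing)).
  + now apply (continuous_comp (fun u => Re (f u)) exp); [|apply continuous_exp].
  + now apply (continuous_comp (fun u => Im (f u)) cos); [|apply continuous_cos].
- apply (continuous_mult (K := R_AbsRing)).
  + now apply (continuous_comp (fun u => Re (f u)) exp); [|apply continuous_exp].
  + now apply (continuous_comp (fun u => Im (f u)) sin); [|apply continuous_sin].
Qed.

Lemma continuous_RtoC {U : UniformSpace} (f : U -> R) (x : U) :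
  continuous f x -> continuous (fun u => RtoC (f u)) x.
Proof. intros H. apply continuous_C; cbn; [exact H | apply continuous_const]. Qed.

Lemma continuous_Cpair {U : UniformSpace} (f g : U -> R) (x : U) :
  continuous f x -> continuous g x -> continuous (fun u => ((f u, g u) : C)) x.
Proof. intros Hf Hg. apply continuous_C; assumption. Qed.

(** * Algebra of the exponential, moduli and neighbourhoods *)

Lemma Cexp_plus (z w : C) : Cexp (z + w) = (Cexp z * Cexp w)%C.
Proof.
destruct z as [a b], w as [c d]. unfold Cexp; cbn.
rewrite exp_plus, cos_plus, sin_plus. unfold Cmult; cbn. f_equal; ring.
Qed.

Lemma Cexp_0 : Cexp 0 = RtoC 1.
Proof. unfold Cexp; cbn. rewrite exp_0, cos_0, sin_0. unfold RtoC. f_equal; ring. Qed.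

Lemma Cexp_Rexp (x : R) : Cexp x = RtoC (exp x).
Proof. unfold Cexp; cbn. rewrite cos_0, sin_0. unfold RtoC. f_equal; ring. Qed.

Lemma Cmod_Cexp (z : C) : Cmod (Cexp z) = exp (Re z).
Proof.
unfold Cexp, Cmod; cbn. pose proof (exp_pos (Re z)).
pose proof (sin2_cos2 (Im z)) as E. unfold Rsqr in E.
replace (_ + _) with (exp (Re z) * exp (Re z)) by nra.
apply sqrt_square; lra.
Qed.

Lemma Cexp_neq_0 (z : C) : Cexp z <> RtoC 0.
Proof. apply Cmod_gt_0. rewrite Cmod_Cexp. apply exp_pos. Qed.

Lemma Cexp_opp (z : C) : Cexp (- z) = (/ Cexp z)%C.
Proof.
assert (E : (Cexp z * Cexp (- z))%C = RtoC 1).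
{ rewrite <- Cexp_plus. replace (z + - z)%C with (RtoC 0) by ring. apply Cexp_0. }
pose proof (Cexp_neq_0 z) as N.
transitivity (Cexp z * Cexp (- z) / Cexp z)%C.
- field. exact N.
- rewrite E. field. exact N.
Qed.

Lemma Cexp_minus (z w : C) : Cexp (z - w) = (Cexp z / Cexp w)%C.
Proof. unfold Cminus. now rewrite Cexp_plus, Cexp_opp. Qed.

Lemma Cexp_pow (z : C) (n : nat) : (Cexp z ^ n)%C = Cexp (INR n * z).
Proof.
induction n as [|n IH].
- cbn. replace (0 * z)%C with (RtoC 0) by ring. now rewrite Cexp_0.
- rewrite S_INR, RtoC_plus. cbn [Cpow].
  replace ((INR n + 1) * z)%C with (z + INR n * z)%C by ring.
  now rewrite Cexp_plus, <- IH.
Qed.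

Lemma Cexp_re_im (z : C) : Cexp z = (exp (Re z) * Cexp (Ci * Im z))%C.
Proof.
destruct z as [a b]. unfold Cexp, Cmult; cbn.
replace (0 * b - 1 * 0) with 0 by ring. replace (0 * 0 + 1 * b) with b by ring.
rewrite exp_0. f_equal; ring.
Qed.

Lemma norm_C_R (z : C) : @norm R_AbsRing C_R_NormedModule z = Cmod z.
Proof.
destruct z as [a b]. unfold norm; cbn. unfold prod_norm, Cmod, norm; cbn.
unfold abs; cbn. f_equal. rewrite !Rmult_1_r.
rewrite <- !Rabs_mult, !(Rabs_pos_eq) ; [reflexivity | nra | nra].
Qed.

Lemma Cmod_le_Re_Im (z : C) : Cmod z <= Rabs (Re z) + Rabs (Im z).
Proof.
destruct z as [a b]. unfold Cmod; cbn.
pose proof (Rabs_pos a). pose proof (Rabs_pos b).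
pose proof (pow2_abs a). pose proof (pow2_abs b). 
apply Rsqr_incr_0_var; [|lra]. rewrite Rsqr_sqrt by nra. unfold Rsqr. nra.
Qed.

Lemma Rabs_Im_le_Cmod (z : C) : Rabs (Im z) <= Cmod z.
Proof. eapply Rle_trans; [apply Rmax_r | apply Rmax_Cmod]. Qed.

Lemma locally_C_Cmod (w : C) (P : C -> Prop) :
  locally w P <-> exists d : posreal, forall v, Cmod (v - w) < d -> P v.
Proof.
split.
- intros [d Hd]. exists d. intros v Hv. apply Hd.
  now apply C_NormedModule_mixin_compat1.
- intros [d Hd].
  assert (H2 : 0 < d / 2) by (pose proof (cond_pos d); lra).
  exists (mkposreal _ H2). intros v [Hv1 Hv2]. apply Hd.
  eapply Rle_lt_trans; [apply Cmod_le_Re_Im|].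
  change (Rabs (fst v - fst w) < d / 2) in Hv1.
  change (Rabs (snd v - snd w) < d / 2) in Hv2.
  change (Rabs (fst v - fst w) + Rabs (snd v - snd w) < d). lra.
Qed.

Lemma filterlim_C_Cmod {T : Type} {F : (T -> Prop) -> Prop} {FF : Filter F}
  (f : T -> C) (l : C) :
  filterlim f F (locally l) <-> (forall e, 0 < e -> F (fun t => Cmod (f t - l) < e)).
Proof.
split.
- intros H e He. apply (H (fun z => Cmod (z - l) < e)). apply locally_C_Cmod. now exists (mkposreal e He).
- intros H P HP. apply locally_C_Cmod in HP. destruct HP as [d Hd].
  change (F (fun t => P (f t))).
  generalize (H d (cond_pos d)). apply filter_imp. intros t; apply Hd.
Qed.

Lemma Cmod_minus_sym (z w : C) : Cmod (z - w) = Cmod (w - z).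
Proof. rewrite <- Cmod_opp. f_equal. ring. Qed.

Lemma Cmod_triangle_inv (z w : C) : Cmod z - Cmod w <= Cmod (z - w).
Proof.
pose proof (Cmod_triangle (z - w) w) as H.
replace (z - w + w)%C with z in H by ring. lra.
Qed.

Lemma Cplus_0_r_inj (a b : C) : (a + 0)%C = (b + 0)%C -> a = b.
Proof. now rewrite !Cplus_0_r. Qed.

(* Forces the carrier to be syntactically [C] before calling [ring] or [field]. *)
Ltac Cnormalize := cbv beta; match goal with |- @eq _ ?a ?b =>
  change (UniformSpace.sort C_UniformSpace) with C in *; generalize (Cplus_0_r_inj a b);
  let H := fresh in intro H; apply H; clear H end.
Ltac Cring := Cnormalize; ring.
Ltac Cfield := Cnormalize; field.

(* Caratheodory's form of complex differentiability: the difference quotient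
   extends to a continuous function. *)
Definition is_Cderiv (f : C -> C) (w l : C) : Prop :=
  exists q : C -> C, continuous q w /\ q w = l /\
    locally w (fun v => f v = (f w + (v - w) * q v)%C).

Lemma is_Cderiv_continuous (f : C -> C) (w l : C) :
  is_Cderiv f w l -> continuous f w.
Proof.
intros (q & Hq & _ & Hf).
apply continuous_ext_loc with (fun v => (f w + (v - w) * q v)%C).
{ generalize Hf. apply filter_imp. intros v E. now rewrite E. }
apply continuous_Cplus; [apply continuous_const|].
apply continuous_Cmult; [|exact Hq].
apply continuous_Cminus; [apply continuous_id | apply continuous_const].
Qed.

Lemma is_Cderiv_eq (f : C -> C) (w l l' : C) :
  is_Cderiv f w l -> l = l' -> is_Cderiv f w l'.
Proof. now intros H <-. Qed.

Lemma is_Cderiv_const (c w : C) : is_Cderiv (fun _ => c) w 0.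
Proof.
exists (fun _ => RtoC 0). split; [apply continuous_const|]. split; [reflexivity|].
apply filter_forall. intros v. Cring.
Qed.

Lemma is_Cderiv_id (w : C) : is_Cderiv (fun v => v) w 1.
Proof.
exists (fun _ => RtoC 1). split; [apply continuous_const|]. split; [reflexivity|].
apply filter_forall. intros v. Cring.
Qed.

Lemma is_Cderiv_plus (f g : C -> C) (w a b : C) :
  is_Cderiv f w a -> is_Cderiv g w b -> is_Cderiv (fun v => f v + g v)%C w (a + b).
Proof.
intros (q & Hq & <- & Hf) (r & Hr & <- & Hg).
exists (fun v => (q v + r v)%C). split; [now apply continuous_Cplus|]. split; [reflexivity|].
generalize (filter_and _ _ Hf Hg). apply filter_imp. intros v [E1 E2].
rewrite E1, E2. Cring.
Qed.

Lemma is_Cderiv_mult (f g : C -> C) (w a b : C) :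
  is_Cderiv f w a -> is_Cderiv g w b ->
  is_Cderiv (fun v => f v * g v)%C w (a * g w + f w * b).
Proof.
intros Hf0 Hg0. pose proof (is_Cderiv_continuous _ _ _ Hg0) as Cg.
destruct Hf0 as (q & Hq & <- & Hf), Hg0 as (r & Hr & <- & Hg).
exists (fun v => (q v * g v + f w * r v)%C).
split; [|split; [reflexivity|]].
- apply continuous_Cplus; apply continuous_Cmult; try assumption; apply continuous_const.
- generalize (filter_and _ _ Hf Hg). apply filter_imp. intros v [E1 E2].
  rewrite E1, E2. Cring.
Qed.

(** In Caratheodory's form the slope of the composite is the product of the slopes, so points with
    [g v = g w] need no separate treatment. *)
Lemma is_Cderiv_comp (f g : C -> C) (w a b : C) :
  is_Cderiv f (g w) a -> is_Cderiv g w b -> is_Cderiv (fun v => f (g v)) w (a * b).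
Proof.
intros Hf0 Hg0. pose proof (is_Cderiv_continuous _ _ _ Hg0) as Cg.
destruct Hf0 as (q & Hq & <- & Hf), Hg0 as (r & Hr & <- & Hg).
exists (fun v => (q (g v) * r v)%C).
split; [|split; [reflexivity|]].
- apply continuous_Cmult; [|assumption]. now apply (continuous_comp g q).
- assert (Hf' : locally w (fun v => f (g v) = (f (g w) + (g v - g w) * q (g v))%C))
    by exact (Cg _ Hf).
  generalize (filter_and _ _ Hf' Hg). apply filter_imp. intros v [E1 E2].
  assert (E : (g v - g w = (v - w) * r v)%C) by (rewrite E2; Cring).
  rewrite E1, E. Cring.
Qed.

Lemma is_Cderiv_inv (f : C -> C) (w a : C) :
  is_Cderiv f w a -> f w <> RtoC 0 -> is_Cderiv (fun v => / f v)%C w (- a / (f w * f w)).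
Proof.
intros Hf0 H0. pose proof (is_Cderiv_continuous _ _ _ Hf0) as Cf.
destruct Hf0 as (q & Hq & <- & Hf).
exists (fun v => (- q v / (f v * f w))%C).
split; [|split; [reflexivity|]].
- apply continuous_Cdiv.
  + now apply continuous_Copp.
  + apply continuous_Cmult; [assumption | apply continuous_const].
  + now apply Cmult_neq_0.
- assert (N : locally w (fun v => f v <> RtoC 0)).
  { apply (Cf (fun z => z <> RtoC 0)). apply locally_C_Cmod.
    exists (mkposreal _ (proj1 (Cmod_gt_0 _) H0)). intros v Hv -> . cbn in Hv.
    rewrite Cmod_minus_sym in Hv. replace (f w - 0)%C with (f w) in Hv by Cring. lra. }
  generalize (filter_and _ _ N Hf). apply filter_imp. intros v [E1 E2].
  assert (E : (f v - f w = (v - w) * q v)%C) by (rewrite E2; ring).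
  transitivity (/ f w - (f v - f w) / (f v * f w))%C.
  + Cfield. now split.
  + rewrite E. Cfield. now split.
Qed.

(** * Complex-valued integrals *)

Notation CInt := (RInt (V := C_R_CompleteNormedModule)).
Notation ex_CInt := (ex_RInt (V := C_R_NormedModule)).
Notation is_CInt := (is_RInt (V := C_R_NormedModule)).

(** Bridge from the slope form to the derivative of Coquelicot: the remainder is [t - x] times
    [q t - q x], which is small by continuity of [q]. *)
Lemma is_derive_caratheodory {V : NormedModule R_AbsRing} (f q : R -> V) (x : R) :
  continuous q x ->
  locally x (fun t => f t = plus (f x) (scal (t - x) (q t))) ->
  is_derive f x (q x).
Proof.
intros Hq Hf. split; [apply is_linear_scal_l|].
intros y Hy. apply (is_filter_lim_locally_unique (V := AbsRing_NormedModule R_AbsRing)) in Hy.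
subst y. intros e.
assert (L : locally x (fun t => norm (minus (q t) (q x)) < e)).
{ apply (Hq (fun z => norm (minus z (q x)) < e)). apply locally_le_locally_norm.
  exists e. intros z Hz. exact Hz. }
generalize (filter_and _ _ Hf L). apply filter_imp. intros t [E1 E2].
rewrite E1.
match goal with |- norm ?X <= _ =>
  replace X with (scal (minus t x) (minus (q t) (q x))) end.
- eapply Rle_trans; [exact (norm_scal (K := R_AbsRing) (V := V) (t - x) _)|]. rewrite Rmult_comm.
  apply Rmult_le_compat_r; [apply norm_ge_0 | now left].
- change (minus t x) with (t - x).
  replace (minus (plus (f x) (scal (t - x) (q t))) (f x)) with (scal (t - x) (q t)).
  + etransitivity; [exact (scal_distr_l (V := V) (t - x) (q t) (opp (q x)))|].
    unfold minus. f_equal. exact (scal_opp_r (V := V) (t - x) (q x)).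
  + generalize (scal (t - x) (q t)). intros z. symmetry. unfold minus.
    rewrite (plus_comm (f x) z), <- plus_assoc.
    etransitivity; [|apply plus_zero_r]. f_equal. exact (plus_opp_r (G := NormedModule.AbelianGroup R_AbsRing V) (f x)).
Qed.

Lemma is_derive_C (f : R -> C) (x : R) (l : C) :
  is_derive (fun t => Re (f t)) x (Re l) -> is_derive (fun t => Im (f t)) x (Im l) ->
  is_derive (V := C_R_NormedModule) f x l.
Proof.
intros [_ H1] [_ H2]. split; [apply is_linear_scal_l|].
intros y Hy. specialize (H1 y Hy). specialize (H2 y Hy). intros e.
assert (He : 0 < e / 2) by (pose proof (cond_pos e); lra).
generalize (filter_and _ _ (H1 (mkposreal _ He)) (H2 (mkposreal _ He))).
apply filter_imp. intros t [E1 E2]. cbn [pos] in E1, E2.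
rewrite norm_C_R. eapply Rle_trans; [apply Cmod_le_Re_Im|].
eapply Rle_trans; [apply Rplus_le_compat; [exact E1 | exact E2]|].
apply Req_le. lra.
Qed.

Lemma scal_C_R (t : R) (z : C) : @scal R_AbsRing C_R_NormedModule t z = (t * z)%C.
Proof.
destruct z as [a b]. unfold scal, Cmult; cbn. unfold prod_scal, scal; cbn. unfold mult; cbn.
f_equal; ring.
Qed.

Lemma is_derive_Cderiv_line (F : C -> C) (w0 d l : C) (t : R) :
  is_Cderiv F (w0 + t * d)%C l ->
  is_derive (V := C_R_NormedModule) (fun t : R => F (w0 + t * d)%C) t (d * l)%C.
Proof.
intros (q & Hq & <- & HF).
assert (Cl : continuous (fun u : R => (w0 + u * d)%C) t).
{ apply continuous_Cplus; [apply continuous_const|].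
  apply continuous_Cmult; [|apply continuous_const].
  apply continuous_RtoC, continuous_id. }
apply (is_derive_caratheodory (V := C_R_NormedModule) _ (fun u : R => (d * q (w0 + u * d))%C)).
- apply continuous_Cmult; [apply continuous_const|].
  now apply (continuous_comp (fun u : R => (w0 + u * d)%C) q).
- generalize (Cl _ HF : locally t (fun u : R => F (w0 + u * d)%C =
    (F (w0 + t * d) + (w0 + u * d - (w0 + t * d)) * q (w0 + u * d))%C)).
  apply filter_imp. intros u E. rewrite scal_C_R, RtoC_minus. rewrite E at 1.
  change (@plus _) with Cplus. Cring.
Qed.

Lemma ex_CInt_continuous (f : R -> C) (a b : R) :
  (forall t, Rmin a b <= t <= Rmax a b -> continuous f t) -> ex_CInt f a b.
Proof. intros H. now apply (ex_RInt_continuous (V := C_R_CompleteNormedModule)). Qed.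

Lemma CInt_correct (f : R -> C) (a b : R) : ex_CInt f a b -> is_CInt f a b (CInt f a b).
Proof. intros H. now apply (RInt_correct (V := C_R_CompleteNormedModule)). Qed.

(** Gives access to theorems stated for real integrals, in particular differentiation under the
    integral sign. *)
Lemma CInt_components (f : R -> C) (a b : R) : ex_CInt f a b ->
  CInt f a b = (RInt (fun t => Re (f t)) a b, RInt (fun t => Im (f t)) a b).
Proof.
intros H. pose proof (CInt_correct _ _ _ H) as I.
pose proof (is_RInt_unique (V := R_CompleteNormedModule) _ _ _ _ (is_RInt_fct_extend_fst _ _ _ _ I)) as I1.
pose proof (is_RInt_unique (V := R_CompleteNormedModule) _ _ _ _ (is_RInt_fct_extend_snd _ _ _ _ I)) as I2.
change (RInt (fun t => Re (f t)) a b = Re (CInt f a b)) in I1.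
change (RInt (fun t => Im (f t)) a b = Im (CInt f a b)) in I2.
rewrite I1, I2. now destruct (CInt f a b).
Qed.

Lemma is_CInt_components (f : R -> C) (a b : R) (l : C) :
  is_RInt (fun t => Re (f t)) a b (Re l) -> is_RInt (fun t => Im (f t)) a b (Im l) ->
  is_CInt f a b l.
Proof.
intros H1 H2. rewrite (surjective_pairing l).
now apply (is_RInt_fct_extend_pair (U := R_NormedModule) (V := R_NormedModule)).
Qed.

Lemma is_CInt_Cmult (f : R -> C) (a b : R) (c l : C) :
  is_CInt f a b l -> is_CInt (fun t => c * f t)%C a b (c * l)%C.
Proof.
intros I.
pose proof (is_RInt_fct_extend_fst _ _ _ _ I) as I1.
pose proof (is_RInt_fct_extend_snd _ _ _ _ I) as I2.
apply is_CInt_components; cbn.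
- apply (is_RInt_minus (V := R_NormedModule));
  now apply (is_RInt_scal (V := R_NormedModule)).
- apply (is_RInt_plus (V := R_NormedModule));
  now apply (is_RInt_scal (V := R_NormedModule)).
Qed.

Lemma ex_CInt_Cmult (f : R -> C) (a b : R) (c : C) :
  ex_CInt f a b -> ex_CInt (fun t => c * f t)%C a b.
Proof. intros [l H]. exists (c * l)%C. now apply is_CInt_Cmult. Qed.

Lemma CInt_Cmult (f : R -> C) (a b : R) (c : C) :
  ex_CInt f a b -> CInt (fun t => c * f t)%C a b = (c * CInt f a b)%C.
Proof.
intros H. apply (is_RInt_unique (V := C_R_CompleteNormedModule)).
now apply is_CInt_Cmult, CInt_correct.
Qed.

Lemma CInt_minus (f g : R -> C) (a b : R) : ex_CInt f a b -> ex_CInt g a b ->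
  CInt (fun t => f t - g t)%C a b = (CInt f a b - CInt g a b)%C.
Proof. intros Hf Hg. now apply (RInt_minus (V := C_R_CompleteNormedModule)). Qed.

Lemma CInt_Chasles (f : R -> C) (a b c : R) : ex_CInt f a b -> ex_CInt f b c ->
  (CInt f a b + CInt f b c)%C = CInt f a c.
Proof. intros Hf Hg. now apply (RInt_Chasles (V := C_R_CompleteNormedModule)). Qed.

Lemma CInt_ext (f g : R -> C) (a b : R) :
  (forall t, Rmin a b < t < Rmax a b -> f t = g t) -> CInt f a b = CInt g a b.
Proof. apply (RInt_ext (V := C_R_CompleteNormedModule)). Qed.

Lemma Cmod_CInt_le (f : R -> C) (g : R -> R) (a b : R) : a <= b ->
  (forall t, a <= t <= b -> Cmod (f t) <= g t) -> ex_CInt f a b -> ex_RInt g a b ->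
  Cmod (CInt f a b) <= RInt g a b.
Proof.
intros Hab H Hf Hg. rewrite <- norm_C_R.
apply (norm_RInt_le (V := C_R_NormedModule) f g a b); [exact Hab | | |].
- intros t Ht. rewrite norm_C_R. now apply H.
- now apply CInt_correct.
- now apply (RInt_correct (V := R_CompleteNormedModule)).
Qed.

Lemma Cmod_CInt_le_const (f : R -> C) (M : R) (a b : R) : a <= b ->
  (forall t, a <= t <= b -> Cmod (f t) <= M) -> ex_CInt f a b ->
  Cmod (CInt f a b) <= (b - a) * M.
Proof.
intros Hab H Hf. rewrite <- (RInt_const (V := R_CompleteNormedModule) a b M : _ = (b - a) * M).
apply Cmod_CInt_le; try assumption. apply ex_RInt_const.
Qed.

Lemma CInt_derive_line (F F' : C -> C) (w0 d : C) (a b : R) :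
  (forall t, Rmin a b <= t <= Rmax a b ->
    is_Cderiv F (w0 + t * d)%C (F' (w0 + t * d)%C) /\ continuous F' (w0 + t * d)%C) ->
  CInt (fun t : R => (d * F' (w0 + t * d))%C) a b = (F (w0 + b * d) - F (w0 + a * d))%C.
Proof.
intros H. apply (is_RInt_unique (V := C_R_CompleteNormedModule)).
apply (is_RInt_derive (V := C_R_CompleteNormedModule) (fun t : R => F (w0 + t * d)%C)).
- intros t Ht. now apply is_derive_Cderiv_line, H.
- intros t Ht. apply continuous_Cmult; [apply continuous_const|].
  apply (continuous_comp (fun u : R => (w0 + u * d)%C) F'); [|now apply H].
  apply continuous_Cplus; [apply continuous_const|].
  apply continuous_Cmult; [|apply continuous_const].
  apply continuous_RtoC, continuous_id.
Qed.

(** * The complex exponential *)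

(** The mean value equality fails for complex values; the inequality comes from writing the
    increment as the integral of the derivative. *)
Lemma Cmod_mean_value (f f' : R -> C) (M : R) :
  (forall t, 0 <= t <= 1 -> is_derive (V := C_R_NormedModule) f t (f' t)) ->
  (forall t, 0 <= t <= 1 -> continuous f' t) ->
  (forall t, 0 <= t <= 1 -> Cmod (f' t) <= M) ->
  Cmod (f 1 - f 0) <= M.
Proof.
intros Hd Hc HM.
assert (I : is_CInt f' 0 1 (f 1 - f 0)%C).
{ apply (is_RInt_derive (V := C_R_CompleteNormedModule) f f');
  rewrite Rmin_left, Rmax_right by lra; assumption. }
rewrite <- (is_RInt_unique (V := C_R_CompleteNormedModule) _ _ _ _ I).
replace M with ((1 - 0) * M) by ring.
apply Cmod_CInt_le_const; [lra | assumption |]. eexists; exact I.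
Qed.

Lemma is_derive_Cexp_line (z : C) (t : R) :
  is_derive (V := C_R_NormedModule) (fun t : R => Cexp (t * z)) t (z * Cexp (t * z))%C.
Proof.
destruct z as [a b]. apply is_derive_C; unfold Cexp; cbn; auto_derive; auto; unfold Rminus; ring.
Qed.

Lemma continuous_Cexp_line (z : C) (t : R) : continuous (fun t : R => Cexp (t * z)) t.
Proof.
apply continuous_Cexp, continuous_Cmult; [|apply continuous_const].
apply continuous_RtoC, continuous_id.
Qed.

Lemma exp_le_exp (x y : R) : x <= y -> exp x <= exp y.
Proof. intros [H| ->]; [left; now apply exp_increasing | apply Rle_refl]. Qed.

Lemma Re_Rmult (t : R) (z : C) : Re (t * z)%C = t * Re z.
Proof. destruct z as [a b]. cbn. ring. Qed.

Lemma Im_Rmult (t : R) (z : C) : Im (t * z)%C = t * Im z.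
Proof. destruct z as [a b]. cbn. ring. Qed.

Lemma Re_scal_le_Cmod (z : C) (t : R) : 0 <= t <= 1 -> Re (t * z)%C <= Cmod z.
Proof.
intros Ht. rewrite Re_Rmult.
pose proof (re_le_Cmod z). pose proof (Rle_abs (Re z)). pose proof (Cmod_ge_0 z). nra.
Qed.

Lemma Cexp_minus_1_le (z : C) : Cmod (Cexp z - 1) <= Cmod z * exp (Cmod z).
Proof.
pose proof (Cmod_mean_value (fun t => Cexp (t * z)) (fun t => z * Cexp (t * z))%C
  (Cmod z * exp (Cmod z))) as H. cbv beta in H.
replace (1 * z)%C with z in H by ring. replace (0 * z)%C with (RtoC 0) in H by ring.
rewrite Cexp_0 in H. apply H.
- intros t _. apply is_derive_Cexp_line.
- intros t _. apply continuous_Cmult; [apply continuous_const | apply continuous_Cexp_line].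
- intros t Ht. rewrite Cmod_mult, Cmod_Cexp. apply Rmult_le_compat_l; [apply Cmod_ge_0|].
  apply exp_le_exp. now apply Re_scal_le_Cmod.
Qed.

Lemma is_derive_Rline (z : C) (t : R) :
  is_derive (V := C_R_NormedModule) (fun t : R => (t * z)%C) t z.
Proof. destruct z as [a b]. apply is_derive_C; cbn; auto_derive; auto; ring. Qed.

(** The first-order bound, applied to the derivative along the segment from 0 to [z], gains one more
    power of the modulus. *)
Lemma Cexp_minus_1_minus_id_le (z : C) :
  Cmod (Cexp z - 1 - z) <= Cmod z * (Cmod z * exp (Cmod z)).
Proof.
pose proof (Cmod_mean_value (fun t => Cexp (t * z) - t * z)%C
  (fun t => z * Cexp (t * z) - z)%C
  (Cmod z * (Cmod z * exp (Cmod z)))) as H. cbv beta in H.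
replace (1 * z)%C with z in H by ring. replace (0 * z)%C with (RtoC 0) in H by ring.
rewrite Cexp_0 in H.
replace (Cexp z - 1 - z)%C with (Cexp z - z - (1 - 0))%C by ring. apply H.
- intros t _. apply (is_derive_minus (V := C_R_NormedModule)).
  + apply is_derive_Cexp_line.
  + apply is_derive_Rline.
- intros t _. apply continuous_Cminus; [|apply continuous_const].
  apply continuous_Cmult; [apply continuous_const | apply continuous_Cexp_line].
- intros t Ht. replace (z * Cexp (t * z) - z)%C with (z * (Cexp (t * z) - 1))%C by ring.
  rewrite Cmod_mult. apply Rmult_le_compat_l; [apply Cmod_ge_0|].
  eapply Rle_trans; [apply Cexp_minus_1_le|].
  assert (Cmod (t * z) <= Cmod z).
  { rewrite Cmod_mult, Cmod_R, Rabs_pos_eq by lra. pose proof (Cmod_ge_0 z). nra. }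
  apply Rmult_le_compat; try assumption; [apply Cmod_ge_0 | left; apply exp_pos |].
  now apply exp_le_exp.
Qed.

(** The derivative of $-(1-tv)e^{tv}$ is $t\,v^2e^{tv}$: the first-order terms cancel, which leaves
    $|v|^2$. The bound [E] is a parameter because it can be 1 when $\Re v\le 0$, as on the rays, and
    has to be larger on the arc. *)
Lemma one_minus_Cexp_le (v : C) (E : R) :
  (forall t, 0 <= t <= 1 -> exp (t * Re v) <= E) ->
  Cmod (1 - (1 - v) * Cexp v) <= Cmod v * Cmod v * E.
Proof.
intros HE.
pose proof (Cmod_mean_value (fun t => - ((1 - t * v) * Cexp (t * v)))%C
  (fun t => t * (v * v * Cexp (t * v)))%C (Cmod v * Cmod v * E)) as H. cbv beta in H.
replace (1 * v)%C with v in H by ring. replace (0 * v)%C with (RtoC 0) in H by ring.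
rewrite Cexp_0 in H.
replace (1 - (1 - v) * Cexp v)%C with (- ((1 - v) * Cexp v) - - ((1 - 0) * 1))%C by ring.
apply H.
- intros t _. destruct v as [a b]. apply is_derive_C; unfold Cexp; cbn; auto_derive; auto; unfold Rminus; ring.
- intros t _. apply continuous_Cmult; [apply continuous_RtoC, continuous_id|].
  apply continuous_Cmult; [apply continuous_const | apply continuous_Cexp_line].
- intros t Ht. rewrite !Cmod_mult, Cmod_R, Rabs_pos_eq, Cmod_Cexp by lra.
  specialize (HE t Ht). rewrite Re_Rmult.
  pose proof (Cmod_ge_0 v). pose proof (exp_pos (t * Re v)).
  assert (0 <= Cmod v * Cmod v) by nra.
  assert (0 <= Cmod v * Cmod v * exp (t * Re v)) by (apply Rmult_le_pos; lra).
  apply Rle_trans with (Cmod v * Cmod v * exp (t * Re v)); [nra|].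
  now apply Rmult_le_compat_l.
Qed.

Lemma is_Cderiv_intro (f q : C -> C) (w : C) :
  continuous q w -> (forall v, f v = (f w + (v - w) * q v)%C) -> is_Cderiv f w (q w).
Proof. intros Hq Hf. exists q. split; [exact Hq|]. split; [reflexivity|]. now apply filter_forall. Qed.

Lemma continuous_C_Cmod (f : C -> C) (w : C) (K : R) :
  (forall v, Cmod (v - w) < 1 -> Cmod (f v - f w) <= K * Cmod (v - w)) -> continuous f w.
Proof.
intros H. apply filterlim_C_Cmod. intros e He.
pose proof (Rabs_pos K). pose proof (Rle_abs K).
assert (Hd : 0 < Rmin 1 (e / (1 + Rabs K))).
{ apply Rmin_glb_lt; [lra|]. apply Rdiv_lt_0_compat; lra. }
apply locally_C_Cmod. exists (mkposreal _ Hd). cbn. intros v Hv.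
pose proof (Rmin_l 1 (e / (1 + Rabs K))). pose proof (Rmin_r 1 (e / (1 + Rabs K))).
eapply Rle_lt_trans; [apply H; lra|].
pose proof (Cmod_ge_0 (v - w)).
apply Rle_lt_trans with ((1 + Rabs K) * Cmod (v - w)); [nra|].
apply Rlt_le_trans with ((1 + Rabs K) * (e / (1 + Rabs K))).
- apply Rmult_lt_compat_l; lra.
- apply Req_le. field. lra.
Qed.

Lemma is_Cderiv_Cexp (w : C) : is_Cderiv Cexp w (Cexp w).
Proof.
(* The difference quotient of the exponential, completed at [w]. The second-order bound makes it
   Lipschitz at [w] within distance 1, with constant $|e^w|e$. *)
set (q := fun v : C => if Ceq_dec v w then Cexp w else (Cexp w * ((Cexp (v - w) - 1) / (v - w)))%C).
replace (Cexp w) with (q w) by (unfold q; now destruct (Ceq_dec w w)).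
apply is_Cderiv_intro.
- apply (continuous_C_Cmod q w (Cmod (Cexp w) * exp 1)). intros v Hv.
  unfold q at 2. destruct (Ceq_dec w w) as [_|N]; [|now elim N].
  unfold q. destruct (Ceq_dec v w) as [->|N].
  + replace (Cexp w - Cexp w)%C with (RtoC 0) by ring. rewrite Cmod_0.
    apply Rmult_le_pos; [|apply Cmod_ge_0].
    apply Rmult_le_pos; [apply Cmod_ge_0 | left; apply exp_pos].
  + assert (N' : (v - w)%C <> RtoC 0).
    { intros E. apply N. replace v with (v - w + w)%C by ring. rewrite E. ring. }
    replace (Cexp w * ((Cexp (v - w) - 1) / (v - w)) - Cexp w)%C
      with (Cexp w * ((Cexp (v - w) - 1 - (v - w)) / (v - w)))%C by (field; exact N').
    rewrite Cmod_mult, Cmod_div, Rmult_assoc by exact N'.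
    apply Rmult_le_compat_l; [apply Cmod_ge_0|].
    pose proof (proj1 (Cmod_gt_0 _) N') as P.
    apply Rmult_le_reg_r with (Cmod (v - w)); [exact P|].
    unfold Rdiv. rewrite Rmult_assoc, Rinv_l, Rmult_1_r by lra.
    eapply Rle_trans; [apply Cexp_minus_1_minus_id_le|].
    assert (exp (Cmod (v - w)) <= exp 1) by (apply exp_le_exp; lra).
    pose proof (exp_pos 1).
    assert (0 <= Cmod (v - w) * Cmod (v - w)) by nra. nra.
- intros v. unfold q. destruct (Ceq_dec v w) as [->|N]; [ring|].
  assert (N' : (v - w)%C <> RtoC 0).
  { intros E. apply N. replace v with (v - w + w)%C by ring. rewrite E. ring. }
  rewrite Cexp_minus. field. split; [apply Cexp_neq_0 | exact N'].
Qed.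

(** * Calculus of continuously differentiable functions *)

(** Takes the place of holomorphy. Differentiability near the point and continuity of the derivative
    are what differentiation under the integral sign asks for, so no argument of Goursat's kind is
    needed. The derivative is an explicit argument, to be given as a formula. *)
Definition is_C1 (F F' : C -> C) (w : C) : Prop :=
  locally w (fun v => is_Cderiv F v (F' v)) /\ continuous F' w.

Lemma is_C1_Cderiv (F F' : C -> C) (w : C) : is_C1 F F' w -> is_Cderiv F w (F' w).
Proof. intros [H _]. now apply locally_singleton in H. Qed.

Lemma is_C1_continuous (F F' : C -> C) (w : C) : is_C1 F F' w -> continuous F w.
Proof. intros H. eapply is_Cderiv_continuous, is_C1_Cderiv, H. Qed.

Lemma is_C1_const (c w : C) : is_C1 (fun _ => c) (fun _ => RtoC 0) w.
Proof.
split; [|apply continuous_const]. apply filter_forall. intros v. apply is_Cderiv_const.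
Qed.

Lemma is_C1_id (w : C) : is_C1 (fun v => v) (fun _ => RtoC 1) w.
Proof. split; [|apply continuous_const]. apply filter_forall. intros v. apply is_Cderiv_id. Qed.

Lemma is_C1_plus (f f' g g' : C -> C) (w : C) : is_C1 f f' w -> is_C1 g g' w ->
  is_C1 (fun v => f v + g v)%C (fun v => f' v + g' v)%C w.
Proof.
intros [Hf Cf] [Hg Cg]. split; [|now apply continuous_Cplus].
generalize (filter_and _ _ Hf Hg). apply filter_imp. intros v [A B]. now apply is_Cderiv_plus.
Qed.

Lemma is_C1_mult (f f' g g' : C -> C) (w : C) : is_C1 f f' w -> is_C1 g g' w ->
  is_C1 (fun v => f v * g v)%C (fun v => f' v * g v + f v * g' v)%C w.
Proof.
intros Hf Hg. pose proof (is_C1_continuous _ _ _ Hf). pose proof (is_C1_continuous _ _ _ Hg).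
destruct Hf as [Hf Cf], Hg as [Hg Cg].
split; [|apply continuous_Cplus; now apply continuous_Cmult].
generalize (filter_and _ _ Hf Hg). apply filter_imp. intros v [A B]. now apply is_Cderiv_mult.
Qed.

Lemma locally_neq_0 (f : C -> C) (w : C) :
  continuous f w -> f w <> RtoC 0 -> locally w (fun v => f v <> RtoC 0).
Proof.
intros Cf H0. apply (Cf (fun z => z <> RtoC 0)). apply locally_C_Cmod.
exists (mkposreal _ (proj1 (Cmod_gt_0 _) H0)). intros v Hv -> . cbn in Hv.
rewrite Cmod_minus_sym in Hv. replace (f w - 0)%C with (f w) in Hv by ring. lra.
Qed.

Lemma is_C1_inv (f f' : C -> C) (w : C) : is_C1 f f' w -> f w <> RtoC 0 ->
  is_C1 (fun v => / f v)%C (fun v => - f' v / (f v * f v))%C w.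
Proof.
intros Hf H0. pose proof (is_C1_continuous _ _ _ Hf) as Cf0. destruct Hf as [Hf Cf].
split.
- generalize (filter_and _ _ Hf (locally_neq_0 _ _ Cf0 H0)). apply filter_imp.
  intros v [A B]. now apply is_Cderiv_inv.
- apply continuous_Cdiv; [now apply continuous_Copp | now apply continuous_Cmult |].
  now apply Cmult_neq_0.
Qed.

Lemma is_C1_Cexp (f f' : C -> C) (w : C) : is_C1 f f' w ->
  is_C1 (fun v => Cexp (f v)) (fun v => Cexp (f v) * f' v)%C w.
Proof.
intros Hf. pose proof (is_C1_continuous _ _ _ Hf) as Cf0. destruct Hf as [Hf Cf].
split.
- generalize Hf. apply filter_imp. intros v A. now apply is_Cderiv_comp; [apply is_Cderiv_Cexp|].
- apply continuous_Cmult; [now apply continuous_Cexp | assumption].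
Qed.

Lemma is_C1_linear (k w : C) : is_C1 (fun v => k * v)%C (fun _ => k) w.
Proof.
pose proof (is_C1_mult _ _ _ _ w (is_C1_const k w) (is_C1_id w)) as [H _].
split; [|apply continuous_const].
generalize H. apply filter_imp. intros v A. eapply is_Cderiv_eq; [exact A | Cring].
Qed.

Lemma is_C1_pow (f f' : C -> C) (n : nat) (w : C) : is_C1 f f' w ->
  is_C1 (fun v => f v ^ S n)%C (fun v => (INR n + 1) * f v ^ n * f' v)%C w.
Proof.
intros Hf. induction n as [|n IH].
- pose proof Hf as [H C0]. split.
  + generalize H. apply filter_imp. intros v A. change (INR 0) with 0. cbn [Cpow].
    pose proof (is_Cderiv_mult _ _ _ _ _ A (is_Cderiv_const 1 v)) as B.
    eapply is_Cderiv_eq; [exact B | Cring].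
  + apply continuous_Cmult; [apply continuous_const | exact C0].
- pose proof (is_C1_mult _ _ _ _ _ Hf IH) as [H _].
  pose proof (is_C1_continuous _ _ _ Hf). destruct Hf as [_ C0]. split.
  + generalize H. apply filter_imp. intros v A.
    eapply is_Cderiv_eq; [exact A|]. rewrite S_INR, RtoC_plus. cbn [Cpow]. Cring.
  + apply continuous_Cmult; [|exact C0].
    apply continuous_Cmult; [apply continuous_const | now apply continuous_Cpow].
Qed.

(** * Cauchy's theorem and residues on rectangles *)

Lemma continuous_horizontal (phi s : R) : continuous (fun s : R => ((s, phi) : C)) s.
Proof. apply continuous_Cpair; [apply continuous_id | apply continuous_const]. Qed.

Lemma continuous_vertical (s phi : R) : continuous (fun phi : R => ((s, phi) : C)) phi.
Proof. apply continuous_Cpair; [apply continuous_const | apply continuous_id]. Qed.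

Lemma ex_CInt_horizontal (F : C -> C) (phi a b : R) : a <= b ->
  (forall s, a <= s <= b -> continuous F (s, phi)) -> ex_CInt (fun s => F (s, phi)) a b.
Proof.
intros Hab H. apply ex_CInt_continuous. rewrite Rmin_left, Rmax_right by lra.
intros s Hs. apply (continuous_comp (fun s : R => ((s, phi) : C)) F); [|now apply H].
apply continuous_horizontal.
Qed.

Lemma ex_CInt_vertical (F : C -> C) (s c d : R) : c <= d ->
  (forall phi, c <= phi <= d -> continuous F (s, phi)) -> ex_CInt (fun phi => F (s, phi)) c d.
Proof.
intros Hab H. apply ex_CInt_continuous. rewrite Rmin_left, Rmax_right by lra.
intros phi Hs. apply (continuous_comp (fun phi : R => ((s, phi) : C)) F); [|now apply H].
apply continuous_vertical.
Qed.

Lemma CInt_derive_horizontal (F F' : C -> C) (phi a b : R) : a <= b ->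
  (forall s, a <= s <= b -> is_C1 F F' (s, phi)) ->
  CInt (fun s => F' (s, phi)) a b = (F (b, phi) - F (a, phi))%C.
Proof.
intros Hab H.
assert (E : forall s : R, ((0, phi) + s * 1)%C = (s, phi)).
{ intros s. unfold Cplus, Cmult; cbn. f_equal; ring. }
pose proof (CInt_derive_line F F' (0, phi) 1 a b) as K. rewrite !E in K. rewrite <- K.
- apply CInt_ext. intros s _. rewrite E. Cring.
- rewrite Rmin_left, Rmax_right by lra. intros s Hs. rewrite E. split; [|now apply H].
  now apply is_C1_Cderiv, H.
Qed.

Lemma CInt_derive_vertical (F F' : C -> C) (s c d : R) : c <= d ->
  (forall phi, c <= phi <= d -> is_C1 F F' (s, phi)) ->
  CInt (fun phi => (Ci * F' (s, phi))%C) c d = (F (s, d) - F (s, c))%C.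
Proof.
intros Hab H.
assert (E : forall phi : R, ((s, 0) + phi * Ci)%C = (s, phi)).
{ intros phi. unfold Cplus, Cmult; cbn. f_equal; ring. }
pose proof (CInt_derive_line F F' (s, 0) Ci c d) as K. rewrite !E in K. rewrite <- K.
- apply CInt_ext. intros phi _. now rewrite E.
- rewrite Rmin_left, Rmax_right by lra. intros phi Hs. rewrite E. split; [|now apply H].
  now apply is_C1_Cderiv, H.
Qed.

Lemma locally_horizontal (P : C -> Prop) (s phi : R) :
  locally ((s, phi) : C) P -> locally_2d (fun u v => P (u, v)) s phi.
Proof.
intros [e He]. exists e. intros u v Hu Hv. apply He. split; assumption.
Qed.

Lemma is_derive_horizontal (F : C -> C) (s phi : R) (l : C) : is_Cderiv F (s, phi) l ->
  is_derive (fun u => Re (F (u, phi))) s (Re l) /\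
  is_derive (fun u => Im (F (u, phi))) s (Im l).
Proof.
intros (q & Hq & <- & HF).
pose proof (continuous_comp (fun u : R => ((u, phi) : C)) q s (continuous_horizontal phi s) Hq)
  as Cq.
assert (L : locally s (fun u : R => F (u, phi) = (F (s, phi) + (u - s) * q (u, phi))%C)).
{ generalize (continuous_horizontal phi s _ HF
    : locally s (fun u => F (u, phi) = (F (s, phi) + ((u, phi) - (s, phi)) * q (u, phi))%C)).
  apply filter_imp. intros u E. refine (eq_trans E _). f_equal. f_equal.
  unfold Cminus, Cplus, RtoC; cbn. f_equal; ring. }
split.
- apply (is_derive_caratheodory (V := R_NormedModule) (fun u => Re (F (u, phi)))
    (fun u => Re (q (u, phi)))); [now apply continuous_Re|].
  generalize L. apply filter_imp. intros u E. cbv beta in E |- *. rewrite E, <- RtoC_minus.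
  unfold plus, scal; cbn. unfold mult, Re, Im; cbn. ring.
- apply (is_derive_caratheodory (V := R_NormedModule) (fun u => Im (F (u, phi)))
    (fun u => Im (q (u, phi)))); [now apply continuous_Im|].
  generalize L. apply filter_imp. intros u E. cbv beta in E |- *. rewrite E, <- RtoC_minus.
  unfold plus, scal; cbn. unfold mult, Re, Im; cbn. ring.
Qed.

(** The theorem on parameter integrals is real-valued, so it is applied to the real and the
    imaginary part. The horizontal partial derivative of either part is that part of [F']. *)
Lemma is_derive_CInt_param (F F' : C -> C) (s0 a0 b0 c d : R) : c <= d -> a0 < s0 < b0 ->
  (forall s phi, a0 < s < b0 -> c <= phi <= d -> is_C1 F F' (s, phi)) ->
  is_derive (V := C_R_NormedModule) (fun s => CInt (fun phi => F (s, phi)) c d) s0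
    (CInt (fun phi => F' (s0, phi)) c d).
Proof.
intros Hcd Hs H.
assert (Ls : locally s0 (fun s => a0 < s < b0)).
{ assert (He : 0 < Rmin (s0 - a0) (b0 - s0)) by (apply Rmin_glb_lt; lra).
  exists (mkposreal _ He). intros s Hb. unfold ball in Hb; cbn in Hb.
  unfold AbsRing_ball, abs, minus, plus, opp in Hb; cbn in Hb. apply Rabs_def2 in Hb.
  pose proof (Rmin_l (s0 - a0) (b0 - s0)). pose proof (Rmin_r (s0 - a0) (b0 - s0)). lra. }
assert (ex : forall s, a0 < s < b0 -> ex_CInt (fun phi => F (s, phi)) c d).
{ intros s Hs'. apply ex_CInt_vertical; [lra|]. intros phi Hphi.
  eapply is_C1_continuous, H; assumption. }
assert (ex' : ex_CInt (fun phi => F' (s0, phi)) c d).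
{ apply ex_CInt_vertical; [lra|]. intros phi Hphi. now apply H. }
assert (Lc : locally s0 (fun s =>
  (RInt (fun t => Re (F (s, t))) c d, RInt (fun t => Im (F (s, t))) c d) =
  CInt (fun phi => F (s, phi)) c d)).
{ generalize Ls. apply filter_imp. intros s Hs'. symmetry. now apply CInt_components, ex. }
refine (is_derive_ext_loc (V := C_R_NormedModule)
  (fun s => (RInt (fun t => Re (F (s, t))) c d, RInt (fun t => Im (F (s, t))) c d))
  (fun s => CInt (fun phi => F (s, phi)) c d) s0 _ Lc _).
rewrite (CInt_components _ _ _ ex').
apply is_derive_C.
- change (is_derive (fun s => RInt (fun t => Re (F (s, t))) c d) s0
    (RInt (fun t => Re (F' (s0, t))) c d)).
  replace (RInt (fun t => Re (F' (s0, t))) c d)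
    with (RInt (fun t => Derive (fun u => Re (F (u, t))) s0) c d).
  2:{ apply RInt_ext. rewrite Rmin_left, Rmax_right by lra. intros t Ht.
      apply is_derive_unique, is_derive_horizontal, is_C1_Cderiv, H; lra. }
  apply (is_derive_RInt_param (fun s t => Re (F (s, t)))).
  + generalize Ls. apply filter_imp. rewrite Rmin_left, Rmax_right by lra.
    intros s Hs' t Ht. eexists.
    exact (proj1 (is_derive_horizontal F s t _ (is_C1_Cderiv _ _ _ (H s t Hs' Ht)))).
  + rewrite Rmin_left, Rmax_right by lra. intros t Ht.
    destruct (H s0 t Hs Ht) as [L C0].
    apply (continuity_2d_pt_ext_loc (fun u v => Re (F' (u, v)))).
    { generalize (locally_horizontal _ _ _ L). apply locally_2d_impl, locally_2d_forall.
      intros u v K. symmetry. now apply is_derive_unique, is_derive_horizontal. }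
    intros e. apply (locally_horizontal (fun w => Rabs (Re (F' w) - Re (F' (s0, t))) < e)).
    apply (continuous_Re _ _ C0 (fun x => Rabs (x - Re (F' (s0, t))) < e)).
    exists e. intros y Hy; exact Hy.
  + generalize Ls. apply filter_imp. intros s Hs'. destruct (ex s Hs') as [l Hl].
    eexists. exact (is_RInt_fct_extend_fst _ _ _ _ Hl).
- change (is_derive (fun s => RInt (fun t => Im (F (s, t))) c d) s0
    (RInt (fun t => Im (F' (s0, t))) c d)).
  replace (RInt (fun t => Im (F' (s0, t))) c d)
    with (RInt (fun t => Derive (fun u => Im (F (u, t))) s0) c d).
  2:{ apply RInt_ext. rewrite Rmin_left, Rmax_right by lra. intros t Ht.
      apply is_derive_unique, is_derive_horizontal, is_C1_Cderiv, H; lra. }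
  apply (is_derive_RInt_param (fun s t => Im (F (s, t)))).
  + generalize Ls. apply filter_imp. rewrite Rmin_left, Rmax_right by lra.
    intros s Hs' t Ht. eexists.
    exact (proj2 (is_derive_horizontal F s t _ (is_C1_Cderiv _ _ _ (H s t Hs' Ht)))).
  + rewrite Rmin_left, Rmax_right by lra. intros t Ht.
    destruct (H s0 t Hs Ht) as [L C0].
    apply (continuity_2d_pt_ext_loc (fun u v => Im (F' (u, v)))).
    { generalize (locally_horizontal _ _ _ L). apply locally_2d_impl, locally_2d_forall.
      intros u v K. symmetry. now apply is_derive_unique, is_derive_horizontal. }
    intros e. apply (locally_horizontal (fun w => Rabs (Im (F' w) - Im (F' (s0, t))) < e)).
    apply (continuous_Im _ _ C0 (fun x => Rabs (x - Im (F' (s0, t))) < e)).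
    exists e. intros y Hy; exact Hy.
  + generalize Ls. apply filter_imp. intros s Hs'. destruct (ex s Hs') as [l Hl].
    eexists. exact (is_RInt_fct_extend_snd _ _ _ _ Hl).
Qed.

Lemma Ci_mult_Ci : (Ci * Ci)%C = (- (1))%C.
Proof. unfold Ci, Cmult, Copp, RtoC; cbn. f_equal; ring. Qed.

(* The integral of F along the vertical segment at abscissa s has s-derivative
   int F' = -i (F(s,d) - F(s,c)). *)
Lemma Cauchy_rectangle (F F' : C -> C) (a0 b0 a b c d : R) :
  c <= d -> a0 < a -> a <= b -> b < b0 ->
  (forall s phi, a0 < s < b0 -> c <= phi <= d -> is_C1 F F' (s, phi)) ->
  (Ci * CInt (fun phi => F (b, phi)) c d - Ci * CInt (fun phi => F (a, phi)) c d =
   CInt (fun s => F (s, d)) a b - CInt (fun s => F (s, c)) a b)%C.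
Proof.
intros Hcd Ha Hab Hb H.
assert (C0 : forall s phi, a0 < s < b0 -> c <= phi <= d -> continuous F (s, phi)).
{ intros s phi Hs Hphi. eapply is_C1_continuous, H; assumption. }
assert (exh : forall phi, c <= phi <= d -> ex_CInt (fun s => F (s, phi)) a b).
{ intros phi Hphi. apply ex_CInt_horizontal; [lra|]. intros s Hs. apply C0; lra. }
assert (I : is_CInt (fun s => - Ci * (F (s, d) - F (s, c)))%C a b
  (CInt (fun phi => F (b, phi)) c d - CInt (fun phi => F (a, phi)) c d)%C).
{ apply (is_RInt_derive (V := C_R_CompleteNormedModule)
    (fun s => CInt (fun phi => F (s, phi)) c d)); rewrite Rmin_left, Rmax_right by lra.
  - intros s Hs.
    replace (- Ci * (F (s, d) - F (s, c)))%C with (CInt (fun phi => F' (s, phi)) c d).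
    + apply (is_derive_CInt_param F F' s a0 b0); [lra | lra | exact H].
    + rewrite <- (CInt_derive_vertical F F' s c d); [|lra|].
      2:{ intros phi Hphi. apply H; lra. }
      rewrite CInt_Cmult.
      * transitivity (- (Ci * Ci) * CInt (fun phi => F' (s, phi)) c d)%C; [|Cring].
        rewrite Ci_mult_Ci. Cring.
      * apply ex_CInt_vertical; [lra|]. intros phi Hphi. apply H; lra.
  - intros s Hs. apply continuous_Cmult; [apply continuous_const|].
    apply continuous_Cminus.
    + apply (continuous_comp (fun s : R => ((s, d) : C)) F); [apply continuous_horizontal|].
      apply C0; lra.
    + apply (continuous_comp (fun s : R => ((s, c) : C)) F); [apply continuous_horizontal|].
      apply C0; lra. }
apply (is_RInt_unique (V := C_R_CompleteNormedModule)) in I.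
rewrite CInt_Cmult, CInt_minus in I.
- transitivity (Ci * (CInt (fun phi => F (b, phi)) c d - CInt (fun phi => F (a, phi)) c d))%C;
    [Cring|].
  rewrite <- I.
  transitivity (- (Ci * Ci) * (CInt (fun s => F (s, d)) a b - CInt (fun s => F (s, c)) a b))%C;
    [Cring|]. rewrite Ci_mult_Ci. Cring.
- apply exh; lra.
- apply exh; lra.
- apply (ex_RInt_minus (V := C_R_NormedModule)); apply exh; lra.
Qed.

(** The contour integral over the boundary of $[a,b]\times[c,d]$, counterclockwise; the factor $i$
    on the vertical sides is $dw=i\,d\varphi$. *)
Definition rect_int (F : C -> C) (a b c d : R) : C :=
  (CInt (fun s => F (s, c)) a b + Ci * CInt (fun phi => F (b, phi)) c d
   - CInt (fun s => F (s, d)) a b - Ci * CInt (fun phi => F (a, phi)) c d)%C.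

Lemma rect_int_0 (F F' : C -> C) (a0 b0 a b c d : R) :
  c <= d -> a0 < a -> a <= b -> b < b0 ->
  (forall s phi, a0 < s < b0 -> c <= phi <= d -> is_C1 F F' (s, phi)) ->
  rect_int F a b c d = RtoC 0.
Proof.
intros Hcd Ha Hab Hb H.
pose proof (Cauchy_rectangle F F' a0 b0 a b c d Hcd Ha Hab Hb H) as E.
unfold rect_int.
transitivity ((Ci * CInt (fun phi => F (b, phi)) c d - Ci * CInt (fun phi => F (a, phi)) c d)
  - (CInt (fun s => F (s, d)) a b - CInt (fun s => F (s, c)) a b))%C; [Cring|].
rewrite E. Cring.
Qed.

(** Up to sign and factors, this kernel and the next are the real and imaginary parts of $1/w$ along
    a side of a square of half-side [r]. The odd one integrates to 0; the even one has the
    arctangent as primitive, evaluated at $\pm1$. *)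
Lemma is_RInt_odd_kernel (m r : R) : 0 < r ->
  is_RInt (fun t => (t - m) / ((t - m) ^ 2 + r ^ 2)) (m - r) (m + r) 0.
Proof.
intros Hr.
pose (G := fun t => / 2 * ln ((t - m) ^ 2 + r ^ 2)).
replace 0 with (minus (G (m + r)) (G (m - r))).
- apply (is_RInt_derive (V := R_CompleteNormedModule) G).
  + intros t _. assert (0 < (t - m) ^ 2 + r ^ 2)
      by (pose proof (pow2_ge_0 (t - m)); pose proof (pow_lt r 2 Hr); lra).
    unfold G. auto_derive; [cbn in *; lra|]. field. cbn in *; lra.
  + intros t _. assert (0 < (t - m) ^ 2 + r ^ 2)
      by (pose proof (pow2_ge_0 (t - m)); pose proof (pow_lt r 2 Hr); lra).
    apply (ex_derive_continuous (V := R_NormedModule)). auto_derive. cbn in *; lra.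
- unfold G, minus, plus, opp; cbn.
  replace ((m - r - m) * ((m - r - m) * 1)) with ((m + r - m) * ((m + r - m) * 1)) by ring.
  ring.
Qed.

Lemma is_RInt_even_kernel (m r : R) : 0 < r ->
  is_RInt (fun t => r / ((t - m) ^ 2 + r ^ 2)) (m - r) (m + r) (PI / 2).
Proof.
intros Hr.
pose (G := fun t => atan ((t - m) / r)).
replace (PI / 2) with (minus (G (m + r)) (G (m - r))).
- apply (is_RInt_derive (V := R_CompleteNormedModule) G).
  + intros t _. assert (0 < (t - m) ^ 2 + r ^ 2)
      by (pose proof (pow2_ge_0 (t - m)); pose proof (pow_lt r 2 Hr); lra).
    unfold G. auto_derive; [lra|]. field. cbn in *. split; nra.
  + intros t _. assert (0 < (t - m) ^ 2 + r ^ 2)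
      by (pose proof (pow2_ge_0 (t - m)); pose proof (pow_lt r 2 Hr); lra).
    apply (ex_derive_continuous (V := R_NormedModule)). auto_derive. cbn in *; lra.
- unfold G, minus, plus, opp; cbn.
  replace ((m + r - m) / r) with 1 by (field; lra).
  replace ((m - r - m) / r) with (- (1)) by (field; lra).
  rewrite atan_opp, atan_1. field.
Qed.

(** The sign of [t] selects the upper or the lower side of the square. *)
Lemma CInt_inv_horizontal (p q r t : R) : 0 < r -> t = r \/ t = - r ->
  is_CInt (fun s => / ((s, (q + t)%R) - (p, q)))%C (p - r) (p + r) (0, - t / r * (PI / 2)).
Proof.
intros Hr Ht. assert (Et : t ^ 2 = r ^ 2) by (destruct Ht; subst; ring).
apply is_CInt_components; cbn [Re Im fst snd].
- apply (is_RInt_ext (fun s => (s - p) / ((s - p) ^ 2 + r ^ 2))); [|now apply is_RInt_odd_kernel].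
  intros s _. rewrite <- Et. unfold Rdiv, Rminus. cbn. unfold Rdiv.
      replace (q + t + - q) with t by ring. replace (p + t + - p) with t by ring.
      (ring || (f_equal; f_equal; ring) || (f_equal; [ring | f_equal; ring])).
- apply (is_RInt_ext (fun s => - t / r * (r / ((s - p) ^ 2 + r ^ 2)))).
  + intros s _. rewrite <- Et at 1.
    replace (- t / r * (r / ((s - p) ^ 2 + t ^ 2))) with (- t / ((s - p) ^ 2 + t ^ 2)).
    * unfold Rdiv, Rminus. cbn. unfold Rdiv.
      replace (q + t + - q) with t by ring. replace (p + t + - p) with t by ring.
      (ring || (f_equal; f_equal; ring) || (f_equal; [ring | f_equal; ring])).
    * pose proof (pow_lt r 2 Hr).
      match goal with |- context [(?a - ?b) ^ 2] => pose proof (pow2_ge_0 (a - b)) end.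
      field; repeat split; lra.
  + apply (is_RInt_scal (V := R_NormedModule)). now apply is_RInt_even_kernel.
Qed.

Lemma CInt_inv_vertical (p q r t : R) : 0 < r -> t = r \/ t = - r ->
  is_CInt (fun phi => / (((p + t)%R, phi) - (p, q)))%C (q - r) (q + r) (t / r * (PI / 2), 0).
Proof.
intros Hr Ht. assert (Et : t ^ 2 = r ^ 2) by (destruct Ht; subst; ring).
apply is_CInt_components; cbn [Re Im fst snd].
- apply (is_RInt_ext (fun s => t / r * (r / ((s - q) ^ 2 + r ^ 2)))).
  + intros s _. rewrite <- Et at 1.
    replace (t / r * (r / ((s - q) ^ 2 + t ^ 2))) with (t / ((s - q) ^ 2 + t ^ 2)).
    * unfold Rdiv, Rminus. cbn. unfold Rdiv.
      replace (q + t + - q) with t by ring. replace (p + t + - p) with t by ring.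
      (ring || (f_equal; f_equal; ring) || (f_equal; [ring | f_equal; ring])).
    * pose proof (pow_lt r 2 Hr).
      match goal with |- context [(?a - ?b) ^ 2] => pose proof (pow2_ge_0 (a - b)) end.
      field; repeat split; lra.
  + apply (is_RInt_scal (V := R_NormedModule)). now apply is_RInt_even_kernel.
- apply (is_RInt_ext (fun s => (- 1) * ((s - q) / ((s - q) ^ 2 + r ^ 2)))).
  + intros s _. rewrite <- Et at 1.
    replace (- 1 * ((s - q) / ((s - q) ^ 2 + t ^ 2))) with (- (s - q) / ((s - q) ^ 2 + t ^ 2)).
    * unfold Rdiv, Rminus. cbn. unfold Rdiv.
      replace (q + t + - q) with t by ring. replace (p + t + - p) with t by ring.
      (ring || (f_equal; f_equal; ring) || (f_equal; [ring | f_equal; ring])).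
    * pose proof (pow_lt r 2 Hr).
      match goal with |- context [(?a - ?b) ^ 2] => pose proof (pow2_ge_0 (a - b)) end.
      field; repeat split; lra.
  + replace 0 with ((- 1) * 0) by ring.
    apply (is_RInt_scal (V := R_NormedModule)). now apply is_RInt_odd_kernel.
Qed.

(** Each of the four sides contributes $i\pi/2$. A square in place of a circle keeps every contour a
    rectangle. *)
Lemma rect_int_inv (p q r : R) : 0 < r ->
  rect_int (fun w => / (w - (p, q)))%C (p - r) (p + r) (q - r) (q + r) = (2 * PI * Ci)%C.
Proof.
intros Hr. unfold rect_int.
pose proof (is_RInt_unique (V := C_R_CompleteNormedModule) _ _ _ _
  (CInt_inv_horizontal p q r r Hr (or_introl eq_refl))) as E1.
pose proof (is_RInt_unique (V := C_R_CompleteNormedModule) _ _ _ _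
  (CInt_inv_horizontal p q r (- r) Hr (or_intror eq_refl))) as E2.
pose proof (is_RInt_unique (V := C_R_CompleteNormedModule) _ _ _ _
  (CInt_inv_vertical p q r r Hr (or_introl eq_refl))) as E3.
pose proof (is_RInt_unique (V := C_R_CompleteNormedModule) _ _ _ _
  (CInt_inv_vertical p q r (- r) Hr (or_intror eq_refl))) as E4.
change (p - r) with (p + - r) at 3. change (q - r) with (q + - r) at 1.
unfold Rminus in *. rewrite E1, E2, E3, E4.
unfold Cminus, Ci, Cplus, Cmult, Copp, RtoC; cbn. f_equal; field; lra.
Qed.

(** What surrounds the small square is cut into a left and a right piece of full height and a lower
    and an upper piece of the width of the square. None of them meets the singularity, so Cauchy's
    theorem makes all four vanish and the inner sides cancel. *)
Lemma rect_int_split (F F' : C -> C) (a0 b0 a b c d p q r : R) :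
  0 < r -> a0 < a -> a <= p - r -> p + r <= b -> b < b0 -> c <= q - r -> q + r <= d ->
  (forall s phi, a0 < s < b0 -> c <= phi <= d -> (s, phi) <> (p, q) -> is_C1 F F' (s, phi)) ->
  rect_int F a b c d = rect_int F (p - r) (p + r) (q - r) (q + r).
Proof.
intros Hr Ha0 Ha Hb Hb0 Hc Hd H.
assert (C0 : forall s phi, a0 < s < b0 -> c <= phi <= d -> s <> p \/ phi <> q ->
  continuous F (s, phi)).
{ intros s phi Hs Hphi N. eapply is_C1_continuous, H; [assumption | assumption|].
  intros E. injection E. intros; subst. now destruct N. }
assert (exh : forall phi u v, c <= phi <= d -> a <= u -> u <= v -> v <= b ->
  v <= p - r \/ p + r <= u \/ phi <= q - r \/ q + r <= phi -> ex_CInt (fun s => F (s, phi)) u v).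
{ intros phi u v Hphi Hu Huv Hv N. apply ex_CInt_horizontal; [lra|].
  intros s Hs. apply C0; [lra | lra|].
  destruct N as [N|[N|N]]; [left|left|right]; lra. }
assert (exv : forall s u v, a <= s <= b -> c <= u -> u <= v -> v <= d ->
  s <= p - r \/ p + r <= s -> ex_CInt (fun phi => F (s, phi)) u v).
{ intros s u v Hs Hu Huv Hv N. apply ex_CInt_vertical; [lra|].
  intros phi Hphi. apply C0; [lra | lra|]. left. lra. }
assert (Hn : forall s phi, s <> p \/ phi <> q -> (s, phi) <> (p, q)).
{ intros s phi N E. injection E. intros; subst. now destruct N. }
assert (R1 : rect_int F a (p - r) c d = RtoC 0).
{ apply (rect_int_0 F F' a0 p); [lra | lra | lra | lra |].
  intros s phi Hs Hphi. apply H; [lra | lra|]. apply Hn. left. lra. }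
assert (R2 : rect_int F (p + r) b c d = RtoC 0).
{ apply (rect_int_0 F F' p b0); [lra | lra | lra | lra |].
  intros s phi Hs Hphi. apply H; [lra | lra|]. apply Hn. left. lra. }
assert (R3 : rect_int F (p - r) (p + r) c (q - r) = RtoC 0).
{ apply (rect_int_0 F F' a0 b0); [lra | lra | lra | lra |].
  intros s phi Hs Hphi. apply H; [lra | lra|]. apply Hn. right. lra. }
assert (R4 : rect_int F (p - r) (p + r) (q + r) d = RtoC 0).
{ apply (rect_int_0 F F' a0 b0); [lra | lra | lra | lra |].
  intros s phi Hs Hphi. apply H; [lra | lra|]. apply Hn. right. lra. }
assert (Sh : forall phi, phi = c \/ phi = d -> CInt (fun s => F (s, phi)) a b =
  (CInt (fun s => F (s, phi)) a (p - r) + CInt (fun s => F (s, phi)) (p - r) (p + r)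
   + CInt (fun s => F (s, phi)) (p + r) b)%C).
{ intros phi Hphi. rewrite !CInt_Chasles; [reflexivity | | | |]; apply exh; lra. }
assert (Sv : forall s, s = p - r \/ s = p + r -> CInt (fun phi => F (s, phi)) c d =
  (CInt (fun phi => F (s, phi)) c (q - r) + CInt (fun phi => F (s, phi)) (q - r) (q + r)
   + CInt (fun phi => F (s, phi)) (q + r) d)%C).
{ intros s Hs. rewrite !CInt_Chasles; [reflexivity | | | |]; apply exv; lra. }
transitivity (rect_int F a b c d
  - (rect_int F a (p - r) c d + rect_int F (p + r) b c d
     + rect_int F (p - r) (p + r) c (q - r) + rect_int F (p - r) (p + r) (q + r) d))%C.
{ rewrite R1, R2, R3, R4. Cring. }
unfold rect_int. rewrite (Sh c), (Sh d), (Sv (p - r)), (Sv (p + r)) by auto. Cring.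
Qed.

Lemma Cmod_rect_int_le (F : C -> C) (M a b c d : R) : a <= b -> c <= d ->
  (forall s phi, a <= s <= b -> c <= phi <= d -> s = a \/ s = b \/ phi = c \/ phi = d ->
    continuous F (s, phi) /\ Cmod (F (s, phi)) <= M) ->
  Cmod (rect_int F a b c d) <= 2 * ((b - a) + (d - c)) * M.
Proof.
intros Hab Hcd H.
assert (Bh : forall phi, phi = c \/ phi = d -> Cmod (CInt (fun s => F (s, phi)) a b) <= (b - a) * M).
{ intros phi Hphi. apply Cmod_CInt_le_const; [lra | intros; apply H; lra |].
  apply ex_CInt_horizontal; [lra|]. intros; apply H; lra. }
assert (Bv : forall s, s = a \/ s = b -> Cmod (Ci * CInt (fun phi => F (s, phi)) c d) <= (d - c) * M).
{ intros s Hs. rewrite Cmod_mult, Cmod_Ci, Rmult_1_l.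
  apply Cmod_CInt_le_const; [lra | intros; apply H; lra |].
  apply ex_CInt_vertical; [lra|]. intros; apply H; lra. }
pose proof (Bh c ltac:(auto)). pose proof (Bh d ltac:(auto)).
pose proof (Bv a ltac:(auto)). pose proof (Bv b ltac:(auto)).
unfold rect_int, Cminus.
eapply Rle_trans; [apply Cmod_triangle|]. rewrite Cmod_opp.
apply Rle_trans with (((b - a) * M + (d - c) * M + (b - a) * M) + (d - c) * M); [|lra].
apply Rplus_le_compat; [|assumption].
eapply Rle_trans; [apply Cmod_triangle|]. rewrite Cmod_opp.
apply Rplus_le_compat; [|assumption].
eapply Rle_trans; [apply Cmod_triangle|].
now apply Rplus_le_compat.
Qed.

Lemma Ceq_of_close (z w : C) (K : R) : 0 <= K ->
  (forall e, 0 < e -> Cmod (z - w) <= K * e) -> z = w.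
Proof.
intros HK H.
assert (E : (z - w)%C = RtoC 0).
{ apply Cmod_eq_0. apply Rle_antisym; [|apply Cmod_ge_0].
  apply le_epsilon. intros e He. rewrite Rplus_0_l.
  assert (He' : 0 < e / (K + 1)) by (apply Rdiv_lt_0_compat; lra).
  eapply Rle_trans; [apply (H _ He')|].
  apply Rle_trans with ((K + 1) * (e / (K + 1))); [nra|]. apply Req_le. field. lra. }
replace z with (z - w + w)%C by ring. rewrite E. ring.
Qed.

(** On a square of half-side [r] around the pole, [F] differs from $l/(w-p)$ by at most $e/r$, and
    the perimeter is $8r$. The resulting error $8e$ does not depend on [r], whence the constant 8.
    The residue enters as the limit of $(w-p)F(w)$ over points other than the pole, so the value of
    [F] there does not matter. *)
Lemma residue_rectangle (F F' : C -> C) (a0 b0 a b c d p q : R) (l : C) :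
  a0 < a -> a < p -> p < b -> b < b0 -> c < q -> q < d ->
  (forall s phi, a0 < s < b0 -> c <= phi <= d -> (s, phi) <> (p, q) -> is_C1 F F' (s, phi)) ->
  (forall e, 0 < e -> locally ((p, q) : C) (fun w => w <> (p, q) ->
     Cmod ((w - (p, q)) * F w - l) <= e)) ->
  rect_int F a b c d = (2 * PI * Ci * l)%C.
Proof.
intros Ha0 Ha Hb Hb0 Hc Hd H Hl.
apply (Ceq_of_close _ _ 8); [lra|]. intros e He.
destruct (proj1 (locally_C_Cmod _ _) (Hl e He)) as [dl Hdl].
(* A point of the boundary of the square is within $2r$ of the centre; [dl / 3] keeps it strictly
   inside the disc of radius [dl]. *)
pose (r := Rmin (dl / 3) (Rmin (Rmin (p - a) (b - p)) (Rmin (q - c) (d - q)))).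
assert (Hr : 0 < r /\ r <= dl / 3 /\ r <= p - a /\ r <= b - p /\ r <= q - c /\ r <= d - q).
{ pose proof (cond_pos dl). unfold r.
  pose proof (Rmin_l (dl / 3) (Rmin (Rmin (p - a) (b - p)) (Rmin (q - c) (d - q)))).
  pose proof (Rmin_r (dl / 3) (Rmin (Rmin (p - a) (b - p)) (Rmin (q - c) (d - q)))).
  pose proof (Rmin_l (Rmin (p - a) (b - p)) (Rmin (q - c) (d - q))).
  pose proof (Rmin_r (Rmin (p - a) (b - p)) (Rmin (q - c) (d - q))).
  pose proof (Rmin_l (p - a) (b - p)). pose proof (Rmin_r (p - a) (b - p)).
  pose proof (Rmin_l (q - c) (d - q)). pose proof (Rmin_r (q - c) (d - q)).
  split; [|lra]. repeat apply Rmin_glb_lt; lra. }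
clearbody r. destruct Hr as (Hr & Hr1 & Hr2 & Hr3 & Hr4 & Hr5).
rewrite (rect_int_split F F' a0 b0 a b c d p q r); try lra; try exact H.
rewrite <- (rect_int_inv p q r Hr).
set (K := fun w : C => (/ (w - (p, q)))%C).
assert (Nz : forall s phi, p - r <= s <= p + r -> q - r <= phi <= q + r ->
  s = p - r \/ s = p + r \/ phi = q - r \/ phi = q + r -> (s, phi) <> (p, q)).
{ intros s phi _ _ N E. injection E. intros; subst. lra. }
assert (CF : forall s phi, p - r <= s <= p + r -> q - r <= phi <= q + r ->
  s = p - r \/ s = p + r \/ phi = q - r \/ phi = q + r -> continuous F (s, phi)).
{ intros s phi Hs Hphi N. eapply is_C1_continuous, H; [lra | lra|]. now apply Nz. }
assert (Nz' : forall w : C, w <> (p, q) -> (w - (p, q))%C <> RtoC 0).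
{ intros w N E. apply N. replace w with (w - (p, q) + (p, q))%C by ring. rewrite E. ring. }
assert (CK : forall s phi, p - r <= s <= p + r -> q - r <= phi <= q + r ->
  s = p - r \/ s = p + r \/ phi = q - r \/ phi = q + r -> continuous K (s, phi)).
{ intros s phi Hs Hphi N. apply continuous_Cinv; [|now apply Nz', Nz].
  apply continuous_Cminus; [apply continuous_id | apply continuous_const]. }
replace (rect_int F (p - r) (p + r) (q - r) (q + r)
         - rect_int K (p - r) (p + r) (q - r) (q + r) * l)%C
  with (rect_int (fun w => F w - l * K w)%C (p - r) (p + r) (q - r) (q + r)).
- eapply Rle_trans.
  + apply (Cmod_rect_int_le _ (e / r)); [lra | lra|].
    intros s phi Hs Hphi N. split.
    * apply continuous_Cminus; [now apply CF|].
      apply continuous_Cmult; [apply continuous_const | now apply CK].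
    * pose proof (Nz s phi Hs Hphi N) as N1. pose proof (Nz' _ N1) as N2.
      unfold K.
      replace (F (s, phi) - l * / ((s, phi) - (p, q)))%C
        with ((((s, phi) - (p, q)) * F (s, phi) - l) / ((s, phi) - (p, q)))%C
        by (field; exact N2).
      rewrite Cmod_div by exact N2.
      assert (D1 : r <= Cmod ((s, phi) - (p, q))).
      { destruct N as [N|[N|N]].
        - eapply Rle_trans; [|apply re_le_Cmod]. cbn. subst s.
          rewrite <- Rabs_Ropp. eapply Rle_trans; [|apply Rle_abs]. lra.
        - eapply Rle_trans; [|apply re_le_Cmod]. cbn. subst s.
          eapply Rle_trans; [|apply Rle_abs]. lra.
        - eapply Rle_trans; [|apply Rabs_Im_le_Cmod]. cbn. destruct N as [-> | ->].
          + rewrite <- Rabs_Ropp. eapply Rle_trans; [|apply Rle_abs]. lra.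
          + eapply Rle_trans; [|apply Rle_abs]. lra. }
      assert (D2 : Cmod ((s, phi) - (p, q)) < dl).
      { eapply Rle_lt_trans; [apply Cmod_le_Re_Im|]. cbn.
        assert (Rabs (s + - p) <= r) by (apply Rabs_le; lra).
        assert (Rabs (phi + - q) <= r) by (apply Rabs_le; lra).
        pose proof (cond_pos dl). lra. }
      unfold Rdiv. apply Rmult_le_compat; [apply Cmod_ge_0 | | exact (Hdl _ D2 N1) |].
      -- left. apply Rinv_0_lt_compat. lra.
      -- now apply Rinv_le_contravar.
  + apply Req_le. field. lra.
- unfold rect_int.
  assert (L : forall f g : R -> C, forall u v : R, ex_CInt f u v -> ex_CInt g u v ->
    CInt (fun t => f t - l * g t)%C u v = (CInt f u v - l * CInt g u v)%C).
  { intros f g u v Hf Hg. rewrite CInt_minus, CInt_Cmult; [reflexivity | assumption | assumption |].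
    now apply ex_CInt_Cmult. }
  assert (Lh : forall phi, phi = q - r \/ phi = q + r ->
    CInt (fun s => F (s, phi) - l * K (s, phi))%C (p - r) (p + r) =
    (CInt (fun s => F (s, phi)) (p - r) (p + r) - l * CInt (fun s => K (s, phi)) (p - r) (p + r))%C).
  { intros phi Hphi. apply L; apply ex_CInt_horizontal; try lra; intros; [apply CF | apply CK]; lra. }
  assert (Lv : forall s, s = p - r \/ s = p + r ->
    CInt (fun phi => F (s, phi) - l * K (s, phi))%C (q - r) (q + r) =
    (CInt (fun phi => F (s, phi)) (q - r) (q + r) - l * CInt (fun phi => K (s, phi)) (q - r) (q + r))%C).
  { intros s Hs. apply L; apply ex_CInt_vertical; try lra; intros; [apply CF | apply CK]; lra. }
  rewrite (Lh (q - r)), (Lh (q + r)), (Lv (p - r)), (Lv (p + r)) by auto. Cring.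
Qed.

(** * Limits along filters, and injectivity of the exponential on strips *)

Lemma filterlim_continuous_2 {T : Type} {F : (T -> Prop) -> Prop} {FF : Filter F}
  (op : C -> C -> C) (f g : T -> C) (x y : C) :
  continuous (T := prod_UniformSpace C_UniformSpace C_UniformSpace) (U := C_UniformSpace)
    (fun z : C * C => op (fst z) (snd z)) (x, y) ->
  filterlim f F (locally x) -> filterlim g F (locally y) ->
  filterlim (fun t => op (f t) (g t)) F (locally (op x y)).
Proof.
intros H Hf Hg. apply (filterlim_comp_2 f g op Hf Hg).
intros P HP. destruct (H P HP) as [e He].
apply (Filter_prod _ _ _ (ball x e) (ball y e)).
- now exists e.
- now exists e.
- intros u v Hu Hv. apply (He (u, v)). split; assumption.
Qed.

Lemma filterlim_Cplus {T : Type} {F : (T -> Prop) -> Prop} {FF : Filter F}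
  (f g : T -> C) (x y : C) :
  filterlim f F (locally x) -> filterlim g F (locally y) ->
  filterlim (fun t => f t + g t)%C F (locally (x + y)%C).
Proof.
apply (filterlim_continuous_2 Cplus).
apply continuous_Cplus; [apply continuous_fst | apply continuous_snd].
Qed.

Lemma filterlim_Cminus {T : Type} {F : (T -> Prop) -> Prop} {FF : Filter F}
  (f g : T -> C) (x y : C) :
  filterlim f F (locally x) -> filterlim g F (locally y) ->
  filterlim (fun t => f t - g t)%C F (locally (x - y)%C).
Proof.
apply (filterlim_continuous_2 Cminus).
apply continuous_Cminus; [apply continuous_fst | apply continuous_snd].
Qed.

Lemma filterlim_Cmult {T : Type} {F : (T -> Prop) -> Prop} {FF : Filter F}
  (f g : T -> C) (x y : C) :
  filterlim f F (locally x) -> filterlim g F (locally y) ->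
  filterlim (fun t => f t * g t)%C F (locally (x * y)%C).
Proof.
apply (filterlim_continuous_2 Cmult).
apply continuous_Cmult; [apply continuous_fst | apply continuous_snd].
Qed.

Lemma filterlim_Cinv {T : Type} {F : (T -> Prop) -> Prop} {FF : Filter F}
  (f : T -> C) (x : C) : x <> RtoC 0 ->
  filterlim f F (locally x) -> filterlim (fun t => / f t)%C F (locally (/ x)%C).
Proof.
intros Hx Hf. apply (filterlim_comp _ _ _ f Cinv _ (locally x)); [exact Hf|].
apply (continuous_Cinv (fun z : C => z)); [apply continuous_id | exact Hx].
Qed.

Lemma filterlim_C_unique {T : Type} {F : (T -> Prop) -> Prop} {FF : ProperFilter F}
  (f : T -> C) (x y : C) :
  filterlim f F (locally x) -> filterlim f F (locally y) -> x = y.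
Proof. apply (filterlim_locally_unique (V := C_NormedModule)). Qed.

Lemma Cmod_limit_le {T : Type} {F : (T -> Prop) -> Prop} {FF : ProperFilter F}
  (f : T -> C) (x : C) (M : R) :
  filterlim f F (locally x) -> F (fun t => Cmod (f t) <= M) -> Cmod x <= M.
Proof.
intros Hf HM. apply le_epsilon. intros e He.
pose proof (proj1 (filterlim_C_Cmod f x) Hf e He) as L.
destruct (filter_ex _ (filter_and _ _ HM L)) as [t [H1 H2]].
pose proof (Cmod_triangle_inv x (f t)) as K. rewrite Cmod_minus_sym in K. lra.
Qed.

Lemma cos_eq_1 (x : R) : Rabs x < 2 * PI -> cos x = 1 -> x = 0.
Proof.
intros Hx H. apply Rabs_def2 in Hx.
assert (S : sin (x / 2) = 0).
{ replace x with (2 * (x / 2)) in H by field. rewrite cos_2a_sin in H. nra. }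
destruct (Rtotal_order x 0) as [L|[->|L]]; [exfalso | reflexivity | exfalso].
- pose proof (sin_gt_0 (- (x / 2)) ltac:(lra) ltac:(lra)). rewrite sin_neg in *. lra.
- pose proof (sin_gt_0 (x / 2) ltac:(lra) ltac:(lra)). lra.
Qed.

Lemma Cexp_inj (z w : C) : Rabs (Im z - Im w) < 2 * PI -> Cexp z = Cexp w -> z = w.
Proof.
intros HI E.
assert (ER : Re z = Re w).
{ apply exp_inv. rewrite <- !Cmod_Cexp. now rewrite E. }
assert (E1 : Cexp (z - w) = RtoC 1).
{ rewrite Cexp_minus, E. field. apply Cexp_neq_0. }
destruct z as [a b], w as [c d]. cbn in ER, HI. subst c.
assert (Hc : cos (b - d) = 1).
{ pose proof (f_equal Re E1) as H. unfold Cexp in H. cbn in H.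
  replace (a + - a) with 0 in H by ring. rewrite exp_0, Rmult_1_l in H. exact H. }
pose proof (cos_eq_1 _ HI Hc). f_equal. lra.
Qed.

(** * Hankel contours in the logarithmic coordinate *)

(* Hankel contour in the logarithmic coordinate w = log zeta = s + i phi, with the two rays
   truncated at s = b. *)
Definition hankel_cut (F : C -> C) (a b th : R) : C :=
  (Ci * CInt (fun phi => F (a, phi)) (- th) th
   + CInt (fun s => F (s, th)) a b - CInt (fun s => F (s, (- th)%R)) a b)%C.

Definition arc_int (F : C -> C) (a th : R) : C :=
  (Ci * CInt (fun phi => F (a, phi)) (- th) th)%C.

(** The truncated contour and the vertical segment at abscissa [b] bound a rectangle. Every
    displacement of an arc below goes through this identity. *)
Lemma hankel_cut_rect (F : C -> C) (a b th : R) :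
  hankel_cut F a b th = (arc_int F b th - rect_int F a b (- th) th)%C.
Proof. unfold hankel_cut, arc_int, rect_int. Cring. Qed.

Lemma Cminus_neq_0 (z w : C) : z <> w -> (z - w)%C <> RtoC 0.
Proof. intros N E. apply N. replace z with (z - w + w)%C by ring. rewrite E. ring. Qed.

(** Both points lie in the strip of half-width [th], one of them strictly inside, so the imaginary
    parts after multiplication by [k] differ by less than $2k\,th\le2\pi$. This is why only one pole
    lies in the strip. *)
Lemma Cexp_scal_inj (k th s phi : R) (p : C) : 0 < k -> k * th <= PI ->
  - th <= phi <= th -> Rabs (Im p) < th -> Cexp (k * (s, phi)) = Cexp (k * p) -> (s, phi) = p.
Proof.
intros Hk Hth Hphi Hp E. apply Rabs_def2 in Hp. apply Cexp_inj in E.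
- apply (f_equal (fun z => (/ k * z)%C)) in E.
  assert (Hk0 : RtoC k <> RtoC 0) by (intros K; apply RtoC_inj in K; lra).
  transitivity (/ k * (k * (s, phi)))%C; [Cfield; exact Hk0|]. rewrite E. Cfield. exact Hk0.
- rewrite !Im_Rmult. cbn [Im snd].
  replace (k * phi - k * Im p) with (k * (phi - Im p)) by ring.
  rewrite Rabs_mult, (Rabs_pos_eq k) by lra.
  assert (Rabs (phi - Im p) < 2 * th) by (apply Rabs_def1; lra). nra.
Qed.

(** The denominator has a single zero in the strip, and it is simple with derivative $ke^{kp}$.
    Serves twice: with [k = 1] for the pole of the approximation to the Gamma integrand, and with
    [k = beta] for the pole of the Mittag-Leffler kernel. *)
Lemma hankel_cut_residue (h h' : C -> C) (a0 a b k th : R) (p : C) :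
  a0 < a -> a < Re p -> Re p < b -> 0 < k -> k * th <= PI -> Rabs (Im p) < th ->
  (forall s phi, a0 < s -> - th <= phi <= th -> is_C1 h h' (s, phi)) ->
  hankel_cut (fun w => h w / (Cexp (k * w) - Cexp (k * p)))%C a b th =
  (arc_int (fun w => h w / (Cexp (k * w) - Cexp (k * p))) b th
   - 2 * PI * Ci * (h p / (k * Cexp (k * p))))%C.
Proof.
intros Ha0 Ha Hb Hk Hth Hp H. rewrite hankel_cut_rect. f_equal. f_equal.
apply Rabs_def2 in Hp.
set (D := fun w : C => (Cexp (k * w) - Cexp (k * p))%C).
set (D' := fun w : C => (Cexp (k * w) * k)%C).
assert (CD : forall w, is_C1 D D' w).
{ intros w. pose proof (is_C1_plus _ _ _ _ w (is_C1_Cexp _ _ w (is_C1_linear k w))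
    (is_C1_const (- Cexp (k * p))%C w)) as [A B]. split.
  - generalize A. apply filter_imp. intros v V. eapply is_Cderiv_eq; [exact V|].
    unfold D'. Cring.
  - apply continuous_Cmult; [|apply continuous_const].
    apply continuous_Cexp, continuous_Cmult; [apply continuous_const | apply continuous_id]. }
assert (Nz : forall s phi, - th <= phi <= th -> (s, phi) <> p -> D (s, phi) <> RtoC 0).
{ intros s phi Hphi N. apply Cminus_neq_0. intros E. apply N.
  apply (Cexp_scal_inj k th); try lra; [|exact E]. apply Rabs_def1; lra. }
apply (residue_rectangle _ (fun w => h' w * / D w + h w * (- D' w / (D w * D w)))%C
  a0 (b + 1) a b (- th) th (Re p) (Im p)); try lra.
- intros s phi Hs Hphi N.
  assert (N' : (s, phi) <> p) by now rewrite (surjective_pairing p).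
  apply is_C1_mult; [apply H; lra|]. apply is_C1_inv; [apply CD | now apply Nz].
- replace ((Re p, Im p) : C) with p by apply surjective_pairing.
  (* With the slope [q] of the denominator, $(w-p)h(w)/D(w)$ is $h(w)/q(w)$, which is continuous at
     [p]; its value there is the residue. *)
  destruct (is_C1_Cderiv _ _ _ (CD p)) as (q & Cq & Eq & LD).
  assert (Hq0 : q p <> RtoC 0).
  { rewrite Eq. apply Cmult_neq_0; [apply Cexp_neq_0|].
    intros K; apply RtoC_inj in K; lra. }
  assert (D0 : D p = RtoC 0) by (unfold D; ring).
  assert (Ch : continuous h p).
  { rewrite (surjective_pairing p). eapply is_C1_continuous, H; unfold Re, Im in *; lra. }
  assert (Chq : continuous (fun w => h w / q w)%C p) by now apply continuous_Cdiv.
  intros e He.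
  pose proof (proj1 (filterlim_C_Cmod _ _) Chq e He) as L.
  pose proof (locally_neq_0 q p Cq Hq0) as Lq.
  generalize (filter_and _ _ L (filter_and _ _ LD Lq)). apply filter_imp.
  intros w [A [B Q]] N. left.
  replace ((w - p) * (h w / (Cexp (k * w) - Cexp (k * p))))%C with (h w / q w)%C.
  + replace (h p / (k * Cexp (k * p)))%C with (h p / q p)%C; [exact A|].
    rewrite Eq. unfold D'. rewrite (Cmult_comm (Cexp _)). reflexivity.
  + change (Cexp (k * w) - Cexp (k * p))%C with (D w). rewrite B, D0.
    Cfield. split; [exact Q | now apply Cminus_neq_0].
Qed.

Definition ray_continuous (F : C -> C) (a phi : R) : Prop :=
  forall s, a <= s -> continuous F (s, phi).

Definition hankel_continuous (F : C -> C) (a th : R) : Prop :=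
  ray_continuous F a th /\ ray_continuous F a (- th) /\
  (forall phi, - th <= phi <= th -> continuous F (a, phi)).

Lemma ex_CInt_ray (F : C -> C) (a phi u v : R) :
  ray_continuous F a phi -> a <= u -> a <= v -> ex_CInt (fun s => F (s, phi)) u v.
Proof.
intros H Hu Hv. apply ex_CInt_continuous. intros s Hs.
apply (continuous_comp (fun s : R => ((s, phi) : C)) F); [apply continuous_horizontal|].
apply H. apply Rle_trans with (Rmin u v); [now apply Rmin_glb | apply Hs].
Qed.

Lemma RInt_exp_opp (M a b : R) :
  is_RInt (fun s => M * exp (- s)) a b (M * (exp (- a) - exp (- b))).
Proof.
replace (M * (exp (- a) - exp (- b))) with (minus (- M * exp (- b)) (- M * exp (- a))).
- apply (is_RInt_derive (V := R_CompleteNormedModule) (fun s => - M * exp (- s))).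
  + intros s _. auto_derive; [auto | ring].
  + intros s _. apply (ex_derive_continuous (V := R_NormedModule)). auto_derive. auto.
- unfold minus, plus, opp; cbn. ring.
Qed.

Lemma Cmod_CInt_ray_le (F : C -> C) (M a phi u v : R) :
  ray_continuous F a phi -> a <= u -> u <= v ->
  (forall s, u <= s <= v -> Cmod (F (s, phi)) <= M * exp (- s)) -> 0 <= M ->
  Cmod (CInt (fun s => F (s, phi)) u v) <= M * exp (- u).
Proof.
intros Cf Hu Huv H HM.
eapply Rle_trans.
- apply (Cmod_CInt_le _ (fun s => M * exp (- s))); [exact Huv | exact H | |].
  + apply (ex_CInt_ray F a); lra || assumption.
  + eexists; apply RInt_exp_opp.
- rewrite (is_RInt_unique _ _ _ _ (RInt_exp_opp M u v)).
  pose proof (exp_pos (- v)). apply Rmult_le_compat_l; lra.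
Qed.

(** The arc has length [2 * th] and the weight $e^{-s}$ has mass at most $e^{-a}$ on each ray. As
    [b] does not occur in the bound, it passes to the improper integral. *)
Lemma Cmod_hankel_cut_le (F : C -> C) (M a b th : R) : 0 <= th -> a <= b -> 0 <= M ->
  hankel_continuous F a th ->
  (forall s, a <= s -> Cmod (F (s, th)) <= M * exp (- s) /\ Cmod (F (s, - th)) <= M * exp (- s)) ->
  (forall phi, - th <= phi <= th -> Cmod (F (a, phi)) <= M) ->
  Cmod (hankel_cut F a b th) <= (2 * th + 2 * exp (- a)) * M.
Proof.
intros Hth Hab HM (C1 & C2 & C3) HR HA. unfold hankel_cut, Cminus.
eapply Rle_trans; [apply Cmod_triangle|]. rewrite Cmod_opp.
assert (K1 : Cmod (Ci * CInt (fun phi => F (a, phi)) (- th) th) <= (th - - th) * M).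
{ rewrite Cmod_mult, Cmod_Ci, Rmult_1_l. apply Cmod_CInt_le_const; [lra | exact HA|].
  apply ex_CInt_vertical; [lra | exact C3]. }
assert (K2 : Cmod (CInt (fun s => F (s, th)) a b) <= M * exp (- a)).
{ apply (Cmod_CInt_ray_le F M a); try lra; try assumption. intros; apply HR; lra. }
assert (K3 : Cmod (CInt (fun s => F (s, - th)) a b) <= M * exp (- a)).
{ apply (Cmod_CInt_ray_le F M a); try lra; try assumption. intros; apply HR; lra. }
pose proof (Cmod_triangle (Ci * CInt (fun phi => F (a, phi)) (- th) th)
  (CInt (fun s => F (s, th)) a b)). lra.
Qed.

Lemma hankel_cut_linear (F G : C -> C) (c : C) (a b th : R) : 0 <= th -> a <= b ->
  hankel_continuous F a th -> hankel_continuous G a th ->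
  hankel_cut (fun w => F w - c * G w)%C a b th =
  (hankel_cut F a b th - c * hankel_cut G a b th)%C.
Proof.
intros Hth Hab (F1 & F2 & F3) (G1 & G2 & G3).
assert (L : forall f g : R -> C, forall u v : R, ex_CInt f u v -> ex_CInt g u v ->
  CInt (fun t => f t - c * g t)%C u v = (CInt f u v - c * CInt g u v)%C).
{ intros f g u v Hf Hg. rewrite CInt_minus, CInt_Cmult; [reflexivity | assumption | assumption |].
  now apply ex_CInt_Cmult. }
unfold hankel_cut.
rewrite (L (fun phi => F (a, phi)) (fun phi => G (a, phi))).
2,3: apply ex_CInt_vertical; lra || assumption.
rewrite (L (fun s => F (s, th)) (fun s => G (s, th))).
2: apply (ex_CInt_ray F a); lra || assumption.
2: apply (ex_CInt_ray G a); lra || assumption.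
rewrite (L (fun s => F (s, - th)) (fun s => G (s, - th))).
2: apply (ex_CInt_ray F a); lra || assumption.
2: apply (ex_CInt_ray G a); lra || assumption.
Cring.
Qed.

Definition is_ray_int (F : C -> C) (a phi : R) (l : C) : Prop :=
  filterlim (fun b => CInt (fun s => F (s, phi)) a b) (Rbar_locally p_infty) (locally l).

(** Both rays are cut at the same abscissa, so identities between truncated contours pass to the
    limit at once. Convergence itself is proved ray by ray. *)
Definition is_hankel_log (F : C -> C) (a th : R) (l : C) : Prop :=
  filterlim (fun b => hankel_cut F a b th) (Rbar_locally p_infty) (locally l).

Lemma Rbar_locally_p_infty_ge (a : R) : Rbar_locally p_infty (fun b => a <= b).
Proof. exists a. intros x Hx. lra. Qed.

Lemma exp_opp_small (M e : R) : 0 < e -> exists u : R, M * exp (- u) < e.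
Proof.
intros He. destruct (Rle_dec M 0) as [HM|HM].
- exists 0. rewrite Ropp_0, exp_0. lra.
- exists (ln (M / e) + 1).
  assert (0 < M / e) by (apply Rdiv_lt_0_compat; lra).
  replace (- (ln (M / e) + 1)) with (- ln (M / e) + - 1) by ring.
  rewrite exp_plus, exp_Ropp, exp_ln by assumption.
  replace (M * (/ (M / e) * exp (-1))) with (e * exp (-1)) by (field; lra).
  pose proof (exp_increasing (-1) 0 ltac:(lra)) as K. rewrite exp_0 in K. nra.
Qed.

(** Cauchy's criterion. The majorant is asked for only beyond [a1]: that of the Mittag-Leffler
    kernel comes from a geometric expansion valid far out, whereas the ray starts at the given
    radius. *)
Lemma ex_ray_int (F : C -> C) (a a1 phi M : R) : a <= a1 -> ray_continuous F a phi ->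
  (forall s, a1 <= s -> Cmod (F (s, phi)) <= M * exp (- s)) ->
  exists l, is_ray_int F a phi l.
Proof.
intros Ha Cf H.
apply (filterlim_locally_cauchy (U := C_R_CompleteNormedModule)). intros e.
assert (HM : 0 <= M).
{ specialize (H a1 (Rle_refl _)). pose proof (Cmod_ge_0 (F (a1, phi))).
  pose proof (exp_pos (- a1)). nra. }
destruct (exp_opp_small M e (cond_pos e)) as [u0 Hu0].
pose (u := Rmax u0 a1).
assert (Hu1 : u0 <= u) by apply Rmax_l. assert (Hu2 : a1 <= u) by apply Rmax_r.
assert (Hu3 : M * exp (- u) < e).
{ eapply Rle_lt_trans; [|exact Hu0]. apply Rmult_le_compat_l; [lra|]. apply exp_le_exp; lra. }
assert (K : forall v w, u < v -> v <= w ->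
  Cmod (CInt (fun s => F (s, phi)) a w - CInt (fun s => F (s, phi)) a v) < e).
{ intros v w Hv Hvw.
  rewrite <- (CInt_Chasles _ a v w); try (apply (ex_CInt_ray F a); lra || assumption).
  replace (CInt (fun s => F (s, phi)) a v + CInt (fun s => F (s, phi)) v w
    - CInt (fun s => F (s, phi)) a v)%C with (CInt (fun s => F (s, phi)) v w) by Cring.
  eapply Rle_lt_trans; [|exact Hu3]. eapply Rle_trans.
  - apply (Cmod_CInt_ray_le F M a); try lra; [assumption|]. intros s Hs. apply H. lra.
  - apply Rmult_le_compat_l; [lra|]. apply exp_le_exp; lra. }
exists (fun b => u < b). split.
- now exists u.
- intros v w Hv Hw. apply C_NormedModule_mixin_compat1.
  destruct (Rle_dec v w) as [L|L].
  + now apply K.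
  + change (Cmod (CInt (fun s => F (s, phi)) a w - CInt (fun s => F (s, phi)) a v) < e).
    rewrite Cmod_minus_sym. apply K; lra.
Qed.

Lemma is_hankel_log_rays (F : C -> C) (a th : R) (l1 l2 : C) :
  is_ray_int F a th l1 -> is_ray_int F a (- th) l2 ->
  is_hankel_log F a th (arc_int F a th + l1 - l2)%C.
Proof.
intros H1 H2. apply filterlim_Cminus; [|exact H2]. apply filterlim_Cplus; [|exact H1].
apply filterlim_const.
Qed.

Lemma hankel_cut_ext (F G : C -> C) (a b th : R) :
  (forall w, F w = G w) -> hankel_cut F a b th = hankel_cut G a b th.
Proof.
intros H. unfold hankel_cut.
rewrite (CInt_ext (fun phi => F (a, phi)) (fun phi => G (a, phi))),
  (CInt_ext (fun s => F (s, th)) (fun s => G (s, th))),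
  (CInt_ext (fun s => F (s, - th)) (fun s => G (s, - th))); auto.
Qed.

Lemma hankel_cut_Cmult (F : C -> C) (c : C) (a b th : R) : 0 <= th -> a <= b ->
  hankel_continuous F a th ->
  hankel_cut (fun w => c * F w)%C a b th = (c * hankel_cut F a b th)%C.
Proof.
intros Hth Hab (F1 & F2 & F3). unfold hankel_cut.
rewrite (CInt_Cmult (fun phi => F (a, phi))), (CInt_Cmult (fun s => F (s, th))),
  (CInt_Cmult (fun s => F (s, - th))); [Cring | | |].
- apply (ex_CInt_ray F a); lra || assumption.
- apply (ex_CInt_ray F a); lra || assumption.
- apply ex_CInt_vertical; lra || assumption.
Qed.

(** Supplies the boundary terms of integration by parts: the contour is connected, so only its two
    far ends remain. *)
Lemma hankel_cut_derive (T T' : C -> C) (a b th : R) : 0 <= th -> a <= b ->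
  (forall s, a <= s -> is_C1 T T' (s, th)) -> (forall s, a <= s -> is_C1 T T' (s, - th)) ->
  (forall phi, - th <= phi <= th -> is_C1 T T' (a, phi)) ->
  hankel_cut T' a b th = (T (b, th) - T (b, (- th)%R))%C.
Proof.
intros Hth Hab H1 H2 H3. unfold hankel_cut.
rewrite (CInt_derive_horizontal T T' th), (CInt_derive_horizontal T T' (- th));
  try assumption; try (intros; apply H1 || apply H2; lra).
pose proof (CInt_derive_vertical T T' a (- th) th ltac:(lra) H3) as K.
rewrite CInt_Cmult in K.
- rewrite K. Cring.
- apply ex_CInt_vertical; [lra|]. intros phi Hphi. now apply H3.
Qed.

Lemma Cmod_Cexp_mult_le (c : C) (s phi th : R) : - th <= phi <= th ->
  Cmod (Cexp (c * (s, phi))) <= exp (Re c * s) * exp (Rabs (Im c) * th).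
Proof.
intros H. rewrite Cmod_Cexp, <- exp_plus. apply exp_le_exp.
destruct c as [x y]. cbn. apply Rplus_le_compat_l.
assert (- (y * phi) <= Rabs y * th); [|lra].
eapply Rle_trans; [apply Rle_abs|]. rewrite Rabs_Ropp, Rabs_mult.
apply Rmult_le_compat_l; [apply Rabs_pos|]. apply Rabs_le. lra.
Qed.

Lemma filterlim_Cmod_le_exp (f : R -> C) (K k : R) : 0 < k ->
  Rbar_locally p_infty (fun b => Cmod (f b) <= K * exp (- (k * b))) ->
  filterlim f (Rbar_locally p_infty) (locally (RtoC 0)).
Proof.
intros Hk H. apply filterlim_C_Cmod. intros e He.
destruct (exp_opp_small K e He) as [u Hu].
assert (L : Rbar_locally p_infty (fun b => Rmax 0 u / k < b)) by (now exists (Rmax 0 u / k)).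
generalize (filter_and _ _ H L). apply filter_imp. intros b [A B].
replace (f b - 0)%C with (f b) by Cring. eapply Rle_lt_trans; [exact A|].
assert (Rmax 0 u < k * b).
{ apply (Rmult_lt_compat_l k) in B; [|exact Hk].
  replace (k * (Rmax 0 u / k)) with (Rmax 0 u) in B by (field; lra). exact B. }
pose proof (Rmax_r 0 u).
destruct (Rle_dec 0 K) as [HK|HK].
- eapply Rle_lt_trans; [|exact Hu]. apply Rmult_le_compat_l; [exact HK|]. apply exp_le_exp. lra.
- pose proof (exp_pos (- (k * b))). nra.
Qed.

Lemma Cexp_neq_pos (N s phi : R) : 0 < N -> Rabs phi < 2 * PI -> phi <> 0 ->
  Cexp (s, phi) <> RtoC N.
Proof.
intros HN Hphi H0 E.
assert (E' : Cexp (s, phi) = Cexp (ln N)) by (rewrite E, Cexp_Rexp, exp_ln; auto).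
apply Cexp_inj in E'.
- injection E'. intros. contradiction.
- cbn. now rewrite Rminus_0_r.
Qed.

Lemma Cexp_neq_lt (N s phi : R) : exp s < N -> Cexp (s, phi) <> RtoC N.
Proof.
intros HN E. apply (f_equal Cmod) in E. rewrite Cmod_Cexp, Cmod_R in E. cbn in E.
pose proof (Rle_abs N). lra.
Qed.

(** The pole $u=N$ lies on the positive axis. The rays have argument $\pm th\ne0$, and the arc has
    radius $e^a<N$. *)
Lemma Cexp_neq_contour (N a th : R) : 0 < N -> a < ln N -> 0 < th <= PI ->
  (forall s, Cexp (s, th) <> RtoC N) /\ (forall s, Cexp (s, - th) <> RtoC N) /\
  (forall phi, Cexp (a, phi) <> RtoC N).
Proof.
intros HN Ha Hth. pose proof PI_RGT_0. repeat split.
- intros s. apply Cexp_neq_pos; [exact HN | rewrite Rabs_pos_eq; lra | lra].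
- intros s. apply Cexp_neq_pos; [exact HN | rewrite Rabs_Ropp, Rabs_pos_eq; lra | lra].
- intros phi. apply Cexp_neq_lt. rewrite <- (exp_ln N HN). now apply exp_increasing.
Qed.

(** * Hankel's formula for 1 / Gamma *)

(* (1 - u/N)^{-j} u^{-z} du in the coordinate u = e^w; it approximates e^u u^{-z} du
   when j = N is large, and decays in all directions. *)
Definition gamma_approx (N : R) (j : nat) (z w : C) : C :=
  ((/ (1 - Cexp w / N)) ^ j * Cexp ((1 - z) * w))%C.

Lemma one_minus_neq_0 (N : R) (w : C) : 0 < N -> Cexp w <> RtoC N ->
  (1 - Cexp w / N)%C <> RtoC 0.
Proof.
intros HN H E. apply H.
assert (HN0 : RtoC N <> RtoC 0) by (intros K; apply RtoC_inj in K; lra).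
replace (Cexp w) with (N * (Cexp w / N))%C by (field; exact HN0).
replace (Cexp w / N)%C with (1 - (1 - Cexp w / N))%C by ring. rewrite E. ring.
Qed.

Lemma is_C1_ext_deriv (F F' G' : C -> C) (w : C) :
  is_C1 F F' w -> (forall v, F' v = G' v) -> is_C1 F G' w.
Proof.
intros [A B] E. split.
- generalize A. apply filter_imp. intros v V. eapply is_Cderiv_eq; [exact V | apply E].
- now apply (continuous_ext F').
Qed.

Lemma is_C1_gamma_inv (N : R) (w : C) : 0 < N -> Cexp w <> RtoC N ->
  is_C1 (fun w => / (1 - Cexp w / N))%C
    (fun w => Cexp w / N * / (1 - Cexp w / N) * / (1 - Cexp w / N))%C w.
Proof.
intros HN H. pose proof (one_minus_neq_0 N w HN H) as H0.
assert (A : is_C1 (fun w => 1 - Cexp w / N)%C (fun w => - (Cexp w / N))%C w).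
{ pose proof (is_C1_plus _ _ _ _ w (is_C1_const 1 w)
   (is_C1_mult _ _ _ _ w (is_C1_const (- / N)%C w) (is_C1_Cexp _ _ w (is_C1_id w)))) as [B D].
  split.
  - generalize B. apply filter_imp. intros v (q & Q1 & Q2 & Q3). exists q.
    split; [exact Q1|]. split; [rewrite Q2; unfold Cdiv; Cring|].
    generalize Q3. apply filter_imp. intros u U.
    transitivity (1 + - / N * Cexp u)%C; [unfold Cdiv; Cring|]. rewrite U. unfold Cdiv. Cring.
  - apply continuous_Copp. apply continuous_Cmult; [|apply continuous_const].
    apply continuous_Cexp, continuous_id. }
pose proof (is_C1_inv _ _ _ A H0) as [B D].
assert (Cw : continuous (fun w => / (1 - Cexp w / N))%C w).
{ apply continuous_Cinv; [|exact H0]. eapply is_C1_continuous, A. }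
split.
- generalize (filter_and _ _ B (locally_neq_0 _ _ (is_C1_continuous _ _ _ A) H0)).
  apply filter_imp. intros v [V V0]. eapply is_Cderiv_eq; [exact V|].
  cbv beta. generalize dependent (1 - Cexp v / N)%C. intros X _ HX.
  generalize (Cexp v / N)%C. intros Y. Cfield. exact HX.
- apply continuous_Cmult; [|exact Cw]. apply continuous_Cmult; [|exact Cw].
  apply continuous_Cmult; [|apply continuous_const]. apply continuous_Cexp, continuous_id.
Qed.

Lemma continuous_gamma_approx (N : R) (j : nat) (z w : C) : 0 < N -> Cexp w <> RtoC N ->
  continuous (gamma_approx N j z) w.
Proof.
intros HN H. apply continuous_Cmult.
- apply continuous_Cpow. eapply is_C1_continuous, is_C1_gamma_inv; assumption.
- apply continuous_Cexp, continuous_Cmult; [apply continuous_const | apply continuous_id].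
Qed.

Lemma hankel_continuous_gamma_approx (N : R) (j : nat) (z : C) (a th : R) :
  0 < N -> a < ln N -> 0 < th <= PI -> hankel_continuous (gamma_approx N j z) a th.
Proof.
intros HN Ha Hth. destruct (Cexp_neq_contour N a th HN Ha Hth) as (A & B & D).
repeat split; repeat intro; eapply continuous_gamma_approx; eauto.
Qed.

(** For $|u|\ge2N$ one has $|1-u/N|\ge|u|/N-1\ge|u|/(2N)$ whatever the argument of $u$. *)
Lemma Cmod_gamma_approx_le (N : R) (j : nat) (z : C) (s phi th : R) :
  0 < N -> 2 * N <= exp s -> - th <= phi <= th ->
  Cmod (gamma_approx N j z (s, phi)) <=
    (2 * N) ^ j * exp (Rabs (Im z) * th) * exp (- ((Re z + INR j - 1) * s)).
Proof.
intros HN Hs Hphi. unfold gamma_approx. rewrite Cmod_mult, Cmod_pow.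
pose proof (exp_pos s) as Ps.
assert (A : exp s / (2 * N) <= Cmod (1 - Cexp (s, phi) / N)).
{ rewrite Cmod_minus_sym. eapply Rle_trans; [|apply Cmod_triangle_inv].
  rewrite Cmod_div, Cmod_Cexp, Cmod_R, Cmod_1, Rabs_pos_eq; cbn; try lra.
  - apply (Rmult_le_reg_r (2 * N)); [lra|].
    replace (exp s / (2 * N) * (2 * N)) with (exp s) by (field; lra).
    replace ((exp s / N - 1) * (2 * N)) with (2 * exp s - 2 * N) by (field; lra). lra.
  - intros K; apply RtoC_inj in K; lra. }
assert (P : 0 < exp s / (2 * N)) by (apply Rdiv_lt_0_compat; lra).
rewrite Cmod_inv by (apply Cmod_gt_0; lra).
apply Rle_trans with ((2 * N * exp (- s)) ^ j * (exp (Re (1 - z) * s) * exp (Rabs (Im (1 - z)) * th))).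
- apply Rmult_le_compat; [|apply Cmod_ge_0| |now apply Cmod_Cexp_mult_le].
  + apply pow_le. left. apply Rinv_0_lt_compat. lra.
  + apply pow_incr. split; [left; apply Rinv_0_lt_compat; lra|].
    rewrite exp_Ropp. replace (2 * N * / exp s) with (/ (exp s / (2 * N))) by (field; lra).
    now apply Rinv_le_contravar.
- apply Req_le. rewrite Rpow_mult_distr.
  replace (Rabs (Im (1 - z))) with (Rabs (Im z)).
  2:{ destruct z as [x y]. cbn. rewrite Rplus_0_l. symmetry. apply Rabs_Ropp. }
  replace (exp (- ((Re z + INR j - 1) * s))) with (exp (- s) ^ j * exp (Re (1 - z) * s)); [ring|].
  rewrite <- (Rpower_pow _ _ (exp_pos (- s))). unfold Rpower. rewrite ln_exp, <- exp_plus.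
  f_equal. destruct z as [x y]. cbn. ring.
Qed.

Lemma exp_ge_eventually (M : R) : 0 < M -> Rbar_locally p_infty (fun s => M <= exp s).
Proof.
intros HM. exists (ln M). intros s Hs. rewrite <- (exp_ln M HM). left.
now apply exp_increasing.
Qed.

(** The integral of [gamma_approx N (S j) z], with exponent one larger than the index here, divided
    by $2\pi i$. The base case $N^{1-z}$ is minus the residue at $u=N$; each recursive step is one
    integration by parts. *)
Fixpoint gamma_approx_val (N : R) (j : nat) (z : C) : C :=
  match j with
  | O => Cexp ((1 - z) * ln N)
  | S k => (N / INR (S k) * z * gamma_approx_val N k (z + 1))%C
  end.

(** The arc is pushed out to infinity, past the pole at $u=N$. For $\Re z>0$ the remaining arc
    integral is $O(e^{-b\Re z})$, so only the residue survives. *)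
Lemma is_hankel_log_gamma_approx_1 (N a th : R) (z : C) :
  0 < N -> a < ln N -> 0 < th <= PI -> 0 < Re z ->
  is_hankel_log (gamma_approx N 1 z) a th (2 * PI * Ci * gamma_approx_val N 0 z)%C.
Proof.
intros HN Ha Hth Hz. cbn [gamma_approx_val].
assert (HN0 : RtoC N <> RtoC 0) by (intros K; apply RtoC_inj in K; lra).
assert (H2N : 0 < 2 * N) by lra.
apply (filterlim_ext_loc (fun b => arc_int (gamma_approx N 1 z) b th
  + 2 * PI * Ci * Cexp ((1 - z) * ln N))%C).
- generalize (filter_and _ _ (exp_ge_eventually _ H2N)
    (Rbar_locally_p_infty_ge a)).
  apply filter_imp. intros b [Hb Hb2]. cbv beta in Hb, Hb2.
  assert (Hlb : ln N < b).
  { rewrite <- (ln_exp b). apply ln_increasing; lra. }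
  pose (h := fun w : C => (- N * Cexp ((1 - z) * w))%C).
  assert (E : forall w, gamma_approx N 1 z w = (h w / (Cexp (1 * w) - Cexp (1 * ln N)))%C).
  { intros w. unfold gamma_approx, h. cbn [Cpow]. rewrite !Cmult_1_l, Cmult_1_r, Cexp_Rexp.
    rewrite exp_ln by exact HN. destruct (Ceq_dec (Cexp w) N) as [Ew|Ew].
    (* The identity is needed at every point, the pole included; there both sides are 0 because the
       inverse of 0 is 0. *)
    - rewrite Ew. replace (1 - N / N)%C with (RtoC 0) by (field; exact HN0).
      replace (N - N)%C with (RtoC 0) by ring. unfold Cdiv.
      replace (/ 0)%C with (RtoC 0); [ring|].
      unfold Cinv, RtoC; cbn. f_equal; unfold Rdiv; ring.
    - field. repeat split; try exact HN0; apply Cminus_neq_0; congruence. }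
  rewrite (hankel_cut_ext _ _ a b th E).
  rewrite (hankel_cut_residue h (fun w => - N * (Cexp ((1 - z) * w) * (1 - z)))%C
    (a - 1) a b 1 th (ln N)); cbn [Re Im fst snd RtoC]; try lra.
  + unfold arc_int. rewrite (CInt_ext (fun phi => gamma_approx N 1 z (b, phi)) _ _ _ (fun t _ => E _)).
    unfold h. rewrite (Cmult_1_l (RtoC (ln N))), (Cexp_Rexp (ln N)), exp_ln by exact HN.
    Cfield. exact HN0.
  + rewrite Rabs_R0; lra.
  + intros s phi _ _. eapply is_C1_ext_deriv.
    * apply is_C1_mult; [apply is_C1_const | apply is_C1_Cexp, is_C1_linear].
    * intros v. Cring.
- replace (2 * PI * Ci * Cexp ((1 - z) * ln N))%C
    with (0 + 2 * PI * Ci * Cexp ((1 - z) * ln N))%C at 1 by ring.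
  apply filterlim_Cplus; [|apply filterlim_const].
  apply (filterlim_Cmod_le_exp _ ((th - - th) * ((2 * N) ^ 1 * exp (Rabs (Im z) * th))) (Re z));
    [exact Hz|].
  generalize (filter_and _ _ (exp_ge_eventually _ H2N)
    (Rbar_locally_p_infty_ge (ln N + 1))).
  apply filter_imp. intros b [Hb Hb2]. cbv beta in Hb, Hb2.
  unfold arc_int. rewrite Cmod_mult, Cmod_Ci, Rmult_1_l, Rmult_assoc.
  apply Cmod_CInt_le_const; [lra | |].
  + intros phi Hphi. eapply Rle_trans; [now apply (Cmod_gamma_approx_le N 1 z b phi th)|].
    apply Req_le. f_equal. f_equal. f_equal. cbn. ring.
  + apply ex_CInt_vertical; [lra|]. intros phi Hphi. apply continuous_gamma_approx; [exact HN|].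
    intros E. apply (f_equal Cmod) in E. rewrite Cmod_Cexp, Cmod_R in E. cbn in E.
    rewrite Rabs_pos_eq in E by lra. lra.
Qed.

(** Integration by parts lowers the exponent by one and raises [z] by one, so the condition on
    [Re z + INR j] is preserved down to the case of a simple pole. The same condition makes the
    boundary terms vanish. *)
Lemma is_hankel_log_gamma_approx (N a th : R) (j : nat) (z : C) :
  0 < N -> a < ln N -> 0 < th <= PI -> 0 < Re z + INR j ->
  is_hankel_log (gamma_approx N (S j) z) a th (2 * PI * Ci * gamma_approx_val N j z)%C.
Proof.
intros HN Ha Hth. revert z. induction j as [|j IH]; intros z Hz.
{ apply is_hankel_log_gamma_approx_1; try assumption. cbn in Hz. lra. }
rewrite S_INR in Hz.
assert (HN0 : RtoC N <> RtoC 0) by (intros K; apply RtoC_inj in K; lra).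
assert (H2N : 0 < 2 * N) by lra.
assert (Hj : 0 < INR (S j)) by (apply lt_0_INR; lia).
assert (Hj0 : RtoC (INR (S j)) <> RtoC 0) by (intros K; apply RtoC_inj in K; lra).
assert (Ej : (INR j + 1)%C = RtoC (INR (S j))) by now rewrite S_INR, RtoC_plus.
(* In the variable $u$ this is $(1-u/N)^{-(j+1)}u^{-z}$. The factor $e^w$ that the chain rule
   produces turns [z + 1] back into [z] in one of the two terms of the derivative. *)
pose (T := gamma_approx N (S j) (z + 1)).
pose (T' := fun w => (INR (S j) / N * gamma_approx N (S (S j)) z w
                      - z * gamma_approx N (S j) (z + 1) w)%C).
assert (CT : forall w, Cexp w <> RtoC N -> is_C1 T T' w).
{ intros w Hw.
  pose proof (is_C1_mult _ _ _ _ w (is_C1_pow _ _ j w (is_C1_gamma_inv N w HN Hw))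
    (is_C1_Cexp _ _ w (is_C1_linear (1 - (z + 1)) w))) as A.
  eapply is_C1_ext_deriv; [exact A|]. intros v. unfold T', gamma_approx. cbv beta.
  rewrite Ej. cbn [Cpow].
  replace (Cexp ((1 - z) * v)) with (Cexp v * Cexp ((1 - (z + 1)) * v))%C.
  - unfold Cdiv. Cring.
  - rewrite <- Cexp_plus. f_equal. ring. }
destruct (Cexp_neq_contour N a th HN Ha Hth) as (A & B & D).
apply (filterlim_ext_loc (fun b => N / INR (S j) * (T (b, th) - T (b, (- th)%R)
   + z * hankel_cut (gamma_approx N (S j) (z + 1)) a b th))%C).
- generalize (Rbar_locally_p_infty_ge a). apply filter_imp. intros b Hb. cbv beta in Hb.
  rewrite <- (hankel_cut_derive T T' a b th); [|lra | lra | | |]; try (intros; apply CT; auto).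
  unfold T'. rewrite (hankel_cut_linear (fun w => INR (S j) / N * gamma_approx N (S (S j)) z w)%C);
    [|lra | lra | |].
  + rewrite hankel_cut_Cmult; [|lra | lra |].
    * Cfield. split; assumption.
    * now apply hankel_continuous_gamma_approx.
  + destruct (hankel_continuous_gamma_approx N (S (S j)) z a th HN Ha Hth) as (P & Q & R0).
    repeat split; repeat intro; apply continuous_Cmult; auto; apply continuous_const.
  + now apply hankel_continuous_gamma_approx.
- assert (LT : forall phi, - th <= phi <= th ->
    filterlim (fun b => T (b, phi)) (Rbar_locally p_infty) (locally (RtoC 0))).
  { intros phi Hphi.
    apply (filterlim_Cmod_le_exp _ ((2 * N) ^ (S j) * exp (Rabs (Im z) * th)) (Re z + INR (S j))).
    - rewrite S_INR. lra.
    - generalize (exp_ge_eventually _ H2N).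
      apply filter_imp. intros b Hb. cbv beta in Hb.
      eapply Rle_trans; [now apply (Cmod_gamma_approx_le N (S j) (z + 1) b phi th)|].
      apply Req_le. destruct z as [x y]. cbn [Im Re Cplus fst snd RtoC].
      rewrite Rplus_0_r. f_equal. f_equal. f_equal. f_equal. ring. }
  replace (2 * PI * Ci * gamma_approx_val N (S j) z)%C
    with (N / INR (S j) * (0 - 0 + z * (2 * PI * Ci * gamma_approx_val N j (z + 1))))%C
    by (cbn [gamma_approx_val]; Cring).
  apply filterlim_Cmult; [apply filterlim_const|].
  apply filterlim_Cplus.
  + apply filterlim_Cminus; apply LT; lra.
  + apply filterlim_Cmult; [apply filterlim_const|]. apply IH.
    destruct z as [x y]. cbn in Hz |- *. lra.
Qed.

Lemma Crising_shift (z : C) (n : nat) : Crising z (S n) = (z * Crising (z + 1) n)%C.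
Proof.
induction n as [|n IH].
- cbn. ring.
- change (Crising z (S (S n))) with (Crising z (S n) * (z + INR (S (S n))))%C.
  rewrite IH. cbn [Crising]. rewrite (S_INR (S n)), RtoC_plus. ring.
Qed.

(** Unrolling the recursion: each factor $N$ compensates for one shift of [z] in the final power, so
    the power of $N$ stays $N^{1-z}$ while the factors $z+k$ build up the rising product. *)
Lemma gamma_approx_val_S (N : R) (n : nat) (z : C) : 0 < N ->
  gamma_approx_val N (S n) z =
  (Crising z n * Cexp ((1 - z) * ln N) / INR (fact (S n)))%C.
Proof.
intros HN.
assert (HN0 : RtoC N <> RtoC 0) by (intros K; apply RtoC_inj in K; lra).
assert (EN : forall z, (N * Cexp ((1 - (z + 1)) * ln N) = Cexp ((1 - z) * ln N))%C).
{ intros u. rewrite <- (exp_ln N HN) at 1. rewrite <- Cexp_Rexp, <- Cexp_plus. f_equal. ring. }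
revert z. induction n as [|n IH]; intros z.
- cbn [gamma_approx_val Crising]. rewrite <- (EN z). change (fact 1) with 1%nat. change (INR 1) with 1. field.
- change (gamma_approx_val N (S (S n)) z)
    with (N / INR (S (S n)) * z * gamma_approx_val N (S n) (z + 1))%C.
  rewrite IH, Crising_shift, <- (EN z).
  change (fact (S (S n))) with (S (S n) * fact (S n))%nat.
  rewrite (mult_INR (S (S n))), RtoC_mult. field. split.
  + intros K. apply RtoC_inj in K. apply (INR_fact_neq_0 (S n) K).
  + intros K. apply RtoC_inj in K. apply (not_0_INR (S (S n)) ltac:(lia) K).
Qed.

(** * Approximation of $e^u$ by $(1-u/m)^{-m}$, uniformly on the contour *)

(** Telescoping. The difference is measured relative to [M], so the bound keeps the full power
    [M ^ n], which is the source of decay along the rays. *)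
Lemma Cmod_pow_minus_le (A B : C) (M d : R) (n : nat) :
  Cmod A <= M -> Cmod B <= M -> Cmod (A - B) <= M * d ->
  Cmod (A ^ n - B ^ n) <= INR n * M ^ n * d.
Proof.
intros HA HB HD.
assert (HM : 0 <= M) by (pose proof (Cmod_ge_0 A); lra).
induction n as [|n IH].
- cbn. replace (1 - 1)%C with (RtoC 0) by ring. rewrite Cmod_0. lra.
- replace (A ^ S n - B ^ S n)%C with (A * (A ^ n - B ^ n) + (A - B) * B ^ n)%C
    by (cbn [Cpow]; ring).
  eapply Rle_trans; [apply Cmod_triangle|]. rewrite !Cmod_mult, Cmod_pow.
  replace (INR (S n) * M ^ S n * d) with (M * (INR n * M ^ n * d) + M * d * M ^ n)
    by (rewrite S_INR; cbn; ring).
  apply Rplus_le_compat; apply Rmult_le_compat; auto using Cmod_ge_0.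
  + apply pow_le, Cmod_ge_0.
  + apply pow_incr. split; [apply Cmod_ge_0 | exact HB].
Qed.

(** Both terms are n-th powers, and $1/(1-v)-e^v=(1-v)^{-1}(1-(1-v)e^v)$ is of second order. With
    $v=u/m$ and $n=m$ the bound is of size $|u|^2/m$. *)
Lemma Cmod_exp_approx_le (v : C) (M E : R) (n : nat) :
  (1 - v)%C <> RtoC 0 -> Cmod (/ (1 - v)) <= M -> Cmod (Cexp v) <= M ->
  (forall t, 0 <= t <= 1 -> exp (t * Re v) <= E) ->
  Cmod ((/ (1 - v)) ^ n - Cexp (INR n * v)) <= INR n * M ^ n * (Cmod v * Cmod v * E).
Proof.
intros Hv HA HB HE. rewrite <- Cexp_pow. apply Cmod_pow_minus_le; try assumption.
replace (/ (1 - v) - Cexp v)%C with (/ (1 - v) * (1 - (1 - v) * Cexp v))%C by (field; exact Hv).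
rewrite Cmod_mult. apply Rmult_le_compat; auto using Cmod_ge_0.
now apply one_minus_Cexp_le.
Qed.

(** A lower bound of order [K] that does not depend on [m]. With $j=\lfloor m/K\rfloor$, Bernoulli's
    inequality gives $(1+t/m)^j\ge1+jt/m$, and $m\le2Kj$ turns this into at least $t/(2K)$; the K-th
    power follows. *)
Lemma pow_one_plus_ge (t : R) (K m : nat) : 0 <= t -> (1 <= K <= m)%nat ->
  (t / (2 * INR K)) ^ K <= (1 + t / INR m) ^ m.
Proof.
intros Ht HK.
assert (K0 : 0 < INR K) by (apply lt_0_INR; lia).
assert (m0 : 0 < INR m) by (apply lt_0_INR; lia).
assert (Htm : 0 <= t / INR m) by (apply Rdiv_le_0_compat; lra).
pose (j := (m / K)%nat).
assert (Hj : (K * j <= m)%nat) by (apply Nat.Div0.mul_div_le).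
assert (Hj2 : (m <= 2 * K * j)%nat).
{ assert (1 <= j)%nat by (apply Nat.div_le_lower_bound; lia).
  assert (m < K * S j)%nat by (apply Nat.mul_succ_div_gt; lia). nia. }
apply le_INR in Hj2. rewrite !mult_INR in Hj2. cbn [INR] in Hj2.
apply Rle_trans with ((1 + t / INR m) ^ (j * K)).
- rewrite pow_mult. apply pow_incr. split; [apply Rdiv_le_0_compat; lra|].
  apply Rle_trans with (1 + INR j * (t / INR m)).
  + assert (t / (2 * INR K) <= INR j * (t / INR m)); [|lra].
    apply (Rmult_le_reg_r (2 * INR K * INR m)); [nra|].
    replace (t / (2 * INR K) * (2 * INR K * INR m)) with (t * INR m) by (field; lra).
    replace (INR j * (t / INR m) * (2 * INR K * INR m)) with (t * ((1 + 1) * INR K * INR j))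
      by (field; lra).
    now apply Rmult_le_compat_l.
  + destruct Htm as [Htm|<-].
    * now apply poly.
    * rewrite Rplus_0_r, pow1. lra.
- apply Rle_pow; [lra | lia].
Qed.

Lemma exp_ge_pow (t : R) (K : nat) : 0 <= t -> (1 <= K)%nat ->
  (t / (2 * INR K)) ^ K <= exp t.
Proof.
intros Ht HK. assert (K0 : 0 < INR K) by (apply lt_0_INR; lia).
eapply Rle_trans; [apply (pow_one_plus_ge t K K Ht); lia|].
assert (0 <= t / INR K) by (apply Rdiv_le_0_compat; lra).
replace t with (INR K * (t / INR K)) at 2 by (field; lra).
replace (exp (INR K * (t / INR K))) with (exp (t / INR K) ^ K).
- apply pow_incr. split; [lra|].
  destruct (Req_dec (t / INR K) 0) as [E|E].
  + rewrite E, exp_0. lra.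
  + left. now apply exp_ineq1.
- rewrite <- Rpower_pow by apply exp_pos. unfold Rpower. now rewrite ln_exp.
Qed.

(** $e^uu^{-z}\,du$ in the coordinate $u=e^w$; the 1 in the exponent is $du=u\,dw$. *)
Definition hankel_kernel (z w : C) : C := (Cexp (Cexp w) * Cexp ((1 - z) * w))%C.

Lemma continuous_hankel_kernel (z w : C) : continuous (hankel_kernel z) w.
Proof.
apply continuous_Cmult.
- apply continuous_Cexp, continuous_Cexp, continuous_id.
- apply continuous_Cexp, continuous_Cmult; [apply continuous_const | apply continuous_id].
Qed.

Lemma Cdiv_R (z : C) (r : R) : r <> 0 -> (z / r)%C = (RtoC (/ r) * z)%C.
Proof. intros H. rewrite RtoC_inv by exact H. unfold Cdiv. ring. Qed.

Lemma gamma_approx_minus_kernel (m : nat) (z w : C) : (1 <= m)%nat ->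
  (gamma_approx (INR m) m z w - hankel_kernel z w)%C =
  (((/ (1 - Cexp w / INR m)) ^ m - Cexp (INR m * (Cexp w / INR m))) * Cexp ((1 - z) * w))%C.
Proof.
intros Hm.
assert (m0 : 0 < INR m) by (apply lt_0_INR; lia).
replace (INR m * (Cexp w / INR m))%C with (Cexp w).
- unfold gamma_approx, hankel_kernel. ring.
- field. intros K. apply RtoC_inj in K. lra.
Qed.

Lemma Re_one_minus (v : C) : Re (1 - v) = 1 - Re v.
Proof. destruct v. reflexivity. Qed.

Lemma Cinv_one_minus_le (v : C) (d : R) : 0 < d -> d <= Cmod (1 - v) ->
  (1 - v)%C <> RtoC 0 /\ Cmod (/ (1 - v)) <= / d.
Proof.
intros Hd H. assert (N : (1 - v)%C <> RtoC 0) by (apply Cmod_gt_0; lra).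
split; [exact N|]. rewrite Cmod_inv by exact N. now apply Rinv_le_contravar.
Qed.

(** On the ray $\Re u=-c|u|$, hence $|1-u/m|\ge1+c|u|/m$, and both $e^u$ and $(1-u/m)^{-m}$ are at
    most $(2K/(c|u|))^K$. The error carries the additional factor $|u|^2/m$, whence 3 in place of 1
    in the second exponent. *)
Lemma Cmod_kernel_ray_le (z : C) (K : nat) (c s phi th : R) :
  0 < c -> cos phi = - c -> - th <= phi <= th -> (1 <= K)%nat ->
  Cmod (hankel_kernel z (s, phi)) <=
    (2 * INR K / c) ^ K * exp (Rabs (Im z) * th) * exp ((1 - Re z - INR K) * s) /\
  forall m, (K <= m)%nat ->
  Cmod (gamma_approx (INR m) m z (s, phi) - hankel_kernel z (s, phi)) <=
    / INR m * ((2 * INR K / c) ^ K * exp (Rabs (Im z) * th) * exp ((3 - Re z - INR K) * s)).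
Proof.
intros Hc Hcos Hphi HK.
assert (K0 : 0 < INR K) by (apply lt_0_INR; lia).
pose proof (exp_pos s) as Ps.
assert (Hcs : 0 < c * exp s) by nra.
assert (Hq : 0 < c * exp s / (2 * INR K)) by (apply Rdiv_lt_0_compat; lra).
assert (HE : Cmod (Cexp ((1 - z) * (s, phi))) <= exp ((1 - Re z) * s) * exp (Rabs (Im z) * th)).
{ eapply Rle_trans; [now apply (Cmod_Cexp_mult_le (1 - z) s phi th)|].
  rewrite Re_one_minus. apply Req_le. f_equal. f_equal. f_equal.
  destruct z as [x y]. cbn. rewrite Rplus_0_l. apply Rabs_Ropp. }
assert (EK : / (c * exp s / (2 * INR K)) ^ K = (2 * INR K / c) ^ K * exp (- INR K * s)).
{ rewrite <- pow_inv.
  replace (/ (c * exp s / (2 * INR K))) with (2 * INR K / c * exp (- s))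
    by (rewrite exp_Ropp; field; lra).
  rewrite Rpow_mult_distr. f_equal.
  rewrite <- Rpower_pow by apply exp_pos. unfold Rpower. rewrite ln_exp. f_equal. ring. }
assert (ReE : Re (Cexp (s, phi)) = - (c * exp s)).
{ unfold Cexp. cbn. rewrite Hcos. ring. }
split.
- unfold hankel_kernel. rewrite Cmod_mult, Cmod_Cexp, ReE.
  apply Rle_trans with (/ (c * exp s / (2 * INR K)) ^ K
    * (exp ((1 - Re z) * s) * exp (Rabs (Im z) * th))).
  + apply Rmult_le_compat; [left; apply exp_pos | apply Cmod_ge_0 | | exact HE].
    rewrite exp_Ropp. apply Rinv_le_contravar; [now apply pow_lt|].
    apply exp_ge_pow; [lra | exact HK].
  + rewrite EK. apply Req_le.
    replace ((1 - Re z - INR K) * s) with (- INR K * s + (1 - Re z) * s) by ring.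
    rewrite exp_plus. ring.
- intros m Hm.
  assert (m0 : 0 < INR m) by (apply lt_0_INR; lia).
  rewrite gamma_approx_minus_kernel by lia. rewrite Cmod_mult.
  assert (Rv : Re (Cexp (s, phi) / INR m) = - (c * exp s / INR m)).
  { rewrite Cdiv_R, Re_Rmult, ReE by lra. field. lra. }
  assert (Mv : Cmod (Cexp (s, phi) / INR m) = exp s / INR m).
  { rewrite Cdiv_R, Cmod_mult, Cmod_R, Cmod_Cexp by lra.
    rewrite Rabs_pos_eq by (left; now apply Rinv_0_lt_compat). cbn. field. lra. }
  set (v := (Cexp (s, phi) / INR m)%C) in *.
  assert (Hx : 0 < c * exp s / INR m) by (apply Rdiv_lt_0_compat; lra).
  destruct (Cinv_one_minus_le v (1 + c * exp s / INR m)) as [N I]; [lra | |].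
  { eapply Rle_trans; [|apply re_le_Cmod]. eapply Rle_trans; [|apply Rle_abs].
    rewrite Re_one_minus, Rv. lra. }
  assert (D : Cmod ((/ (1 - v)) ^ m - Cexp (INR m * v)) <=
    / INR m * ((2 * INR K / c) ^ K * exp (- INR K * s) * (exp s * exp s))).
  { eapply Rle_trans.
    - apply (Cmod_exp_approx_le v (/ (1 + c * exp s / INR m)) 1 m N I).
      + rewrite Cmod_Cexp, Rv, exp_Ropp. apply Rinv_le_contravar; [lra|].
        left. apply exp_ineq1. lra.
      + intros t Ht. rewrite <- exp_0. apply exp_le_exp. rewrite Rv. nra.
    - rewrite Mv, pow_inv, Rmult_1_r.
      replace (INR m * / (1 + c * exp s / INR m) ^ m * (exp s / INR m * (exp s / INR m)))
        with (/ INR m * (/ (1 + c * exp s / INR m) ^ m * (exp s * exp s))).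
      + apply Rmult_le_compat_l; [left; now apply Rinv_0_lt_compat|].
        apply Rmult_le_compat_r; [nra|]. rewrite <- EK.
        apply Rinv_le_contravar; [now apply pow_lt|].
        replace (c * exp s / INR m) with ((c * exp s) / INR m) by reflexivity.
        apply pow_one_plus_ge; [lra | lia].
      + field. split; [lra|]. apply pow_nonzero.
        assert (0 < c * exp s + INR m) by lra. intros E.
        assert (INR m * (1 + c * exp s / INR m) = INR m + c * exp s) by (field; lra). nra. }
  eapply Rle_trans; [apply Rmult_le_compat; [apply Cmod_ge_0 | apply Cmod_ge_0 | exact D | exact HE]|].
  apply Req_le. rewrite Rmult_assoc. f_equal.
  replace ((3 - Re z - INR K) * s) with (- INR K * s + (s + s) + (1 - Re z) * s) by ring.
  rewrite !exp_plus. ring.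
Qed.

(** Here $\Re u$ may be positive. With $x=|u|/m\le1/2$ one has $1/(1-x)\le1+2x\le e^{2x}$, so the
    m-th power stays below $e^{2|u|}$. *)
Lemma Cmod_kernel_arc_le (z : C) (a phi th : R) (m : nat) :
  - th <= phi <= th -> 2 * exp a <= INR m ->
  Cmod (gamma_approx (INR m) m z (a, phi) - hankel_kernel z (a, phi)) <=
    / INR m * (exp (2 * exp a) * (exp a * exp a * exp 1)
               * (exp (Re (1 - z) * a) * exp (Rabs (Im (1 - z)) * th))).
Proof.
intros Hphi Hm. pose proof (exp_pos a) as Pa.
assert (m0 : 0 < INR m) by lra.
assert (m1 : (1 <= m)%nat).
{ destruct m; [cbn in m0; lra | lia]. }
rewrite gamma_approx_minus_kernel by exact m1. rewrite Cmod_mult, <- Rmult_assoc.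
apply Rmult_le_compat; [apply Cmod_ge_0 | apply Cmod_ge_0 | | now apply Cmod_Cexp_mult_le].
assert (Mv : Cmod (Cexp (a, phi) / INR m) = exp a / INR m).
{ rewrite Cdiv_R, Cmod_mult, Cmod_R, Cmod_Cexp by lra.
  rewrite Rabs_pos_eq by (left; now apply Rinv_0_lt_compat). cbn. field. lra. }
set (v := (Cexp (a, phi) / INR m)%C) in *.
assert (Hx : 0 < exp a / INR m) by (apply Rdiv_lt_0_compat; lra).
assert (Hx2 : exp a / INR m <= / 2).
{ apply (Rmult_le_reg_r (2 * INR m)); [lra|].
  replace (exp a / INR m * (2 * INR m)) with (2 * exp a) by (field; lra). lra. }
assert (Rv : Rabs (Re v) <= exp a / INR m) by (rewrite <- Mv; apply re_le_Cmod).
apply Rabs_le_between in Rv.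
destruct (Cinv_one_minus_le v (1 - exp a / INR m)) as [N I]; [lra | |].
{ pose proof (Cmod_triangle_inv 1 v) as K. rewrite Cmod_1 in K. lra. }
eapply Rle_trans.
- apply (Cmod_exp_approx_le v (/ (1 - exp a / INR m)) (exp 1) m N I).
  + rewrite Cmod_Cexp. apply Rle_trans with (exp (exp a / INR m)); [apply exp_le_exp; lra|].
    rewrite <- (Ropp_involutive (exp a / INR m)) at 1. rewrite exp_Ropp.
    apply Rinv_le_contravar; [lra|].
    pose proof (exp_ineq1 (- (exp a / INR m)) ltac:(lra)). lra.
  + intros t Ht. apply exp_le_exp. nra.
- rewrite Mv.
  replace (INR m * (/ (1 - exp a / INR m)) ^ m * (exp a / INR m * (exp a / INR m) * exp 1))
    with (/ INR m * ((/ (1 - exp a / INR m)) ^ m * (exp a * exp a * exp 1))).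
  + apply Rmult_le_compat_l; [left; now apply Rinv_0_lt_compat|].
    apply Rmult_le_compat_r; [pose proof (exp_pos 1); nra|].
    replace (2 * exp a) with (2 * (exp a / INR m) * INR m) by (field; lra).
    replace (exp (2 * (exp a / INR m) * INR m)) with (exp (2 * (exp a / INR m)) ^ m).
    * apply pow_incr. split; [left; apply Rinv_0_lt_compat; lra|].
      apply Rle_trans with (1 + 2 * (exp a / INR m)).
      -- apply (Rmult_le_reg_r (1 - exp a / INR m)); [lra|].
         rewrite Rinv_l by lra. nra.
      -- left. apply exp_ineq1. lra.
    * rewrite <- Rpower_pow by apply exp_pos. unfold Rpower. rewrite ln_exp. f_equal. ring.
  + field. lra.
Qed.

Lemma INR_ge_exists (x : R) : exists n : nat, (1 <= n)%nat /\ x <= INR n.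
Proof.
destruct (INR_unbounded x) as [n Hn]. exists (S n). split; [lia|]. rewrite S_INR. lra.
Qed.

Lemma cos_lt_0_Hankel (th : R) : PI / 2 < th <= PI -> 0 < - cos th.
Proof. intros H. pose proof PI_RGT_0. pose proof (cos_lt_0 th ltac:(lra) ltac:(lra)). lra. Qed.

Lemma exp_le_weight (q a s : R) : q <= - 1 -> a <= s ->
  exp (q * s) <= exp ((q + 1) * a) * exp (- s).
Proof.
intros Hq Hs. rewrite <- exp_plus. apply exp_le_exp. nra.
Qed.

Lemma hankel_kernel_bound (z : C) (a th : R) : PI / 2 < th <= PI ->
  exists M, 0 <= M /\ forall s, a <= s ->
    Cmod (hankel_kernel z (s, th)) <= M * exp (- s) /\
    Cmod (hankel_kernel z (s, - th)) <= M * exp (- s).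
Proof.
intros Hth. pose proof (cos_lt_0_Hankel th Hth) as Hc. pose proof PI_RGT_0.
(* This [K] makes the exponent [1 - Re z - INR K] at most -1, as the weight $e^{-s}$ requires. *)
destruct (INR_ge_exists (2 - Re z)) as (K & HK & HK2).
exists ((2 * INR K / - cos th) ^ K * exp (Rabs (Im z) * th) * exp ((1 - Re z - INR K + 1) * a)).
assert (P0 : 0 <= (2 * INR K / - cos th) ^ K * exp (Rabs (Im z) * th)).
{ apply Rmult_le_pos; [|left; apply exp_pos]. apply pow_le, Rdiv_le_0_compat; [|lra].
  pose proof (pos_INR K). lra. }
split; [apply Rmult_le_pos; [exact P0 | left; apply exp_pos]|].
intros s Hs.
assert (W := exp_le_weight (1 - Re z - INR K) a s ltac:(lra) Hs).
split; eapply Rle_trans;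
  try (apply (Cmod_kernel_ray_le z K (- cos th) s _ th); try lra; try exact HK;
       rewrite ?cos_neg; lra);
  rewrite (Rmult_assoc _ _ (exp (- s))); now apply Rmult_le_compat_l.
Qed.

(** One constant for rays and arc together, so that the error of the contour integral is
    $O(1/m)$. *)
Lemma gamma_approx_uniform (z : C) (a th : R) : PI / 2 < th <= PI ->
  exists M, 0 <= M /\ exists m0 : nat, forall m, (m0 <= m)%nat ->
    (1 <= m)%nat /\ exp a < INR m /\
    (forall s, a <= s ->
      Cmod (gamma_approx (INR m) m z (s, th) - hankel_kernel z (s, th)) <= / INR m * M * exp (- s) /\
      Cmod (gamma_approx (INR m) m z (s, - th) - hankel_kernel z (s, - th)) <= / INR m * M * exp (- s)) /\
    (forall phi, - th <= phi <= th ->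
      Cmod (gamma_approx (INR m) m z (a, phi) - hankel_kernel z (a, phi)) <= / INR m * M).
Proof.
intros Hth. pose proof (cos_lt_0_Hankel th Hth) as Hc. pose proof PI_RGT_0.
(* Two more than for the kernel alone, because of the factor $|u|^2$ in the error. *)
destruct (INR_ge_exists (4 - Re z)) as (K & HK & HK2).
destruct (INR_ge_exists (2 * exp a)) as (m1 & Hm1 & Hm1').
pose (M1 := (2 * INR K / - cos th) ^ K * exp (Rabs (Im z) * th) * exp ((3 - Re z - INR K + 1) * a)).
pose (M2 := exp (2 * exp a) * (exp a * exp a * exp 1)
               * (exp (Re (1 - z) * a) * exp (Rabs (Im (1 - z)) * th))).
assert (P0 : 0 <= (2 * INR K / - cos th) ^ K * exp (Rabs (Im z) * th)).
{ apply Rmult_le_pos; [|left; apply exp_pos]. apply pow_le, Rdiv_le_0_compat; [|lra].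
  pose proof (pos_INR K). lra. }
assert (PM1 : 0 <= M1) by (apply Rmult_le_pos; [exact P0 | left; apply exp_pos]).
assert (PM2 : 0 <= M2).
{ unfold M2. repeat apply Rmult_le_pos; left; apply exp_pos. }
exists (M1 + M2). split; [lra|]. exists (max K m1). intros m Hm.
assert (m0 : 0 < INR m) by (apply lt_0_INR; lia).
assert (im0 : 0 < / INR m) by now apply Rinv_0_lt_compat.
assert (Hm2 : 2 * exp a <= INR m).
{ eapply Rle_trans; [exact Hm1'|]. apply le_INR. lia. }
pose proof (exp_pos a).
split; [lia|]. split; [lra|]. split.
- intros s Hs.
  assert (W := exp_le_weight (3 - Re z - INR K) a s ltac:(lra) Hs).
  assert (HmK : (K <= m)%nat) by lia.
  assert (Q : / INR m * ((2 * INR K / - cos th) ^ K * exp (Rabs (Im z) * th) * exp ((3 - Re z - INR K) * s))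
    <= / INR m * (M1 + M2) * exp (- s)).
  { rewrite (Rmult_assoc (/ INR m) (M1 + M2)). apply Rmult_le_compat_l; [lra|].
    apply Rle_trans with (M1 * exp (- s)).
    - unfold M1. rewrite (Rmult_assoc _ _ (exp (- s))). now apply Rmult_le_compat_l.
    - apply Rmult_le_compat_r; [left; apply exp_pos | lra]. }
  split; (eapply Rle_trans; [|exact Q]);
  (apply (Cmod_kernel_ray_le z K (- cos th) s _ th); try lra; try exact HK; try exact HmK;
       rewrite ?cos_neg; lra).
- intros phi Hphi. eapply Rle_trans; [now apply (Cmod_kernel_arc_le z a phi th m)|].
  apply Rmult_le_compat_l; [lra|]. fold M2. lra.
Qed.

(** [gamma_approx_val] at $N=m$ for the exponent $m$, with $m=n+2$: the reciprocal of Gauss's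
    quotient up to a factor tending to 1. *)
Definition gamma_seq (z : C) (n : nat) : C :=
  (Crising z n * Cexp ((1 - z) * ln (INR (S (S n)))) / INR (fact (S n)))%C.

Lemma Cmult_div_cancel (X l : C) : X <> RtoC 0 -> (X * (l / X))%C = l.
Proof. intros H. field. exact H. Qed.

Lemma two_PI_Ci_neq_0 : (2 * PI * Ci)%C <> RtoC 0.
Proof.
pose proof PI_RGT_0. intros K. apply (f_equal Im) in K. cbn in K. lra.
Qed.

(** The integral converges by the decay of the kernel. That [gamma_seq] converges is then deduced
    from the integral, with no prior knowledge of the Gamma function. *)
Lemma hankel_kernel_integral (z : C) (a th : R) : PI / 2 < th <= PI ->
  exists H, is_hankel_log (hankel_kernel z) a th (2 * PI * Ci * H)%C /\
    filterlim (gamma_seq z) eventually (locally H).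
Proof.
intros Hth. pose proof PI_RGT_0.
destruct (hankel_kernel_bound z a th Hth) as (B & HB & Bd).
assert (RC : forall phi, ray_continuous (hankel_kernel z) a phi).
{ intros phi s _. apply continuous_hankel_kernel. }
destruct (ex_ray_int (hankel_kernel z) a a th B (Rle_refl _) (RC th)) as [l1 Hl1].
{ intros s Hs. exact (proj1 (Bd s Hs)). }
destruct (ex_ray_int (hankel_kernel z) a a (- th) B (Rle_refl _) (RC (- th))) as [l2 Hl2].
{ intros s Hs. exact (proj2 (Bd s Hs)). }
pose proof (is_hankel_log_rays _ _ _ _ _ Hl1 Hl2) as HL.
set (l := (arc_int (hankel_kernel z) a th + l1 - l2)%C) in HL.
pose proof two_PI_Ci_neq_0 as N0.
exists (l / (2 * PI * Ci))%C. split.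
{ rewrite Cmult_div_cancel by exact N0. exact HL. }
destruct (gamma_approx_uniform z a th Hth) as (M & HM & m0 & HU).
assert (HC : hankel_continuous (hankel_kernel z) a th).
{ split; [apply RC | split; [apply RC|]]. intros phi _. apply continuous_hankel_kernel. }
(* From this index on, [Re z] plus the number of integrations by parts is positive. *)
destruct (INR_ge_exists (- Re z)) as (n1 & _ & Hn1).
assert (D : forall n, (m0 + n1 <= n)%nat ->
  Cmod (2 * PI * Ci * gamma_seq z n - l) <= (2 * th + 2 * exp (- a)) * (/ INR (S (S n)) * M)).
{ intros n Hn. pose (m := S (S n)).
  destruct (HU m ltac:(unfold m; lia)) as (Hm1 & Hma & U1 & U2).
  assert (Hm : 0 < INR m) by (apply lt_0_INR; lia).
  assert (Ha : a < ln (INR m)).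
  { rewrite <- (ln_exp a). apply ln_increasing; [apply exp_pos | exact Hma]. }
  assert (G : is_hankel_log (gamma_approx (INR m) m z) a th (2 * PI * Ci * gamma_seq z n)%C).
  { unfold gamma_seq. fold m. rewrite <- (gamma_approx_val_S (INR m) n z Hm).
    apply is_hankel_log_gamma_approx; try assumption; try lra.
    rewrite S_INR. assert (INR n1 <= INR n) by (apply le_INR; lia). lra. }
  apply (Cmod_limit_le (F := Rbar_locally p_infty)
    (fun b => hankel_cut (gamma_approx (INR m) m z) a b th - hankel_cut (hankel_kernel z) a b th)%C).
  - now apply filterlim_Cminus.
  - generalize (Rbar_locally_p_infty_ge a). apply filter_imp. intros b Hb.
    pose proof (hankel_continuous_gamma_approx (INR m) m z a th Hm Ha ltac:(lra)) as HG.
    replace (hankel_cut (gamma_approx (INR m) m z) a b th - hankel_cut (hankel_kernel z) a b th)%C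
      with (hankel_cut (fun w => gamma_approx (INR m) m z w - 1 * hankel_kernel z w)%C a b th).
    + apply Cmod_hankel_cut_le; try lra.
      * apply Rmult_le_pos; [left; now apply Rinv_0_lt_compat | exact HM].
      * destruct HC as (C1 & C2 & C3), HG as (G1 & G2 & G3).
        split; [|split]; intros t Ht; (apply continuous_Cminus;
          [|apply continuous_Cmult; [apply continuous_const|]]); auto.
      * intros s Hs. rewrite !Cmult_1_l. now apply U1.
      * intros phi Hphi. rewrite !Cmult_1_l. now apply U2.
    + rewrite hankel_cut_linear; try lra; try assumption. Cring. }
apply filterlim_C_Cmod. intros e He.
set (Q := (2 * th + 2 * exp (- a)) * M) in *.
assert (HQ : 0 <= Q).
{ apply Rmult_le_pos; [|exact HM]. pose proof (exp_pos (- a)). lra. }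
assert (P2 : 0 < Cmod (2 * PI * Ci)) by now apply Cmod_gt_0.
destruct (INR_ge_exists (Q / (e * Cmod (2 * PI * Ci)))) as (n2 & _ & Hn2).
exists (m0 + n1 + n2)%nat. intros n Hn.
specialize (D n ltac:(lia)).
assert (Hm : 0 < INR (S (S n))) by (apply lt_0_INR; lia).
assert (Hn3 : Q / (e * Cmod (2 * PI * Ci)) < INR (S (S n))).
{ eapply Rle_lt_trans; [exact Hn2|]. apply lt_INR. lia. }
apply (Rmult_lt_reg_l (Cmod (2 * PI * Ci))); [exact P2|].
rewrite <- Cmod_mult.
replace (2 * PI * Ci * (gamma_seq z n - l / (2 * PI * Ci)))%C
  with (2 * PI * Ci * gamma_seq z n - l)%C.
- eapply Rle_lt_trans; [exact D|].
  replace ((2 * th + 2 * exp (- a)) * (/ INR (S (S n)) * M)) with (Q / INR (S (S n)))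
    by (unfold Q; field; lra).
  apply (Rmult_lt_reg_r (INR (S (S n)))); [exact Hm|].
  replace (Q / INR (S (S n)) * INR (S (S n))) with Q by (field; lra).
  apply (Rmult_lt_compat_l (e * Cmod (2 * PI * Ci))) in Hn3; [|nra].
  replace (e * Cmod (2 * PI * Ci) * (Q / (e * Cmod (2 * PI * Ci)))) with Q in Hn3
    by (field; lra). lra.
- unfold Cminus. rewrite Cmult_plus_distr_l, <- (Cmult_div_cancel _ l N0) at 1. Cring.
Qed.

(** * Nonvanishing of the limit away from the poles, and the identification with [rCGamma] *)

Lemma ln_le_sub_1 (x : R) : 0 < x -> ln x <= x - 1.
Proof.
intros Hx. destruct (Req_dec (ln x) 0) as [E|E].
- rewrite E. apply (f_equal exp) in E. rewrite exp_ln, exp_0 in E by exact Hx. lra.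
- pose proof (exp_ineq1 (ln x) E) as K. rewrite exp_ln in K by exact Hx. lra.
Qed.

(** From $-\ln(1+t)\le1/(1+t)-1$. The remaining inequality amounts to $t^2(1+2t)\ge0$, which is
    where $-1/2$ comes from. *)
Lemma ln_one_plus_ge (t : R) : - / 2 <= t -> t - 2 * t ^ 2 <= ln (1 + t).
Proof.
intros Ht. pose proof (ln_le_sub_1 (/ (1 + t)) ltac:(apply Rinv_0_lt_compat; lra)) as K.
rewrite ln_Rinv in K by lra.
assert (E : / (1 + t) - 1 <= - (t - 2 * t ^ 2)); [|lra].
apply (Rmult_le_reg_r (1 + t)); [lra|].
rewrite Rmult_minus_distr_r, Rinv_l by lra.
assert (0 <= t ^ 2 * (1 + 2 * t)) by (apply Rmult_le_pos; [apply pow2_ge_0 | lra]). nra.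
Qed.

(** The terms of order $1/q$ cancel and what is left is summable over $q$. The sign of [y] decides
    which bound on the second logarithm applies. *)
Lemma ln_ratio_ge (y q : R) : 2 <= q -> 2 * Rabs y <= q ->
  - ((2 * y ^ 2 + 2 * Rabs y) / q ^ 2) <= ln (1 + y / q) - y * ln (1 + / q).
Proof.
intros Hq Hy.
assert (Hiq : 0 < / q) by (apply Rinv_0_lt_compat; lra).
assert (Hy2 : - / 2 <= y / q).
{ pose proof (Rle_abs (- y)) as K. rewrite Rabs_Ropp in K.
  apply (Rmult_le_reg_r (2 * q)); [lra|]. 
  replace (y / q * (2 * q)) with (2 * y) by (field; lra). lra. }
pose proof (ln_one_plus_ge (y / q) Hy2) as L1.
pose proof (ln_one_plus_ge (/ q) ltac:(lra)) as L2.
pose proof (ln_le_sub_1 (1 + / q) ltac:(lra)) as L3.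
replace ((2 * y ^ 2 + 2 * Rabs y) / q ^ 2) with (2 * (y / q) ^ 2 + 2 * Rabs y * (/ q) ^ 2)
  by (field; lra).
unfold Rdiv in *. set (i := / q) in *.
destruct (Rle_dec 0 y) as [P|P].
- rewrite (Rabs_pos_eq y) by exact P.
  assert (y * ln (1 + i) <= y * i) by (apply Rmult_le_compat_l; lra).
  assert (0 <= 2 * y * i ^ 2) by (pose proof (pow2_ge_0 i); nra). lra.
- rewrite (Rabs_left1 y) by lra.
  assert (- y * (i - 2 * i ^ 2) <= - y * ln (1 + i)) by (apply Rmult_le_compat_l; lra). lra.
Qed.

Lemma Re_mult_R (z : C) (r : R) : Re (z * r) = Re z * r.
Proof. destruct z as [x y]. cbn. ring. Qed.

(** The quotient of consecutive terms is $|z+n+1|\,q^{-1}(1+1/q)^{1-\Re z}$ in modulus, and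
    $|z+n+1|\ge q+(\Re z-1)$. *)
Lemma Cmod_gamma_seq_S (z : C) (n : nat) (q : R) :
  q = INR n + 2 -> 2 * Rabs (Re z - 1) <= q ->
  Cmod (gamma_seq z n) * exp (ln (1 + (Re z - 1) / q) - (Re z - 1) * ln (1 + / q))
  <= Cmod (gamma_seq z (S n)).
Proof.
intros Hq Hy.
pose proof (pos_INR n) as Pn.
assert (Q0 : 0 < q) by lra.
assert (Iq : 0 < / q) by now apply Rinv_0_lt_compat.
assert (Y : 0 < 1 + (Re z - 1) / q).
{ pose proof (Rle_abs (- (Re z - 1))) as K. rewrite Rabs_Ropp in K.
  apply (Rmult_lt_reg_r q); [exact Q0|].
  replace ((1 + (Re z - 1) / q) * q) with (q + (Re z - 1)) by (field; lra). lra. }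
assert (F0 : 0 < INR (fact (S n))) by apply INR_fact_lt_0.
assert (E2 : INR (S (S n)) = q) by (rewrite !S_INR; lra).
assert (E3 : ln (INR (S (S (S n)))) = ln q + ln (1 + / q)).
{ rewrite <- ln_mult by lra. f_equal. rewrite S_INR, E2. field. lra. }
assert (EF : INR (fact (S (S n))) = q * INR (fact (S n))).
{ change (fact (S (S n))) with (S (S n) * fact (S n))%nat. now rewrite mult_INR, E2. }
assert (Nf : forall k, RtoC (INR (fact k)) <> RtoC 0).
{ intros k K. apply RtoC_inj in K. apply (INR_fact_neq_0 k K). }
unfold gamma_seq. cbn [Crising].
rewrite !Cmod_div, !Cmod_mult, !Cmod_Cexp, !Cmod_R by apply Nf.
rewrite !Re_mult_R, Re_one_minus, E2, E3, EF, !Rabs_pos_eq by nra.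
assert (HX : q * (1 + (Re z - 1) / q) <= Cmod (z + INR (S n))).
{ eapply Rle_trans; [|apply re_le_Cmod]. eapply Rle_trans; [|apply Rle_abs].
  destruct z as [x y]. cbn [Re fst Cplus RtoC]. rewrite S_INR.
  replace (q * (1 + (x - 1) / q)) with (q + (x - 1)) by (field; lra). lra. }
rewrite Rmult_plus_distr_l, exp_plus.
replace (ln (1 + (Re z - 1) / q) - (Re z - 1) * ln (1 + / q))
  with (ln (1 + (Re z - 1) / q) + (1 - Re z) * ln (1 + / q)) by ring.
rewrite exp_plus, exp_ln by exact Y.
set (e1 := exp ((1 - Re z) * ln q)). set (e2 := exp ((1 - Re z) * ln (1 + / q))).
apply Rle_trans with
  (Cmod (Crising z n) * (q * (1 + (Re z - 1) / q)) * (e1 * e2) / (q * INR (fact (S n)))).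
- apply Req_le. field. lra.
- apply Rmult_le_compat_r; [left; apply Rinv_0_lt_compat; nra|].
  apply Rmult_le_compat_r; [apply Rmult_le_pos; left; apply exp_pos|].
  apply Rmult_le_compat_l; [apply Cmod_ge_0 | exact HX].
Qed.

Lemma Crising_neq_0 (z : C) (n : nat) : ~ CGamma_pole z -> Crising z n <> RtoC 0.
Proof.
intros H. assert (N : forall k, (z + INR k)%C <> RtoC 0).
{ intros k E. apply H. exists k. replace z with (z + INR k - INR k)%C by ring. rewrite E. ring. }
induction n as [|n IH].
- specialize (N O). cbn in N |- *. now rewrite Cplus_0_r in N.
- cbn [Crising]. apply Cmult_neq_0; [exact IH | apply N].
Qed.

Lemma gamma_seq_neq_0 (z : C) (n : nat) : ~ CGamma_pole z -> gamma_seq z n <> RtoC 0.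
Proof.
intros H. unfold gamma_seq, Cdiv.
apply Cmult_neq_0; [apply Cmult_neq_0|].
- now apply Crising_neq_0.
- apply Cexp_neq_0.
- rewrite <- RtoC_inv by apply INR_fact_neq_0. intros K. apply RtoC_inj in K.
  apply (Rinv_neq_0_compat _ (INR_fact_neq_0 (S n)) K).
Qed.

(** The modulus times $e^{-D/(n+1)}$ is eventually nondecreasing: one step loses at most $D/(n+2)^2$
    in the logarithm, and $D/(n+1)-D/(n+2)$ makes up for it. This rules out the limit 0, so the
    reciprocals converge too. *)
Lemma gamma_seq_lower_bound (z : C) : ~ CGamma_pole z ->
  exists d, 0 < d /\ exists n0, forall n, (n0 <= n)%nat -> d <= Cmod (gamma_seq z n).
Proof.
intros H. set (y := Re z - 1). set (D := 2 * y ^ 2 + 2 * Rabs y).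
assert (HD : 0 <= D) by (unfold D; pose proof (pow2_ge_0 y); pose proof (Rabs_pos y); lra).
destruct (INR_ge_exists (2 * Rabs y)) as (n0 & _ & Hn0).
pose (a := fun n => Cmod (gamma_seq z n) * exp (- (D / (INR n + 1)))).
assert (Mono : forall n, (n0 <= n)%nat -> a n <= a (S n)).
{ intros n Hn. unfold a. pose proof (pos_INR n) as Pn. apply le_INR in Hn.
  pose proof (Cmod_gamma_seq_S z n (INR n + 2) eq_refl) as K. fold y in K.
  specialize (K ltac:(lra)).
  pose proof (ln_ratio_ge y (INR n + 2) ltac:(lra) ltac:(lra)) as L. fold D in L.
  apply Rle_trans with (Cmod (gamma_seq z n)
    * exp (ln (1 + y / (INR n + 2)) - y * ln (1 + / (INR n + 2))) * exp (- (D / (INR (S n) + 1)))).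
  - rewrite Rmult_assoc, <- exp_plus. apply Rmult_le_compat_l; [apply Cmod_ge_0|].
    apply exp_le_exp. rewrite S_INR.
    assert (D / (INR n + 2) ^ 2 + D / (INR n + 1 + 1) <= D / (INR n + 1)); [|lra].
    apply (Rmult_le_reg_r ((INR n + 2) ^ 2 * (INR n + 1))); [nra|].
    replace ((D / (INR n + 2) ^ 2 + D / (INR n + 1 + 1)) * ((INR n + 2) ^ 2 * (INR n + 1)))
      with (D * ((INR n + 3) * (INR n + 1))) by (field; lra).
    replace (D / (INR n + 1) * ((INR n + 2) ^ 2 * (INR n + 1))) with (D * (INR n + 2) ^ 2)
      by (field; lra).
    apply Rmult_le_compat_l; [exact HD | nra].
  - apply Rmult_le_compat_r; [left; apply exp_pos | exact K]. }
exists (a n0). split.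
- apply Rmult_lt_0_compat; [|apply exp_pos]. now apply Cmod_gt_0, gamma_seq_neq_0.
- exists n0. intros n Hn. apply Rle_trans with (a n).
  + induction Hn as [|n Hn IH]; [lra|]. eapply Rle_trans; [exact IH | now apply Mono].
  + unfold a. rewrite <- (Rmult_1_r (Cmod (gamma_seq z n))) at 2.
    apply Rmult_le_compat_l; [apply Cmod_ge_0|].
    apply Rle_trans with (exp 0); [apply exp_le_exp | rewrite exp_0; lra].
    assert (0 <= D / (INR n + 1)); [|lra].
    apply Rdiv_le_0_compat; [exact HD|]. pose proof (pos_INR n). lra.
Qed.

Lemma ln_ratio_limit :
  filterlim (fun n => RtoC (ln (INR n) - ln (INR n + 2))) eventually (locally (RtoC 0)).
Proof.
apply filterlim_C_Cmod. intros e He.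
destruct (INR_ge_exists (2 / e)) as (n0 & Hn0 & Hn0').
exists (S n0). intros n Hn.
assert (Pn : INR n0 < INR n) by (apply lt_INR; lia).
assert (P0 : 0 < INR n0) by (apply lt_0_INR; lia).
replace (RtoC (ln (INR n) - ln (INR n + 2)) - 0)%C with (RtoC (- (ln (INR n + 2) - ln (INR n)))).
- rewrite Cmod_R, Rabs_Ropp.
  rewrite <- ln_div by lra.
  replace ((INR n + 2) / INR n) with (1 + 2 / INR n) by (field; lra).
  assert (0 < 2 / INR n) by (apply Rdiv_lt_0_compat; lra).
  pose proof (ln_le_sub_1 (1 + 2 / INR n) ltac:(lra)).
  assert (0 < ln (1 + 2 / INR n)) by (rewrite <- ln_1; apply ln_increasing; lra).
  rewrite Rabs_pos_eq by lra.
  assert (2 / INR n < e); [|lra].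
  apply (Rmult_lt_reg_r (INR n)); [lra|].
  replace (2 / INR n * INR n) with 2 by (field; lra).
  apply (Rmult_lt_reg_r (/ e)); [now apply Rinv_0_lt_compat|].
  replace (e * INR n * / e) with (INR n) by (field; lra).
  unfold Rdiv in Hn0'. lra.
- rewrite <- !RtoC_minus. f_equal. ring.
Qed.

(* The Euler-Gauss quotient differs from 1 / gamma_seq by a factor tending to 1. *)
Lemma Gauss_quotient_gamma_seq (z : C) (n : nat) : (1 <= n)%nat -> ~ CGamma_pole z ->
  (INR (fact n) * polar_pow (INR n) 0 z / Crising z n)%C =
  ((1 + / INR (S n)) * Cexp (z * RtoC (ln (INR n) - ln (INR n + 2))) * / gamma_seq z n)%C.
Proof.
intros Hn Hz.
assert (Pn : 0 < INR n) by (apply lt_0_INR; lia).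
assert (C0 := Crising_neq_0 z n Hz).
assert (N1 : RtoC (INR (S n)) <> RtoC 0).
{ intros K. apply RtoC_inj in K. rewrite S_INR in K. lra. }
assert (Nf : RtoC (INR (fact n)) <> RtoC 0).
{ intros K. apply RtoC_inj in K. apply (INR_fact_neq_0 n K). }
unfold gamma_seq, polar_pow.
replace (INR (S (S n))) with (INR n + 2) by (rewrite !S_INR; ring).
change (fact (S n)) with (S n * fact n)%nat. rewrite mult_INR, RtoC_mult.
change ((ln (INR n), 0) : C) with (RtoC (ln (INR n))).
rewrite RtoC_minus.
replace (z * (ln (INR n) - ln (INR n + 2)))%C with (z * ln (INR n) - z * ln (INR n + 2))%C by ring.
replace ((1 - z) * ln (INR n + 2))%C with (ln (INR n + 2) - z * ln (INR n + 2))%C by ring.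
rewrite !Cexp_minus, Cexp_Rexp, exp_ln by lra.
replace (RtoC (INR n + 2)) with (INR (S n) + 1)%C
  by (rewrite S_INR, !RtoC_plus, <- Cplus_assoc, <- RtoC_plus; reflexivity).
assert (N2 : (INR (S n) + 1)%C <> RtoC 0).
{ rewrite <- RtoC_plus. intros K. apply RtoC_inj in K. rewrite S_INR in K. lra. }
pose proof (Cexp_neq_0 (z * ln (INR n + 2))).
field. repeat split; assumption.
Qed.

Lemma inv_INR_S_limit :
  filterlim (fun n => (/ INR (S n))%C) eventually (locally (RtoC 0)).
Proof.
apply filterlim_C_Cmod. intros e He.
destruct (INR_ge_exists (/ e)) as (n0 & Hn0 & Hn0').
exists n0. intros n Hn. apply le_INR in Hn.
pose proof (Rinv_0_lt_compat e He) as Ie.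
replace (/ INR (S n) - 0)%C with (/ INR (S n))%C by ring.
rewrite Cmod_inv, Cmod_R, S_INR, Rabs_pos_eq; try lra.
- rewrite <- (Rinv_inv e). apply Rinv_lt_contravar; [|lra]. apply Rmult_lt_0_compat; lra.
- intros K. apply RtoC_inj in K. rewrite S_INR in K. lra.
Qed.

(** At a pole $-k$ the rising product vanishes from $n=k$ on, in agreement with the convention.
    Elsewhere [H] is not 0, so Gauss's quotients converge to its inverse and the description
    operator in [CGamma] returns that value. *)
Lemma rCGamma_limit (z H : C) : filterlim (gamma_seq z) eventually (locally H) -> rCGamma z = H.
Proof.
intros L. unfold rCGamma. destruct (excluded_middle_informative (CGamma_pole z)) as [P|P].
- apply (filterlim_C_unique (F := eventually) (gamma_seq z)); [|exact L].
  apply (filterlim_ext_loc (fun _ => RtoC 0)); [|apply filterlim_const].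
  destruct P as [k Hk]. exists k. intros n Hn.
  assert (E : Crising z n = RtoC 0).
  { induction Hn as [|n Hn IH].
    - destruct k as [|k]; cbn [Crising]; subst z; [cbn|]; ring.
    - cbn [Crising]. rewrite IH. ring. }
  unfold gamma_seq. rewrite E. unfold Cdiv. ring.
- destruct (gamma_seq_lower_bound z P) as (d & Hd & n0 & Hn0).
  assert (H0 : H <> RtoC 0).
  { intros ->. destruct (proj1 (filterlim_C_Cmod _ _) L d Hd) as [n1 Hn1].
    specialize (Hn0 (max n0 n1) ltac:(lia)). specialize (Hn1 (max n0 n1) ltac:(lia)).
    cbv beta in Hn1.
    replace (gamma_seq z (max n0 n1) - 0)%C with (gamma_seq z (max n0 n1)) in Hn1 by ring. lra. }
  replace (CGamma z) with (/ H)%C; [field; exact H0|]. symmetry.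
  unfold CGamma, Climit_seq.
  apply (iota_filterlim_locally (V := C_CompleteNormedModule)).
  apply (filterlim_ext_loc (fun n => (1 + / INR (S n))
    * Cexp (z * RtoC (ln (INR n) - ln (INR n + 2))) * / gamma_seq z n)%C).
  + exists 1%nat. intros n Hn. symmetry. now apply Gauss_quotient_gamma_seq.
  + replace (/ H)%C with ((1 + 0) * Cexp (z * 0) * / H)%C.
    2:{ replace (z * 0)%C with (RtoC 0) by ring. rewrite Cexp_0. ring. }
    apply filterlim_Cmult; [apply filterlim_Cmult|].
    * apply filterlim_Cplus; [apply filterlim_const | apply inv_INR_S_limit].
    * apply (filterlim_comp _ _ _ (fun n => RtoC (ln (INR n) - ln (INR n + 2)))
        (fun u => Cexp (z * u)) _ (locally (RtoC 0))); [apply ln_ratio_limit|].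
      apply continuous_Cexp, continuous_Cmult; [apply continuous_const | apply continuous_id].
    * apply filterlim_Cinv; assumption.
Qed.

Lemma Hankel_formula (z : C) (a th : R) : PI / 2 < th <= PI ->
  is_hankel_log (hankel_kernel z) a th (2 * PI * Ci * rCGamma z)%C.
Proof.
intros Hth. destruct (hankel_kernel_integral z a th Hth) as (H & H1 & H2).
now rewrite (rCGamma_limit z H H2).
Qed.

(** * The double series *)

Lemma Csum_list_app (a : nat -> nat -> C) (l r : list (nat * nat)) :
  Csum_list a (l ++ r) = (Csum_list a l + Csum_list a r)%C.
Proof.
induction l as [|p l IH]; [change (Csum_list a nil) with (RtoC 0); cbn [app]; ring|].
change (Csum_list a (p :: l ++ r) = (a (fst p) (snd p) + Csum_list a l + Csum_list a r)%C).
rewrite <- Cplus_assoc, <- IH. reflexivity.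
Qed.

Lemma Csum_list_cons (a : nat -> nat -> C) (p : nat * nat) (l : list (nat * nat)) :
  Csum_list a (p :: l) = (a (fst p) (snd p) + Csum_list a l)%C.
Proof. reflexivity. Qed.

Lemma Csum_list_ext (a b : nat -> nat -> C) (l : list (nat * nat)) :
  (forall n m, a n m = b n m) -> Csum_list a l = Csum_list b l.
Proof. intros H. induction l as [|p l IH]; [reflexivity|]. now rewrite !Csum_list_cons, IH, H. Qed.

Lemma Csum_list_Cmult (c : C) (a : nat -> nat -> C) (l : list (nat * nat)) :
  Csum_list (fun n m => c * a n m)%C l = (c * Csum_list a l)%C.
Proof.
induction l as [|p l IH]; [cbn; ring|]. rewrite !Csum_list_cons, IH. ring.
Qed.

Lemma Csum_list_Permutation (a : nat -> nat -> C) (l r : list (nat * nat)) :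
  Permutation l r -> Csum_list a l = Csum_list a r.
Proof.
induction 1 as [|p l r _ IH|p q l|l r s _ IH1 _ IH2].
- reflexivity.
- now rewrite !Csum_list_cons, IH.
- rewrite !Csum_list_cons. ring.
- now rewrite IH1.
Qed.

(** Defined through [Csum_list] so that the rules for concatenation and permutation serve the real
    majorants as well. *)
Definition Rsum_list (b : nat -> nat -> R) (l : list (nat * nat)) : R :=
  Re (Csum_list (fun n m => RtoC (b n m)) l).

Lemma Csum_list_RtoC (b : nat -> nat -> R) (l : list (nat * nat)) :
  Csum_list (fun n m => RtoC (b n m)) l = RtoC (Rsum_list b l).
Proof.
unfold Rsum_list. induction l as [|p l IH]; [reflexivity|].
rewrite !Csum_list_cons, IH, <- RtoC_plus. reflexivity.
Qed.

Lemma Rsum_list_nonneg (b : nat -> nat -> R) (l : list (nat * nat)) :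
  (forall n m, 0 <= b n m) -> 0 <= Rsum_list b l.
Proof.
intros H. unfold Rsum_list. induction l as [|p l IH]; [cbn; lra|].
rewrite Csum_list_cons. specialize (H (fst p) (snd p)).
change (0 <= b (fst p) (snd p) + Re (Csum_list (fun n m => RtoC (b n m)) l)). lra.
Qed.

Lemma Cmod_Csum_list_le (a : nat -> nat -> C) (b : nat -> nat -> R) (l : list (nat * nat)) :
  (forall n m, Cmod (a n m) <= b n m) -> Cmod (Csum_list a l) <= Rsum_list b l.
Proof.
intros H. unfold Rsum_list. induction l as [|p l IH]; [cbn; rewrite Cmod_0; lra|].
rewrite !Csum_list_cons. eapply Rle_trans; [apply Cmod_triangle|].
change (Cmod (a (fst p) (snd p)) + Cmod (Csum_list a l)
  <= b (fst p) (snd p) + Re (Csum_list (fun n m => RtoC (b n m)) l)).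
apply Rplus_le_compat; [apply H | exact IH].
Qed.

(** Splits off the complement of one finite index set in another, so that nested partial sums can be
    compared. *)
Lemma NoDup_incl_Permutation (l l' : list (nat * nat)) : NoDup l -> incl l l' ->
  exists r, Permutation l' (l ++ r).
Proof.
revert l'. induction l as [|p l IH]; intros l' N I.
- exists l'. apply Permutation_refl.
- inversion N as [|? ? N1 N2]; subst.
  destruct (in_split p l') as (u & v & ->); [apply I; now left|].
  destruct (IH (u ++ v) N2) as [r Hr].
  { intros q Hq. assert (Hq' : In q (u ++ p :: v)) by (apply I; now right).
    apply in_app_or in Hq'. apply in_or_app. destruct Hq' as [?|[E|?]]; auto.
    subst q. contradiction. }
  exists r. apply Permutation_sym, Permutation_trans with (p :: (u ++ v)).
  + cbn. apply perm_skip, Permutation_sym, Hr.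
  + apply Permutation_middle.
Qed.

(** Squares are cofinal among the finite index sets, and over a square the double geometric sum
    factors. *)
Definition square (K : nat) : list (nat * nat) := list_prod (seq 0 K) (seq 0 K).

Lemma in_square (K : nat) (p : nat * nat) : In p (square K) <-> (fst p < K /\ snd p < K)%nat.
Proof.
destruct p as [n m]. unfold square. rewrite in_prod_iff, !in_seq. cbn. lia.
Qed.

Lemma NoDup_square (K : nat) : NoDup (square K).
Proof.
assert (H : forall l : list nat, NoDup l -> NoDup (list_prod l (seq 0 K))); [|apply H, seq_NoDup].
intros l N1. pose proof (seq_NoDup K 0) as N.
induction N1 as [|n l Hn N1 IH]; [constructor|].
cbn [list_prod]. apply NoDup_app; [|exact IH|].
- apply FinFun.Injective_map_NoDup; [|exact N]. intros u v E. now injection E.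
- intros [u v] H1 H2. apply in_map_iff in H1. destruct H1 as (w & E & _). injection E. intros _ <-.
  apply in_prod_iff in H2. now apply Hn.
Qed.

Lemma incl_square (l : list (nat * nat)) (K : nat) :
  exists K', (K <= K')%nat /\ incl l (square K').
Proof.
exists (K + fold_right (fun p s => fst p + snd p + s + 1) 0 l)%nat. split; [lia|].
intros p Hp. apply in_square.
induction l as [|p' l IH]; [destruct Hp|]. cbn [fold_right].
destruct Hp as [->|Hp]; [lia|]. specialize (IH Hp). lia.
Qed.

Definition geom_sum (q : C) (l : list nat) : C :=
  fold_right (fun n s => (q ^ n + s)%C) (RtoC 0) l.

Lemma Csum_list_row (q1 q2 : C) (n : nat) (l : list nat) :
  Csum_list (fun n m => q1 ^ n * q2 ^ m)%C (map (fun m => (n, m)) l) =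
  (q1 ^ n * geom_sum q2 l)%C.
Proof.
induction l as [|m l IH]; [cbn; ring|].
cbn [map]. rewrite Csum_list_cons, IH.
change (geom_sum q2 (m :: l)) with (q2 ^ m + geom_sum q2 l)%C. cbn [fst snd]. ring.
Qed.

Lemma Csum_list_prod (q1 q2 : C) (l1 l2 : list nat) :
  Csum_list (fun n m => q1 ^ n * q2 ^ m)%C (list_prod l1 l2) =
  (geom_sum q1 l1 * geom_sum q2 l2)%C.
Proof.
induction l1 as [|n l1 IH]; [cbn; ring|].
cbn [list_prod]. rewrite Csum_list_app, IH, Csum_list_row.
change (geom_sum q1 (n :: l1)) with (q1 ^ n + geom_sum q1 l1)%C. ring.
Qed.

Lemma geom_sum_seq (q : C) (k K : nat) :
  ((1 - q) * geom_sum q (seq k K))%C = (q ^ k * (1 - q ^ K))%C.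
Proof.
revert k. induction K as [|K IH]; intros k; [cbn; ring|].
cbn [seq]. change (geom_sum q (k :: seq (S k) K)) with (q ^ k + geom_sum q (seq (S k) K))%C.
rewrite Cmult_plus_distr_l, IH. cbn [Cpow]. ring.
Qed.

Lemma half_lt_one (q : C) : Cmod q <= / 2 -> (1 - q)%C <> RtoC 0 /\ Cmod (/ (1 - q)) <= 2.
Proof.
intros H. pose proof (Cmod_triangle_inv 1 q) as K. rewrite Cmod_1 in K.
destruct (Cinv_one_minus_le q (/ 2)) as [N I]; [lra | lra|].
split; [exact N|]. rewrite Rinv_inv in I. exact I.
Qed.

Lemma Csum_square (q1 q2 : C) (K : nat) : Cmod q1 <= / 2 -> Cmod q2 <= / 2 ->
  Csum_list (fun n m => q1 ^ n * q2 ^ m)%C (square K) =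
  ((1 - q1 ^ K) * (1 - q2 ^ K) * (/ (1 - q1) * / (1 - q2)))%C.
Proof.
intros H1 H2. destruct (half_lt_one q1 H1) as [N1 _]. destruct (half_lt_one q2 H2) as [N2 _].
unfold square. rewrite Csum_list_prod.
assert (E : forall q, (1 - q)%C <> RtoC 0 ->
  geom_sum q (seq 0 K) = ((1 - q ^ K) * / (1 - q))%C).
{ intros q N. pose proof (geom_sum_seq q 0 K) as G. cbn [Cpow] in G. rewrite Cmult_1_l in G.
  rewrite <- G. field. exact N. }
rewrite !E by assumption. ring.
Qed.

Lemma Rsum_square_half (K : nat) :
  Rsum_list (fun n m => (/ 2) ^ n * (/ 2) ^ m) (square K) = 4 * (1 - (/ 2) ^ K) ^ 2.
Proof.
apply RtoC_inj. rewrite <- Csum_list_RtoC.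
assert (Hh : Cmod (/ 2)%R <= / 2) by (rewrite Cmod_R, Rabs_pos_eq; lra).
rewrite (Csum_list_ext _ (fun n m => RtoC (/ 2) ^ n * RtoC (/ 2) ^ m)%C).
- rewrite (Csum_square _ _ K Hh Hh).
  replace (1 - (/ 2)%R)%C with (RtoC (/ 2)) by (rewrite <- RtoC_minus; f_equal; lra).
  rewrite <- RtoC_inv, Rinv_inv, <- RtoC_pow, <- RtoC_minus, <- !RtoC_mult by lra.
  f_equal. ring.
- intros n m. rewrite RtoC_mult, !RtoC_pow. reflexivity.
Qed.

(* Uniform in q1, q2: this is what lets the double sum be integrated term by term. *)
Lemma double_geometric_tail (q1 q2 : C) (K : nat) (l : list (nat * nat)) :
  Cmod q1 <= / 2 -> Cmod q2 <= / 2 -> NoDup l -> incl (square K) l ->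
  Cmod (/ (1 - q1) * / (1 - q2) - Csum_list (fun n m => q1 ^ n * q2 ^ m)%C l) <= 20 * (/ 2) ^ K.
Proof.
intros H1 H2 N I.
destruct (half_lt_one q1 H1) as [N1 B1]. destruct (half_lt_one q2 H2) as [N2 B2].
destruct (incl_square l K) as (K' & HK' & I').
(* The arbitrary index set is enclosed between two squares, over which the sums are explicit; [r] is
   what it lacks to fill the larger one. *)
destruct (NoDup_incl_Permutation l (square K') N I') as [r Hr].
destruct (NoDup_incl_Permutation (square K) l (NoDup_square K) I) as [r0 Hr0].
set (a := fun n m => (q1 ^ n * q2 ^ m)%C).
set (b := fun n m => (/ 2) ^ n * (/ 2) ^ m).
assert (Hb : forall n m, 0 <= b n m).
{ intros n m. apply Rmult_le_pos; apply pow_le; lra. }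
assert (Hab : forall n m, Cmod (a n m) <= b n m).
{ intros n m. unfold a, b. rewrite Cmod_mult, !Cmod_pow.
  apply Rmult_le_compat; try apply pow_le, Cmod_ge_0;
  apply pow_incr; split; auto using Cmod_ge_0. }
assert (RA : forall u v, Rsum_list b (u ++ v) = Rsum_list b u + Rsum_list b v).
{ intros u v. unfold Rsum_list. now rewrite Csum_list_app. }
assert (RP : forall u v, Permutation u v -> Rsum_list b u = Rsum_list b v).
{ intros u v P. unfold Rsum_list. now rewrite (Csum_list_Permutation _ u v P). }
pose proof (RP _ _ Hr) as E1. pose proof (RP _ _ Hr0) as E2. rewrite RA in E1, E2.
pose proof (Rsum_list_nonneg b r0 Hb) as P0.
pose proof (Cmod_Csum_list_le a b r Hab) as Hr1.
unfold b in E1, E2. rewrite Rsum_square_half in E1, E2. fold b in E1, E2.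
pose proof (Csum_list_Permutation a _ _ Hr) as E3. rewrite Csum_list_app in E3.
unfold a in E3 at 1. rewrite Csum_square in E3 by assumption.
set (X := (/ (1 - q1) * / (1 - q2))%C) in *.
assert (HX : Cmod X <= 4).
{ unfold X. rewrite Cmod_mult. replace 4 with (2 * 2) by ring.
  apply Rmult_le_compat; auto using Cmod_ge_0. }
assert (HH : 0 < (/ 2) ^ K' <= (/ 2) ^ K /\ (/ 2) ^ K <= 1).
{ split; [split; [apply pow_lt; lra|]|].
  - replace K' with (K + (K' - K))%nat by lia. rewrite pow_add.
    assert (0 < (/ 2) ^ K) by (apply pow_lt; lra).
    assert ((/ 2) ^ (K' - K) <= 1) by (rewrite <- (pow1 (K' - K)); apply pow_incr; lra). nra.
  - rewrite <- (pow1 K). apply pow_incr. lra. }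
set (h := (/ 2) ^ K) in *. set (h' := (/ 2) ^ K') in *.
assert (G1 : Cmod (q1 ^ K') <= h') by (rewrite Cmod_pow; apply pow_incr; auto using Cmod_ge_0).
assert (G2 : Cmod (q2 ^ K') <= h') by (rewrite Cmod_pow; apply pow_incr; auto using Cmod_ge_0).
assert (D1 : Cmod (q1 ^ K' + q2 ^ K' - q1 ^ K' * q2 ^ K') <= 3 * h').
{ eapply Rle_trans; [apply Cmod_triangle|]. rewrite Cmod_opp, Cmod_mult.
  pose proof (Cmod_triangle (q1 ^ K') (q2 ^ K')).
  pose proof (Cmod_ge_0 (q1 ^ K')). pose proof (Cmod_ge_0 (q2 ^ K')). nra. }
(* 20 is 12 + 8: the larger square misses [X] by at most $4\cdot3h'\le12h$, and the terms in [r] are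
   majorised by $4(1-h')^2-4(1-h)^2\le8h$. *)
replace (X - Csum_list a l)%C
  with (X * (q1 ^ K' + q2 ^ K' - q1 ^ K' * q2 ^ K') + Csum_list a r)%C.
- eapply Rle_trans; [apply Cmod_triangle|]. rewrite Cmod_mult.
  pose proof (Cmod_ge_0 X). pose proof (Cmod_ge_0 (q1 ^ K' + q2 ^ K' - q1 ^ K' * q2 ^ K')).
  assert (Rsum_list b r <= 8 * h) by nra. nra.
- replace (Csum_list a r) with ((1 - q1 ^ K') * (1 - q2 ^ K') * X - Csum_list a l)%C
    by (rewrite E3; ring). ring.
Qed.

(** * Expansion of the kernel on a large contour and termwise integration *)

Definition ML2_kernel (alpha beta : R) (x y mu w : C) : C :=
  (Cexp (Cexp w) * Cexp ((1 + alpha + beta - mu) * w)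
   / ((Cexp (beta * w) - y) * (Cexp (alpha * w) - x)))%C.

Lemma hankel_cut_Csum (F : C -> C) (c : nat -> nat -> C) (k : nat -> nat -> C -> C)
  (l : list (nat * nat)) (a b th : R) : 0 <= th -> a <= b ->
  hankel_continuous F a th -> (forall n m, hankel_continuous (k n m) a th) ->
  hankel_cut (fun w => F w - Csum_list (fun n m => c n m * k n m w) l)%C a b th =
  (hankel_cut F a b th - Csum_list (fun n m => c n m * hankel_cut (k n m) a b th) l)%C.
Proof.
intros Hth Hab HF Hk. revert F HF. induction l as [|[n m] l IH]; intros F HF.
- change (Csum_list _ nil) with (RtoC 0).
  rewrite (hankel_cut_ext _ F); [Cring|]. intros w. change (Csum_list _ nil) with (RtoC 0). ring.
- rewrite Csum_list_cons. cbn [fst snd].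
  rewrite (hankel_cut_ext _
    (fun w => F w - c n m * k n m w - Csum_list (fun n m => c n m * k n m w) l)%C).
  + rewrite (IH (fun w => F w - c n m * k n m w)%C).
    * rewrite hankel_cut_linear; auto. Cring.
    * destruct HF as (F1 & F2 & F3), (Hk n m) as (K1 & K2 & K3).
      split; [|split]; intros t Ht; apply continuous_Cminus; auto;
      (apply continuous_Cmult; [apply continuous_const | auto]).
  + intros w. rewrite Csum_list_cons. cbn [fst snd]. ring.
Qed.

Lemma filterlim_Csum_list {T : Type} {F : (T -> Prop) -> Prop} {FF : Filter F}
  (f : T -> nat -> nat -> C) (L : nat -> nat -> C) (l : list (nat * nat)) :
  (forall n m, filterlim (fun t => f t n m) F (locally (L n m))) ->
  filterlim (fun t => Csum_list (f t) l) F (locally (Csum_list L l)).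
Proof.
intros H. induction l as [|p l IH].
- apply filterlim_const.
- rewrite Csum_list_cons.
  apply (filterlim_ext (fun t => f t (fst p) (snd p) + Csum_list (f t) l)%C); [reflexivity|].
  now apply filterlim_Cplus.
Qed.

Lemma RtoC_neq_0 (r : R) : r <> 0 -> RtoC r <> RtoC 0.
Proof. intros H E. now apply RtoC_inj in E. Qed.

Lemma Cmod_ratio_le_half (x : C) (k s phi : R) : 2 * Cmod x <= exp (k * s) ->
  Cmod (x / Cexp (k * (s, phi))) <= / 2.
Proof.
intros H. rewrite Cmod_div, Cmod_Cexp, Re_Rmult by apply Cexp_neq_0. cbn [Re fst].
pose proof (exp_pos (k * s)).
apply (Rmult_le_reg_r (exp (k * s))); [assumption|].
unfold Rdiv. rewrite Rmult_assoc, Rinv_l by lra. lra.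
Qed.

Lemma Cminus_ratio (x z : C) : z <> RtoC 0 -> (z - x)%C = (z * (1 - x / z))%C.
Proof. intros H. field. exact H. Qed.

(** Taking $u^\alpha$ and $u^\beta$ out of the two factors of the denominator uses up the exponent
    $\alpha+\beta$ of the numerator; Hankel's kernel for [mu] remains. *)
Lemma ML2_kernel_expand (alpha beta : R) (x y mu w : C) :
  Cmod (x / Cexp (alpha * w)) <= / 2 -> Cmod (y / Cexp (beta * w)) <= / 2 ->
  ML2_kernel alpha beta x y mu w =
  (hankel_kernel mu w
   * (/ (1 - x / Cexp (alpha * w)) * / (1 - y / Cexp (beta * w))))%C.
Proof.
intros Hx Hy. unfold ML2_kernel, hankel_kernel.
destruct (half_lt_one _ Hx) as [Nx _]. destruct (half_lt_one _ Hy) as [Ny _].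
pose proof (Cexp_neq_0 (alpha * w)) as Na. pose proof (Cexp_neq_0 (beta * w)) as Nb.
rewrite (Cminus_ratio y _ Nb), (Cminus_ratio x _ Na).
replace ((1 + alpha + beta - mu) * w)%C with ((1 - mu) * w + alpha * w + beta * w)%C by ring.
rewrite !Cexp_plus.
generalize dependent (1 - x / Cexp (alpha * w))%C. intros X HX.
generalize dependent (1 - y / Cexp (beta * w))%C. intros Y HY.
field. repeat split; assumption.
Qed.

(** Multiplying by $u^{-n\alpha-m\beta}$ only shifts the parameter, so each term of the expansion is
    again a Hankel kernel. *)
Lemma ML2_term_kernel (alpha beta : R) (x y mu : C) (n m : nat) (w : C) :
  (x ^ n * y ^ m * hankel_kernel (INR n * alpha + INR m * beta + mu) w)%C =
  (hankel_kernel mu w * ((x / Cexp (alpha * w)) ^ n * (y / Cexp (beta * w)) ^ m))%C.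
Proof.
unfold hankel_kernel.
replace ((1 - (INR n * alpha + INR m * beta + mu)) * w)%C
  with ((1 - mu) * w - INR n * (alpha * w) - INR m * (beta * w))%C by ring.
rewrite !Cexp_minus, <- !Cexp_pow.
assert (E : forall u v k, v <> RtoC 0 -> ((u / v) ^ k = u ^ k / v ^ k)%C).
{ intros u v k Hv. unfold Cdiv. rewrite Cpow_mult_l, Cpow_inv; auto. }
rewrite !E by apply Cexp_neq_0.
pose proof (Cpow_nz _ n (Cexp_neq_0 (alpha * w))).
pose proof (Cpow_nz _ m (Cexp_neq_0 (beta * w))).
field. split; assumption.
Qed.

Lemma ratio_le_half (alpha beta : R) (x y : C) (s phi : R) :
  2 * Cmod x <= exp (alpha * s) /\ 2 * Cmod y <= exp (beta * s) ->
  Cmod (x / Cexp (alpha * (s, phi))) <= / 2 /\ Cmod (y / Cexp (beta * (s, phi))) <= / 2.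
Proof. intros [H1 H2]. split; now apply Cmod_ratio_le_half. Qed.

Lemma continuous_ML2_kernel (alpha beta : R) (x y mu w : C) :
  Cexp (alpha * w) <> x -> Cexp (beta * w) <> y ->
  continuous (ML2_kernel alpha beta x y mu) w.
Proof.
intros Hx Hy.
assert (L : forall c : C, continuous (fun w => Cexp (c * w)) w).
{ intros c. apply continuous_Cexp, continuous_Cmult; [apply continuous_const | apply continuous_id]. }
apply continuous_Cdiv.
- apply continuous_Cmult; [|apply L]. apply continuous_Cexp, continuous_Cexp, continuous_id.
- apply continuous_Cmult; (apply continuous_Cminus; [apply L | apply continuous_const]).
- apply Cmult_neq_0; now apply Cminus_neq_0.
Qed.

Lemma Cexp_neq_far (alpha beta : R) (x y : C) (s phi : R) :
  2 * Cmod x <= exp (alpha * s) /\ 2 * Cmod y <= exp (beta * s) ->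
  Cexp (alpha * (s, phi)) <> x /\ Cexp (beta * (s, phi)) <> y.
Proof.
intros [H1 H2].
pose proof (exp_pos (alpha * s)). pose proof (exp_pos (beta * s)).
split; intros E; apply (f_equal Cmod) in E; rewrite Cmod_Cexp, Re_Rmult in E;
cbn [Re fst] in E; lra.
Qed.

Lemma ML2_kernel_sum_bound (alpha beta : R) (x y mu w : C) (M : R) (K : nat) (l : list (nat * nat)) :
  Cmod (x / Cexp (alpha * w)) <= / 2 -> Cmod (y / Cexp (beta * w)) <= / 2 ->
  Cmod (hankel_kernel mu w) <= M -> NoDup l -> incl (square K) l ->
  Cmod (ML2_kernel alpha beta x y mu w - Csum_list (fun n m =>
    x ^ n * y ^ m * hankel_kernel (INR n * alpha + INR m * beta + mu) w)%C l)
  <= M * (20 * (/ 2) ^ K).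
Proof.
intros Hx Hy HM N I.
rewrite ML2_kernel_expand by assumption.
rewrite (Csum_list_ext _ _ l (fun n m => ML2_term_kernel alpha beta x y mu n m w)), Csum_list_Cmult.
match goal with |- Cmod (?k * ?u - ?k * ?v) <= _ =>
  replace (k * u - k * v)%C with (k * (u - v))%C by ring end.
rewrite Cmod_mult. apply Rmult_le_compat; try apply Cmod_ge_0; [exact HM|].
now apply double_geometric_tail.
Qed.

(** [E] is the contour integral divided by $2\pi i$. Over any finite index set containing a large
    square, the kernel minus its partial expansion is at most a multiple of $2^{-K}$ times an
    integrable weight, so the integrated partial sums approach [E]. The bound on the rays is
    exported because the contour of the given radius needs it. *)
Lemma ML2_Hankel_far (alpha beta : R) (x y mu : C) (A th : R) :
  PI / 2 < th <= PI ->
  (forall s, A <= s -> 2 * Cmod x <= exp (alpha * s) /\ 2 * Cmod y <= exp (beta * s)) ->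
  exists E,
  is_hankel_log (ML2_kernel alpha beta x y mu) A th (2 * PI * Ci * E)%C /\
  is_double_sum (ML2_term alpha beta x y mu) E /\
  exists M, forall s, A <= s ->
    Cmod (ML2_kernel alpha beta x y mu (s, th)) <= M * exp (- s) /\
    Cmod (ML2_kernel alpha beta x y mu (s, - th)) <= M * exp (- s).
Proof.
intros Hth HA. pose proof PI_RGT_0.
set (G := ML2_kernel alpha beta x y mu).
destruct (hankel_kernel_bound mu A th Hth) as (B & HB & Bd).
(* Bounds Hankel's kernel on the arc, where $\Re u\le|u|=e^A$. *)
pose (B2 := exp (exp A) * (exp (Re (1 - mu) * A) * exp (Rabs (Im (1 - mu)) * th))).
assert (HB2 : 0 <= B2).
{ unfold B2. repeat apply Rmult_le_pos; left; apply exp_pos. }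
assert (Ba : forall phi, - th <= phi <= th -> Cmod (hankel_kernel mu (A, phi)) <= B2).
{ intros phi Hphi. unfold hankel_kernel. rewrite Cmod_mult.
  apply Rmult_le_compat; try apply Cmod_ge_0; [|now apply Cmod_Cexp_mult_le].
  rewrite Cmod_Cexp. apply exp_le_exp. eapply Rle_trans; [apply Rle_abs|].
  eapply Rle_trans; [apply re_le_Cmod|]. rewrite Cmod_Cexp. cbn. lra. }
clearbody B2.
assert (CG : forall s phi, A <= s -> continuous G (s, phi)).
{ intros s phi Hs. destruct (Cexp_neq_far alpha beta x y s phi (HA s Hs)).
  now apply continuous_ML2_kernel. }
(* Each of the two geometric sums has modulus at most 2. *)
assert (BG : forall s phi, A <= s -> Cmod (G (s, phi)) <= Cmod (hankel_kernel mu (s, phi)) * (2 * 2)).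
{ intros s phi Hs. destruct (ratio_le_half alpha beta x y s phi (HA s Hs)) as [H1 H2].
  unfold G. rewrite ML2_kernel_expand, Cmod_mult by assumption.
  apply Rmult_le_compat_l; [apply Cmod_ge_0|]. rewrite Cmod_mult.
  apply Rmult_le_compat; try apply Cmod_ge_0; now apply half_lt_one. }
assert (BG2 : forall s, A <= s -> Cmod (G (s, th)) <= (B * (2 * 2)) * exp (- s) /\
    Cmod (G (s, - th)) <= (B * (2 * 2)) * exp (- s)).
{ intros s Hs. destruct (Bd s Hs) as [B1' B2'].
  pose proof (BG s th Hs). pose proof (BG s (- th) Hs). lra. }
destruct (ex_ray_int G A A th (B * (2 * 2)) (Rle_refl _)) as [l1 Hl1].
{ intros s Hs. now apply CG. }
{ intros s Hs. exact (proj1 (BG2 s Hs)). }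
destruct (ex_ray_int G A A (- th) (B * (2 * 2)) (Rle_refl _)) as [l2 Hl2].
{ intros s Hs. now apply CG. }
{ intros s Hs. exact (proj2 (BG2 s Hs)). }
pose proof (is_hankel_log_rays _ _ _ _ _ Hl1 Hl2) as HL.
set (I := (arc_int G A th + l1 - l2)%C) in HL.
pose proof two_PI_Ci_neq_0 as N0.
exists (I / (2 * PI * Ci))%C. split; [|split].
{ rewrite Cmult_div_cancel by exact N0. exact HL. }
2:{ now exists (B * (2 * 2)). }
intros e He.
(* The total weight of the contour, times the bounds on rays and arc, times the 20 of the geometric
   tail. *)
pose (Q := (2 * th + 2 * exp (- A)) * ((B + B2) * 20)).
assert (HQ : 0 <= Q).
{ apply Rmult_le_pos; [pose proof (exp_pos (- A)); lra | lra]. }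
assert (P2 : 0 < Cmod (2 * PI * Ci)) by now apply Cmod_gt_0.
assert (HK : exists K, Q * (/ 2) ^ K < e * Cmod (2 * PI * Ci)).
{ assert (D : 0 < e * Cmod (2 * PI * Ci) / (Q + 1)) by (apply Rdiv_lt_0_compat; nra).
  destruct (pow_lt_1_zero (/ 2) ltac:(rewrite Rabs_pos_eq; lra) _ D) as [K HK].
  exists K. specialize (HK K (le_n K)).
  assert (PK : 0 < (/ 2) ^ K) by (apply pow_lt; lra).
  rewrite Rabs_pos_eq in HK by lra.
  apply (Rmult_lt_compat_l (Q + 1)) in HK; [|lra].
  replace ((Q + 1) * (e * Cmod (2 * PI * Ci) / (Q + 1))) with (e * Cmod (2 * PI * Ci)) in HK
    by (field; lra). nra. }
destruct HK as [K HK].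
exists (square K). intros l Nl Il.
assert (D : Cmod (I - Csum_list (fun n m => x ^ n * y ^ m
    * (2 * PI * Ci * rCGamma (INR n * alpha + INR m * beta + mu)))%C l) <= Q * (/ 2) ^ K).
{ apply (Cmod_limit_le (F := Rbar_locally p_infty) (fun b => hankel_cut G A b th
    - Csum_list (fun n m => x ^ n * y ^ m
       * hankel_cut (hankel_kernel (INR n * alpha + INR m * beta + mu)) A b th)%C l)%C).
  - apply filterlim_Cminus; [exact HL|].
    apply (filterlim_Csum_list (fun b n m => x ^ n * y ^ m
       * hankel_cut (hankel_kernel (INR n * alpha + INR m * beta + mu)) A b th)%C).
    intros n m. apply filterlim_Cmult; [apply filterlim_const|]. now apply Hankel_formula.
  - generalize (Rbar_locally_p_infty_ge A). apply filter_imp. intros b Hb.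
    assert (HG : hankel_continuous G A th).
    { split; [|split]; intros t Ht; apply CG; lra. }
    assert (Hk : forall z, hankel_continuous (hankel_kernel z) A th).
    { intros z. split; [|split]; intros t Ht; apply continuous_hankel_kernel. }
    rewrite <- (hankel_cut_Csum G (fun n m => x ^ n * y ^ m)%C
      (fun n m => hankel_kernel (INR n * alpha + INR m * beta + mu))); auto; [|lra].
    replace (Q * (/ 2) ^ K) with ((2 * th + 2 * exp (- A)) * ((B + B2) * (20 * (/ 2) ^ K)))
      by (unfold Q; ring).
    assert (PK : 0 < (/ 2) ^ K) by (apply pow_lt; lra).
    apply Cmod_hankel_cut_le; [lra | exact Hb | nra | | |].
    + assert (CS : forall w, continuous (fun w => Csum_list (fun n m =>
        x ^ n * y ^ m * hankel_kernel (INR n * alpha + INR m * beta + mu) w)%C l) w).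
      { intros w. apply (filterlim_Csum_list (fun w n m =>
          x ^ n * y ^ m * hankel_kernel (INR n * alpha + INR m * beta + mu) w)%C).
        intros n m.
        exact (continuous_Cmult (fun _ => x ^ n * y ^ m)%C
          (hankel_kernel (INR n * alpha + INR m * beta + mu)) w
          (continuous_const _ _) (continuous_hankel_kernel _ _)). }
      destruct HG as (G1 & G2 & G3).
      split; [|split]; intros t Ht; (apply continuous_Cminus; [auto | apply CS]).
    + intros s Hs. destruct (Bd s Hs) as [Q1 Q2]. pose proof (exp_pos (- s)).
      assert (B * exp (- s) * (20 * (/ 2) ^ K) <= (B + B2) * (20 * (/ 2) ^ K) * exp (- s)).
      { assert (0 <= B2 * (20 * (/ 2) ^ K) * exp (- s)).
        { repeat apply Rmult_le_pos; lra. } nra. }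
      split; (eapply Rle_trans; [|eassumption]);
      apply ML2_kernel_sum_bound; try assumption; now apply (ratio_le_half alpha beta x y), HA.
    + intros phi Hphi. eapply Rle_trans.
      * apply ML2_kernel_sum_bound; try exact Nl; try exact Il;
          [| |now apply Ba]; now apply (ratio_le_half alpha beta x y), HA, Rle_refl.
      * apply Rmult_le_compat_r; lra. }
apply (Rmult_lt_reg_l (Cmod (2 * PI * Ci))); [exact P2|].
rewrite <- Cmod_mult.
replace (2 * PI * Ci * (Csum_list (ML2_term alpha beta x y mu) l - I / (2 * PI * Ci)))%C
  with (- (I - Csum_list (fun n m => x ^ n * y ^ m
    * (2 * PI * Ci * rCGamma (INR n * alpha + INR m * beta + mu)))%C l))%C.
- rewrite Cmod_opp. eapply Rle_lt_trans; [exact D|]. lra.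
- rewrite (Csum_list_ext _ (fun n m => 2 * PI * Ci * ML2_term alpha beta x y mu n m)%C).
  + rewrite Csum_list_Cmult. rewrite <- (Cmult_div_cancel _ I N0) at 1. ring.
  + intros n m. unfold ML2_term. ring.
Qed.

(** * Arguments, and the return to the variable zeta *)

Lemma Rabs_Arg_le (z : C) : Rabs (Arg z) <= PI.
Proof.
unfold Arg. pose proof (acos_bound (Re z / Cmod z)).
destruct (Rle_dec 0 (Im z)); apply Rabs_le; lra.
Qed.

Lemma Cexp_ln_Arg (z : C) : z <> RtoC 0 -> Cexp (ln (Cmod z), Arg z) = z.
Proof.
intros Hz. pose proof (proj1 (Cmod_gt_0 z) Hz) as P.
pose proof (re_le_Cmod z) as HR. apply Rabs_le_between in HR.
assert (HQ : -1 <= Re z / Cmod z <= 1).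
{ split; apply (Rmult_le_reg_r (Cmod z)); try exact P;
  unfold Rdiv; rewrite Rmult_assoc, Rinv_l; lra. }
assert (HS : sin (acos (Re z / Cmod z)) = Rabs (Im z) / Cmod z).
{ rewrite sin_acos by exact HQ. unfold Rsqr.
  apply sqrt_lem_1.
  - nra.
  - apply Rdiv_le_0_compat; [apply Rabs_pos | exact P].
  - apply (Rmult_eq_reg_r (Cmod z ^ 2)); [|nra].
    replace (Rabs (Im z) / Cmod z * (Rabs (Im z) / Cmod z) * Cmod z ^ 2) with (Rabs (Im z) ^ 2)
      by (field; lra).
    replace ((1 - Re z / Cmod z * (Re z / Cmod z)) * Cmod z ^ 2) with (Cmod z ^ 2 - Re z ^ 2)
      by (field; lra).
    rewrite Cmod2_alt, pow2_abs. ring. }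
rewrite (surjective_pairing z) at 3. unfold Cexp. cbn [Re Im fst snd].
rewrite exp_ln by exact P. fold (Re z) (Im z). unfold Arg.
destruct (Rle_dec 0 (Im z)) as [H|H].
- rewrite cos_acos, HS, (Rabs_pos_eq _ H) by exact HQ. f_equal; field; lra.
- rewrite cos_neg, sin_neg, cos_acos, HS, Rabs_left by lra. f_equal; field; lra.
Qed.

(** One imaginary part is strictly below $\pi$ in modulus and the other at most $\pi$, so the
    difference is less than $2\pi$. *)
Lemma Cexp_inj_Arg (w z : C) : Rabs (Im w) < PI -> z <> RtoC 0 -> Cexp w = z ->
  w = (ln (Cmod z), Arg z).
Proof.
intros Hw Hz E. apply Cexp_inj; [|now rewrite Cexp_ln_Arg].
cbn [Im snd]. pose proof (Rabs_Arg_le z). unfold Rminus.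
eapply Rle_lt_trans; [apply Rabs_triang|]. rewrite Rabs_Ropp. lra.
Qed.

Lemma RtoC_mult_pair (k s phi : R) : (k * (s, phi))%C = (k * s, k * phi).
Proof. unfold Cmult; cbn. f_equal; ring. Qed.

Lemma ln_lt_of_Rpower_lt (eps k r : R) : Rpower eps k < r -> k * ln eps < ln r.
Proof.
intros H. unfold Rpower in H. rewrite <- (ln_exp (k * ln eps)).
apply ln_increasing; [apply exp_pos | exact H].
Qed.

(** Two ways to be on the left. If $|x|$ is small, $|u^\alpha|$ exceeds it beyond [a0], and $x=0$ is
    never a value of the exponential. Otherwise the argument of $u^\alpha$ is at most
    $\theta/\beta<\pi$ in modulus, hence principal, and differs from that of $x$ at every radius.
    The strict inequality on [a0] is the margin needed by Cauchy's theorem. *)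
Lemma Omega_minus_avoid (eps alpha beta theta : R) (x : C) :
  0 < alpha -> 0 < beta -> theta / beta < PI ->
  Omega_minus (Rpower eps (1 / beta)) (theta / beta) x ->
  exists a0, a0 < ln eps / (alpha * beta) /\ forall s phi, a0 < s ->
    - (theta / (alpha * beta)) <= phi <= theta / (alpha * beta) -> Cexp (alpha * (s, phi)) <> x.
Proof.
intros Ha Hb Ht [H|[Hx [H _]]].
- destruct (Ceq_dec x 0) as [->|Hx].
  + exists (ln eps / (alpha * beta) - 1). split; [lra|]. intros s phi _ _. apply Cexp_neq_0.
  + exists (ln (Cmod x) / alpha). split.
    * pose proof (proj1 (Cmod_gt_0 x) Hx) as P.
      apply ln_increasing in H; [|exact P]. rewrite ln_Rpower in H.
      apply (Rmult_lt_reg_r alpha); [exact Ha|].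
      replace (ln (Cmod x) / alpha * alpha) with (ln (Cmod x)) by (field; lra).
      replace (ln eps / (alpha * beta) * alpha) with (1 / beta * ln eps) by (field; lra).
      exact H.
    * intros s phi Hs _ E. apply (f_equal Cmod) in E. rewrite Cmod_Cexp, Re_Rmult in E.
      cbn [Re fst] in E. rewrite <- E, ln_exp in Hs.
      replace (alpha * s / alpha) with s in Hs by (field; lra). lra.
- exists (ln eps / (alpha * beta) - 1). split; [lra|]. intros s phi _ Hphi E.
  rewrite RtoC_mult_pair in E.
  assert (B : Rabs (alpha * phi) <= theta / beta).
  { rewrite Rabs_mult, (Rabs_pos_eq alpha) by lra.
    apply Rabs_le in Hphi. apply (Rmult_le_compat_l alpha) in Hphi; [|lra].
    replace (alpha * (theta / (alpha * beta))) with (theta / beta) in Hphi by (field; lra).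
    exact Hphi. }
  apply Cexp_inj_Arg in E; [|cbn; lra | exact Hx].
  apply (f_equal Im) in E. cbn [Im snd] in E. rewrite <- E in H. lra.
Qed.

Lemma Cinv_0 : (/ 0)%C = RtoC 0.
Proof. unfold Cinv, RtoC; cbn. f_equal; unfold Rdiv; ring. Qed.

(** Valid at 0 too, since the inverse of 0 is 0; the kernel can thus be rewritten as a function, its
    poles included. *)
Lemma Cinv_mult_total (z w : C) : (/ (z * w))%C = (/ z * / w)%C.
Proof.
destruct (Ceq_dec z 0) as [->|Hz]; [rewrite Cmult_0_l, Cinv_0; ring|].
destruct (Ceq_dec w 0) as [->|Hw]; [rewrite Cmult_0_r, Cinv_0; ring|].
field. split; assumption.
Qed.

Lemma arc_int_ext (F G : C -> C) (a th : R) : (forall w, F w = G w) ->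
  arc_int F a th = arc_int G a th.
Proof. intros H. unfold arc_int. f_equal. apply CInt_ext. intros; apply H. Qed.

Definition ML2_residue (alpha beta : R) (x mu p : C) : C :=
  (Cexp (Cexp p) * Cexp ((1 + alpha + beta - mu) * p)
   / (Cexp (alpha * p) - x) / (beta * Cexp (beta * p)))%C.

(** Both contours are compared with the same vertical segment at [b]: the rectangle starting at [a]
    contains the pole, the one starting at [A] does not. *)
Lemma hankel_cut_shift (alpha beta a0 a A b th : R) (x mu p : C) :
  0 < beta -> beta * th <= PI -> Rabs (Im p) < th ->
  a0 < a -> a < Re p -> Re p < A -> A <= b ->
  (forall s phi, a0 < s -> - th <= phi <= th -> Cexp (alpha * (s, phi)) <> x) ->
  let G := ML2_kernel alpha beta x (Cexp (beta * p)) mu in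
  hankel_cut G a b th =
  (hankel_cut G A b th - 2 * PI * Ci * ML2_residue alpha beta x mu p)%C.
Proof.
intros Hb Hth Hp Ha0 Ha HA Hbb Hx G.
pose (h := fun w : C => (Cexp (Cexp w) * Cexp ((1 + alpha + beta - mu) * w)
   * / (Cexp (alpha * w) + - x))%C).
assert (EG : forall w, G w = (h w / (Cexp (beta * w) - Cexp (beta * p)))%C).
{ intros w. unfold G, h, ML2_kernel, Cdiv. rewrite Cinv_mult_total. unfold Cminus. ring. }
pose (h1 := fun w : C => (Cexp (Cexp w) * (Cexp w * 1) * Cexp ((1 + alpha + beta - mu) * w)
  + Cexp (Cexp w) * (Cexp ((1 + alpha + beta - mu) * w) * (1 + alpha + beta - mu)))%C).
pose (d1 := fun w : C => (- (Cexp (alpha * w) * alpha + 0)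
  / ((Cexp (alpha * w) + - x) * (Cexp (alpha * w) + - x)))%C).
pose (h' := fun w : C => (h1 w * / (Cexp (alpha * w) + - x)
  + Cexp (Cexp w) * Cexp ((1 + alpha + beta - mu) * w) * d1 w)%C).
assert (Ch : forall s phi, a0 < s -> - th <= phi <= th -> is_C1 h h' (s, phi)).
{ intros s phi Hs Hphi. apply is_C1_mult.
  - apply is_C1_mult.
    + apply (is_C1_Cexp Cexp (fun w => Cexp w * 1)%C).
      apply (is_C1_Cexp (fun w => w) (fun _ => RtoC 1)), is_C1_id.
    + apply is_C1_Cexp, is_C1_linear.
  - apply is_C1_inv.
    + apply is_C1_plus; [apply is_C1_Cexp, is_C1_linear | apply is_C1_const].
    + apply Cminus_neq_0. now apply Hx. }
rewrite (hankel_cut_ext _ _ a b th EG).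
rewrite (hankel_cut_residue h h' a0 a b beta th p); try lra; try assumption.
rewrite <- (arc_int_ext _ _ b th EG).
rewrite (hankel_cut_rect G A b th).
replace (rect_int G A b (- th) th) with (RtoC 0).
- unfold ML2_residue, h, Cminus, Cdiv. Cring.
- symmetry.
  apply (rect_int_0 G (fun w => h' w * / (Cexp (beta * w) + - Cexp (beta * p))
    + h w * (- (Cexp (beta * w) * beta + 0)
       / ((Cexp (beta * w) + - Cexp (beta * p)) * (Cexp (beta * w) + - Cexp (beta * p)))))%C
    (Re p) (b + 1)); try lra.
  { pose proof (Rabs_pos (Im p)). lra. }
  intros s phi Hs Hphi.
  assert (K : is_C1 (fun w => h w * / (Cexp (beta * w) + - Cexp (beta * p)))%C
    (fun w => h' w * / (Cexp (beta * w) + - Cexp (beta * p))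
    + h w * (- (Cexp (beta * w) * beta + 0)
       / ((Cexp (beta * w) + - Cexp (beta * p)) * (Cexp (beta * w) + - Cexp (beta * p)))))%C (s, phi)).
  { apply is_C1_mult; [apply Ch; lra|]. apply is_C1_inv.
    + apply is_C1_plus; [apply is_C1_Cexp, is_C1_linear | apply is_C1_const].
    (* Equal values would have equal moduli, which forces the abscissa [Re p]; this rectangle lies
       to the right of it. *)
    + apply Cminus_neq_0. intros E. apply (f_equal Cmod) in E.
      rewrite !Cmod_Cexp, !Re_Rmult in E. apply exp_inv in E. cbn [Re fst] in E. nra. }
  destruct K as [K1 K2]. split; [|exact K2].
  generalize K1. apply filter_imp. intros v (q & Q1 & Q2 & Q3). exists q.
  split; [exact Q1|]. split; [exact Q2|]. generalize Q3. apply filter_imp.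
  intros u U. rewrite !EG. exact U.
Qed.

Lemma ln_pair (k r phi : R) : k <> 0 -> ((ln r, phi) : C) = (k * ((ln r / k)%R, (phi / k)%R))%C.
Proof. intros Hk. unfold Cmult; cbn. f_equal; field; exact Hk. Qed.

(** * Change of variable between $\zeta$ and its logarithmic coordinate *)

(** The integrand times $\zeta$ is the kernel, because the $-1$ in its exponent cancels, and
    $e^{i\varphi}=\zeta/r$. The arc uses the same identity, since its integrand is $i\epsilon$ times
    that of a ray at radius $\epsilon$. *)
Lemma hankel_ray_log (alpha beta : R) (x y mu : C) (r phi : R) :
  0 < alpha -> 0 < beta -> 0 < r ->
  hankel_ray (ML2_integrand alpha beta x y mu) phi r =
  (ML2_kernel alpha beta x y mu ((ln r / (alpha * beta))%R, (phi / (alpha * beta))%R) * / r)%C.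
Proof.
intros Ha Hb Hr.
assert (Ha0 : RtoC alpha <> RtoC 0) by (apply RtoC_neq_0; lra).
assert (Hb0 : RtoC beta <> RtoC 0) by (apply RtoC_neq_0; lra).
assert (Hr0 : RtoC r <> RtoC 0) by (apply RtoC_neq_0; lra).
assert (Hk0 : alpha * beta <> 0) by nra.
set (w := ((ln r / (alpha * beta), phi / (alpha * beta)) : C)).
assert (E0 : ((ln r, phi) : C) = (alpha * beta * w)%C).
{ rewrite (ln_pair (alpha * beta) r phi Hk0), RtoC_mult. reflexivity. }
assert (E1 : Cexp (Ci * phi) = (Cexp (alpha * beta * w) * / r)%C).
{ rewrite <- E0, (Cexp_re_im (ln r, phi)). cbn [Re Im fst snd]. rewrite exp_ln by exact Hr.
  field. exact Hr0. }
unfold hankel_ray, ML2_integrand, ML2_kernel, polar_pow. rewrite E0, E1.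
replace (1 / (alpha * beta) * (alpha * beta * w))%C with w by (field; auto).
replace (1 / alpha * (alpha * beta * w))%C with (beta * w)%C by (field; auto).
replace (1 / beta * (alpha * beta * w))%C with (alpha * w)%C by (field; auto).
replace (((1 + alpha + beta - mu) / (alpha * beta) - 1) * (alpha * beta * w))%C
  with ((1 + alpha + beta - mu) * w - alpha * beta * w)%C by (field; auto).
rewrite (Cexp_minus ((1 + alpha + beta - mu) * w)).
pose proof (Cexp_neq_0 (alpha * beta * w)) as N.
unfold Cdiv. generalize (/ ((Cexp (beta * w) - y) * (Cexp (alpha * w) - x)))%C. intros D.
field. split; assumption.
Qed.

Lemma is_CInt_hankel_ray (alpha beta eps : R) (x y mu : C) (phi B : R) :
  0 < alpha -> 0 < beta -> 0 < eps -> eps <= B ->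
  ray_continuous (ML2_kernel alpha beta x y mu) (ln eps / (alpha * beta)) (phi / (alpha * beta)) ->
  is_CInt (hankel_ray (ML2_integrand alpha beta x y mu) phi) eps B
    (alpha * beta * CInt (fun s => ML2_kernel alpha beta x y mu (s, (phi / (alpha * beta))%R))
      (ln eps / (alpha * beta)) (ln B / (alpha * beta)))%C.
Proof.
intros Ha Hb He HB HC.
assert (Hk : 0 < alpha * beta) by now apply Rmult_lt_0_compat.
set (G := fun s => ML2_kernel alpha beta x y mu (s, phi / (alpha * beta))).
assert (I : is_CInt (fun r => scal (/ (alpha * beta * r)) (G (ln r / (alpha * beta)))) eps B
  (CInt G (ln eps / (alpha * beta)) (ln B / (alpha * beta)))).
{ apply (is_RInt_comp (V := C_R_CompleteNormedModule) G (fun r => ln r / (alpha * beta))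
    (fun r => / (alpha * beta * r))); rewrite Rmin_left, Rmax_right by exact HB; intros r Hr.
  - apply (continuous_comp (fun s : R => ((s, phi / (alpha * beta)) : C))
      (ML2_kernel alpha beta x y mu)); [apply continuous_horizontal|].
    apply HC. apply Rmult_le_compat_r; [left; now apply Rinv_0_lt_compat|].
    destruct (proj1 Hr) as [L|<-]; [left; now apply ln_increasing | lra].
  - split.
    + auto_derive; [lra|]. field. lra.
    + apply (ex_derive_continuous (V := R_NormedModule)). auto_derive.
      apply Rgt_not_eq, Rmult_lt_0_compat; lra. }
apply (is_CInt_Cmult _ _ _ (alpha * beta)%C) in I.
apply (is_RInt_ext (V := C_R_NormedModule) _ _ _ _ _) with (2 := I).
rewrite Rmin_left, Rmax_right by exact HB. intros r Hr. cbv beta.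
rewrite hankel_ray_log by lra.
change (@scal _ _ (/ (alpha * beta * r)) (G (ln r / (alpha * beta))))
  with (@scal R_AbsRing C_R_NormedModule (/ (alpha * beta * r)) (G (ln r / (alpha * beta)))).
rewrite scal_C_R, RtoC_inv, !RtoC_mult by nra. unfold G. Cfield.
repeat split; apply RtoC_neq_0; lra.
Qed.

Lemma is_RInt_gen_hankel_ray (alpha beta eps : R) (x y mu : C) (phi : R) (l : C) :
  0 < alpha -> 0 < beta -> 0 < eps ->
  ray_continuous (ML2_kernel alpha beta x y mu) (ln eps / (alpha * beta)) (phi / (alpha * beta)) ->
  is_ray_int (ML2_kernel alpha beta x y mu) (ln eps / (alpha * beta)) (phi / (alpha * beta)) l ->
  is_RInt_gen (V := C_R_NormedModule) (hankel_ray (ML2_integrand alpha beta x y mu) phi)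
    (at_point eps) (Rbar_locally p_infty) (alpha * beta * l)%C.
Proof.
intros Ha Hb He HC HL.
assert (Hk : 0 < alpha * beta) by now apply Rmult_lt_0_compat.
assert (L : filterlim (fun B => alpha * beta
    * CInt (fun s => ML2_kernel alpha beta x y mu (s, (phi / (alpha * beta))%R))
      (ln eps / (alpha * beta)) (ln B / (alpha * beta)))%C
    (Rbar_locally p_infty) (locally (alpha * beta * l)%C)).
{ apply filterlim_Cmult; [apply filterlim_const|].
  apply (filterlim_comp _ _ _ (fun B => ln B / (alpha * beta))
    (fun b => CInt (fun s => ML2_kernel alpha beta x y mu (s, (phi / (alpha * beta))%R))
      (ln eps / (alpha * beta)) b) _ (Rbar_locally p_infty)); [|exact HL].
  intros P [M HM]. exists (exp (alpha * beta * M)). intros B HB. apply HM.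
  apply (Rmult_lt_reg_l (alpha * beta)); [exact Hk|].
  replace (alpha * beta * (ln B / (alpha * beta))) with (ln B) by (field; lra).
  rewrite <- (ln_exp (alpha * beta * M)). apply ln_increasing; [apply exp_pos | exact HB]. }
intros P HP.
apply (Filter_prod _ _ _ (fun u => u = eps) (fun B => eps <= B /\ P (alpha * beta
    * CInt (fun s => ML2_kernel alpha beta x y mu (s, (phi / (alpha * beta))%R))
      (ln eps / (alpha * beta)) (ln B / (alpha * beta)))%C)).
- reflexivity.
- apply filter_and; [apply Rbar_locally_p_infty_ge | exact (L P HP)].
- intros u B -> [HB1 HB2]. eexists. split; [|exact HB2]. cbn [fst snd].
  now apply is_CInt_hankel_ray.
Qed.

Lemma is_CInt_hankel_arc (alpha beta eps theta : R) (x y mu : C) :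
  0 < alpha -> 0 < beta -> 0 < eps -> 0 <= theta ->
  (forall phi, - (theta / (alpha * beta)) <= phi <= theta / (alpha * beta) ->
    continuous (ML2_kernel alpha beta x y mu) (ln eps / (alpha * beta), phi)) ->
  is_CInt (hankel_arc (ML2_integrand alpha beta x y mu) eps) (- theta) theta
    (alpha * beta * arc_int (ML2_kernel alpha beta x y mu) (ln eps / (alpha * beta))
       (theta / (alpha * beta)))%C.
Proof.
intros Ha Hb He Ht HC.
assert (Hk : 0 < alpha * beta) by now apply Rmult_lt_0_compat.
set (G := fun phi => ML2_kernel alpha beta x y mu (ln eps / (alpha * beta), phi)).
assert (Hm : - theta <= theta) by lra.
assert (I : is_CInt (fun phi => scal (/ (alpha * beta)) (G (phi / (alpha * beta)))) (- theta) theta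
  (CInt G (- theta / (alpha * beta)) (theta / (alpha * beta)))).
{ apply (is_RInt_comp (V := C_R_CompleteNormedModule) G (fun phi => phi / (alpha * beta))
    (fun _ => / (alpha * beta))); rewrite Rmin_left, Rmax_right by exact Hm; intros phi Hphi.
  - apply (continuous_comp (fun phi : R => ((ln eps / (alpha * beta), phi) : C))
      (ML2_kernel alpha beta x y mu)); [apply continuous_vertical|].
    assert (0 < / (alpha * beta)) by now apply Rinv_0_lt_compat.
    apply HC. unfold Rdiv. rewrite Ropp_mult_distr_l.
    split; apply Rmult_le_compat_r; lra.
  - split; [auto_derive; [auto|]; field; lra | apply continuous_const]. }
apply (is_CInt_Cmult _ _ _ (alpha * beta * Ci)%C) in I.
replace (alpha * beta * arc_int (ML2_kernel alpha beta x y mu) (ln eps / (alpha * beta))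
       (theta / (alpha * beta)))%C
  with (alpha * beta * Ci * CInt G (- theta / (alpha * beta)) (theta / (alpha * beta)))%C.
2:{ unfold arc_int, G. replace (- theta / (alpha * beta)) with (- (theta / (alpha * beta)))
      by (field; lra). Cring. }
apply (is_RInt_ext (V := C_R_NormedModule) _ _ _ _ _) with (2 := I).
intros phi _. cbv beta.
transitivity (Ci * eps * hankel_ray (ML2_integrand alpha beta x y mu) phi eps)%C.
- rewrite hankel_ray_log by lra.
  change (@scal _ _ (/ (alpha * beta)) (G (phi / (alpha * beta))))
    with (@scal R_AbsRing C_R_NormedModule (/ (alpha * beta)) (G (phi / (alpha * beta)))).
  rewrite scal_C_R, RtoC_inv, !RtoC_mult by nra. unfold G. Cfield.
  repeat split; apply RtoC_neq_0; lra.
- unfold hankel_ray, hankel_arc. Cring.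
Qed.

Lemma is_double_sum_unique (a : nat -> nat -> C) (s t : C) :
  is_double_sum a s -> is_double_sum a t -> s = t.
Proof.
intros Hs Ht. apply (Ceq_of_close s t 2); [lra|]. intros e He.
destruct (Hs e He) as [l1 H1]. destruct (Ht e He) as [l2 H2].
destruct (incl_square l1 0) as (K1 & _ & I1). destruct (incl_square l2 K1) as (K2 & HK & I2).
specialize (H2 (square K2) (NoDup_square K2) I2).
assert (I1' : incl l1 (square K2)).
{ intros p Hp. apply I1, in_square in Hp. apply in_square. lia. }
specialize (H1 (square K2) (NoDup_square K2) I1').
replace (s - t)%C with ((Csum_list a (square K2) - t) + - (Csum_list a (square K2) - s))%C by ring.
eapply Rle_trans; [apply Cmod_triangle|]. rewrite Cmod_opp. lra.
Qed.

Lemma double_sum_eq (a : nat -> nat -> C) (s : C) : is_double_sum a s -> double_sum a = s.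
Proof.
intros H. apply (iota_unique (V := C_CompleteNormedModule)); [|exact H].
intros t Ht. now apply (is_double_sum_unique a).
Qed.

(** The [+ 1] keeps the argument of the logarithm positive when [M = 0]. *)
Lemma exp_mult_ge (k M : R) : 0 < k -> 0 <= M ->
  forall s, ln (M + 1) / k <= s -> M <= exp (k * s).
Proof.
intros Hk HM s Hs.
apply (Rmult_le_compat_l k) in Hs; [|lra].
replace (k * (ln (M + 1) / k)) with (ln (M + 1)) in Hs by (field; lra).
apply exp_le_exp in Hs. rewrite exp_ln in Hs by lra. lra.
Qed.

Theorem lemma2p2 :
  forall (alpha beta : R) (mu : C) (eps theta : R) (x y : C),
  0 < alpha < 2 -> 0 < beta < 2 -> alpha * beta < 2 ->
  0 < eps ->
  PI * alpha * beta / 2 < theta <= Rmin PI (PI * alpha * beta) ->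
  theta / beta < PI -> theta / alpha < PI ->
  Omega_minus (Rpower eps (1 / beta)) (theta / beta) x ->
  Omega_plus (Rpower eps (1 / alpha)) (theta / alpha) y ->
  ex_double_sum (ML2_term alpha beta x y mu) /\
  ex_hankel_int (ML2_integrand alpha beta x y mu) eps theta /\
  ML2 alpha beta x y mu =
    (1 / beta
       * (Cexp (Cppow y (1 / beta)) * Cppow y ((1 + alpha - mu) / beta)
          / (Cppow y (alpha / beta) - x))
     + 1 / (2 * PI * Ci) * (1 / (alpha * beta))
       * hankel_int (ML2_integrand alpha beta x y mu) eps theta)%C.
Proof.
intros alpha beta mu eps theta x y [Ha _] [Hb _] _ He [Ht1 Ht2] Hta Htb Hx [Hy1 Hy2].
pose proof PI_RGT_0 as Hpi.
assert (Hk : 0 < alpha * beta) by now apply Rmult_lt_0_compat.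
assert (Ht0 : 0 < theta) by nra.
(* Radius and opening of the contour in the variable $u=\zeta^{1/(\alpha\beta)}$, the radius on a
   logarithmic scale. The bounds on [theta] become exactly $\pi/2<th\le\pi$. *)
set (a := ln eps / (alpha * beta)). set (th := theta / (alpha * beta)).
assert (Eth : th * (alpha * beta) = theta) by (unfold th; field; lra).
assert (Hth : PI / 2 < th <= PI).
{ pose proof (Rmin_r PI (PI * alpha * beta)). split; nra. }
assert (Hbth : beta * th <= PI).
{ replace (beta * th) with (theta / alpha) by (unfold th; field; lra). lra. }
assert (Py : 0 < Cmod y).
{ eapply Rlt_trans; [|exact Hy1]. apply exp_pos. }
assert (Hy0 : y <> RtoC 0) by now apply Cmod_gt_0.
(* The principal logarithm of $y$ divided by $\beta$, that is, the pole $u=y^{1/\beta}$ in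
   logarithmic coordinate. The two conditions in [Omega_plus] place it to the right of the arc and
   strictly between the rays. *)
set (p := ((ln (Cmod y) / beta, Arg y / beta) : C)).
assert (Ep : ((ln (Cmod y), Arg y) : C) = (beta * p)%C).
{ unfold p. rewrite RtoC_mult_pair. f_equal; field; lra. }
assert (Eyp : Cexp (beta * p) = y) by (rewrite <- Ep; now apply Cexp_ln_Arg).
assert (Hpa : a < Re p).
{ apply ln_lt_of_Rpower_lt in Hy1. unfold a, p. cbn [Re fst].
  apply (Rmult_lt_reg_r beta); [exact Hb|].
  replace (ln eps / (alpha * beta) * beta) with (1 / alpha * ln eps) by (field; lra).
  replace (ln (Cmod y) / beta * beta) with (ln (Cmod y)) by (field; lra). exact Hy1. }
assert (Hpt : Rabs (Im p) < th).
{ unfold p, th. cbn [Im snd]. unfold Rdiv at 1. rewrite Rabs_mult, (Rabs_pos_eq (/ beta)).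
  - apply (Rmult_lt_reg_r beta); [exact Hb|]. rewrite Rmult_assoc, Rinv_l, Rmult_1_r by lra.
    replace (theta / (alpha * beta) * beta) with (theta / alpha) by (field; lra). exact Hy2.
  - left. now apply Rinv_0_lt_compat. }
destruct (Omega_minus_avoid eps alpha beta theta x Ha Hb Hta Hx) as (a0 & Ha0 & Hav).
fold a th in Ha0, Hav.
set (G := ML2_kernel alpha beta x y mu).
(* Far enough out for both geometric ratios to be at most 1/2 and for the pole to lie to the
   left. *)
pose (A := Rmax (ln (2 * Cmod x + 1) / alpha)
  (Rmax (ln (2 * Cmod y + 1) / beta) (Re p + 1))).
assert (HA : forall s, A <= s -> 2 * Cmod x <= exp (alpha * s) /\ 2 * Cmod y <= exp (beta * s)).
{ pose proof (Cmod_ge_0 x). intros s Hs. split.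
  - apply exp_mult_ge; [exact Ha | lra|]. eapply Rle_trans; [apply Rmax_l | exact Hs].
  - apply exp_mult_ge; [exact Hb | lra|]. eapply Rle_trans; [apply Rmax_l|].
    eapply Rle_trans; [apply Rmax_r | exact Hs]. }
assert (HpA : Re p < A).
{ assert (Re p + 1 <= A); [|lra]. eapply Rle_trans; [apply Rmax_r | apply Rmax_r]. }
clearbody A.
destruct (ML2_Hankel_far alpha beta x y mu A th Hth HA) as (E & HE & DS & M & HM).
fold G in HE, HM.
assert (CG : forall s phi, a <= s -> - th <= phi <= th -> (s, phi) <> p -> continuous G (s, phi)).
{ intros s phi Hs Hphi N. apply continuous_ML2_kernel.
  - apply Hav; lra.
  - intros E1. apply N. apply (Cexp_scal_inj beta th); try assumption. now rewrite Eyp. }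
(* The pole lies strictly inside the strip, hence on neither ray. *)
assert (Nr : forall s, (s, th) <> p /\ (s, - th) <> p).
{ apply Rabs_def2 in Hpt.
  intros s. split; intros E1; apply (f_equal Im) in E1; rewrite <- E1 in Hpt; cbn [Im snd] in Hpt; lra. }
assert (C1 : ray_continuous G a th).
{ intros s Hs. apply CG; [exact Hs | lra | apply Nr]. }
assert (C2 : ray_continuous G a (- th)).
{ intros s Hs. apply CG; [exact Hs | lra | apply Nr]. }
assert (C3 : forall phi, - th <= phi <= th -> continuous G (a, phi)).
{ intros phi Hphi. apply CG; [lra | exact Hphi|]. intros E1. rewrite <- E1 in Hpa.
  cbn [Re fst] in Hpa. lra. }
assert (HaA : a <= A) by lra.
destruct (ex_ray_int G a A th M HaA C1) as [l1 Hl1].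
{ intros s Hs. exact (proj1 (HM s Hs)). }
destruct (ex_ray_int G a A (- th) M HaA C2) as [l2 Hl2].
{ intros s Hs. exact (proj2 (HM s Hs)). }
pose proof (is_hankel_log_rays _ _ _ _ _ Hl1 Hl2) as HL.
assert (EI : (arc_int G a th + l1 - l2)%C =
  (2 * PI * Ci * E - 2 * PI * Ci * ML2_residue alpha beta x mu p)%C).
{ apply (filterlim_C_unique (F := Rbar_locally p_infty) (fun b => hankel_cut G a b th)); [exact HL|].
  apply (filterlim_ext_loc
    (fun b => hankel_cut G A b th - 2 * PI * Ci * ML2_residue alpha beta x mu p)%C).
  - generalize (Rbar_locally_p_infty_ge A). apply filter_imp. intros b HAb. unfold G.
    rewrite <- Eyp. symmetry. now apply (hankel_cut_shift alpha beta a0 a A b th x mu p).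
  - apply filterlim_Cminus; [exact HE | apply filterlim_const]. }
assert (Em : - theta / (alpha * beta) = - th) by (unfold th; field; lra).
assert (R1 : is_RInt_gen (V := C_R_NormedModule)
    (hankel_ray (ML2_integrand alpha beta x y mu) theta)
    (at_point eps) (Rbar_locally p_infty) (alpha * beta * l1)%C).
{ now apply is_RInt_gen_hankel_ray. }
assert (R2 : is_RInt_gen (V := C_R_NormedModule)
    (hankel_ray (ML2_integrand alpha beta x y mu) (- theta))
    (at_point eps) (Rbar_locally p_infty) (alpha * beta * l2)%C).
{ apply is_RInt_gen_hankel_ray; try assumption; rewrite Em; assumption. }
assert (R3 : is_CInt (hankel_arc (ML2_integrand alpha beta x y mu) eps) (- theta) theta
    (alpha * beta * arc_int G a th)%C).
{ apply is_CInt_hankel_arc; try assumption. lra. }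
(* The ray at $-\theta$ is traversed inward, from infinity to [eps]; this produces the minus sign in
   front of [l2]. *)
apply (is_RInt_gen_swap (V := C_R_NormedModule)) in R2.
split; [now exists E|]. split.
{ split; [eexists; exact R2 | split; eexists; [exact R3 | exact R1]]. }
unfold ML2. rewrite (double_sum_eq _ E DS).
unfold hankel_int.
rewrite (is_RInt_gen_unique (V := C_R_CompleteNormedModule) _ _ R1),
  (is_RInt_gen_unique (V := C_R_CompleteNormedModule) _ _ R2),
  (is_RInt_unique (V := C_R_CompleteNormedModule) _ _ _ _ R3).
change (@opp _ (alpha * beta * l2)%C) with (- (alpha * beta * l2))%C.
assert (EE : E = ((arc_int G a th + l1 - l2) / (2 * PI * Ci) + ML2_residue alpha beta x mu p)%C).
{ rewrite EI. pose proof two_PI_Ci_neq_0 as N0. revert N0.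
  generalize (2 * PI * Ci)%C. intros X N0. field. exact N0. }
assert (ER : ML2_residue alpha beta x mu p =
  (1 / beta * (Cexp (Cppow y (1 / beta)) * Cppow y ((1 + alpha - mu) / beta)
          / (Cppow y (alpha / beta) - x)))%C).
{ assert (Hb0 : RtoC beta <> RtoC 0) by (apply RtoC_neq_0; lra).
  unfold ML2_residue, Cppow, polar_pow. rewrite Ep.
  replace (1 / beta * (beta * p))%C with p by (field; exact Hb0).
  replace (alpha / beta * (beta * p))%C with (alpha * p)%C by (field; exact Hb0).
  replace ((1 + alpha - mu) / beta * (beta * p))%C with ((1 + alpha - mu) * p)%C
    by (field; exact Hb0).
  (* The factor $e^{\beta p}=y$ in the denominator of the residue uses up the $\beta$ in the
     exponent, which leaves the power $(1+\alpha-\mu)/\beta$ of $y$. *)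
  replace ((1 + alpha + beta - mu) * p)%C with ((1 + alpha - mu) * p + beta * p)%C by ring.
  rewrite Cexp_plus. pose proof (Cexp_neq_0 (beta * p)) as N.
  unfold Cdiv. generalize (/ (Cexp (alpha * p) - x))%C. intros D.
  field. split; assumption. }
rewrite EE, ER.
assert (Ha0' : RtoC alpha <> RtoC 0) by (apply RtoC_neq_0; lra).
assert (Hb0' : RtoC beta <> RtoC 0) by (apply RtoC_neq_0; lra).
rewrite Cplus_comm. f_equal. unfold Cdiv. generalize two_PI_Ci_neq_0.
generalize (2 * PI * Ci)%C. intros X N0. Cfield. repeat split; assumption.
Qed.
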